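(* Let $\chi$ be a real primitive Dirichlet character modulo $q$, $q>1$, and assume that $\theta(x,\chi)>0$ for any $x>0$. Write $c_\chi(n)=c_{\chi,1/2}(n)$. Then $$L(1,\chi)=\frac{2\pi^\delta}{q^{1/2+\delta/2}}\sum_{m=0}^\infty\sum_{n=0}^\infty c_\chi(m)\,c_\chi(n)\Bigl(\frac{2n+1}{2m+1}\Bigr)^{\frac18}K_{\frac14}\Bigl(\frac{\pi}{q}\sqrt{(2m+1)(2n+1)}\Bigr)$$ and $$L(1/2,\chi)=\frac{2\,(\pi/q)^{\frac{1+2\delta}{4}}}{\Gamma(1/4+\delta/2)}\sum_{m=0}^\infty\sum_{n=0}^\infty c_\chi(m)\,c_\chi(n)\,K_0\Bigl(\frac{\pi}{q}\sqrt{(2m+1)(2n+1)}\Bigr).$$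
   Context: $L(s,\chi)$ is the Dirichlet $L$-function, the continuation of $\sum_{n\ge1}\chi(n)n^{-s}$. Set $\delta=0$ if $\chi(-1)=1$ and $\delta=1$ if $\chi(-1)=-1$. The theta series is $\theta(x,\chi)=\sum_{n\in\mathbb{Z}}n^\delta\chi(n)e^{-\pi n^2x/q}$ for $x>0$. When $\theta(x,\chi)>0$ for all $x>0$, put $\theta(x,\chi)^\alpha=\exp(\alpha\log\theta(x,\chi))$ for real $\alpha>0$, and define the numbers $c_{\chi,\alpha}(m)$ $(m=0,1,2,\dots)$ by the expansion $$\theta(x,\chi)^\alpha=2^\alpha e^{-\frac{\pi\alpha x}{q}}\Bigl(1+\sum_{n=2}^\infty n^\delta\chi(n)e^{-\frac{\pi(n^2-1)x}{q}}\Bigr)^\alpha=2^\alpha e^{-\frac{\pi\alpha x}{q}}\sum_{j=0}^\infty\binom{\alpha}{j}\Bigl(\sum_{n=2}^\infty n^\delta\chi(n)e^{-\frac{\pi(n^2-1)x}{q}}\Bigr)^j=2^\alpha\sum_{m=0}^\infty c_{\chi,\alpha}(m)e^{-\frac{\pi(m+\alpha)x}{q}}.$$ $K_\nu$ is the $K$-Bessel function, $K_\nu(x)=\frac12\int_0^\infty e^{-\frac{x}{2}(t+\frac1t)}t^{-\nu}\frac{dt}{t}$ for $x>0$, $\nu\in\mathbb{C}$.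
   Formalization: The expansion of θ(x,χ)^{1/2} with coefficients c_χ(m) is assumed to hold for every x>0; positivity of θ alone does not give this (for χ=(·/5), q=5, θ has complex zeros, the coefficients grow exponentially and the double series diverges). *)

(* Defs.v *)
From HB Require Import structures.
From mathcomp Require Import all_boot all_order all_algebra.
From mathcomp Require Import all_classical all_reals all_analysis.
From mathcomp Require Import complex.

Set Implicit Arguments.
Unset Strict Implicit.
Unset Printing Implicit Defensive.

Import Order.TTheory GRing.Theory Num.Theory.
Import numFieldNormedType.Exports.

Local Open Scope classical_set_scope.
Local Open Scope ring_scope.
Local Open Scope complex_scope.

(* A real Dirichlet character modulo q, as a function on the integers.  The
   value chi 1 = 1 follows from the first and third clauses. *)
Definition real_dirichlet_character (R : realType) (q : nat) (chi : int -> R)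
    : Prop :=
  [/\ forall m n : int, chi (m * n) = chi m * chi n,
      forall n : int, chi (n + q%:Z) = chi n
    & forall n : int, (chi n != 0) = coprimez n q%:Z].

(* No proper divisor d of q is an induced modulus, i.e. chi is not trivial on
   the integers prime to q and congruent to 1 modulo d. *)
Definition primitive_character (R : realType) (q : nat) (chi : int -> R)
    : Prop :=
  forall d : nat, (d %| q)%N -> (d < q)%N ->
  exists n : int,
    [/\ coprimez n q%:Z, (n = 1 %[mod d%:Z])%Z & chi n != 1].

Definition parity (R : realType) (chi : int -> R) : nat :=
  if chi (-1) == 1 then 0%N else 1%N.

(* Sum over the integers: [Negz n] is -(n+1).  Only used for absolutely
   convergent families. *)
Definition bilateral_sum (R : realType) (f : int -> R) : R :=
  limn (series (fun n : nat => f (Posz n))) +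
  limn (series (fun n : nat => f (Negz n))).

Definition theta (R : realType) (q : nat) (chi : int -> R) (x : R) : R :=
  bilateral_sum (fun n : int =>
    n%:~R ^+ parity chi * chi n * expR (- (pi * n%:~R ^+ 2 * x / q%:R))).

(* c is the sequence of coefficients in the expansion
     theta(x, chi)^alpha = 2^alpha sum_m c(m) exp(- pi (m + alpha) x / q),
   which is required for every x > 0; by uniqueness of power series
   coefficients (in the variable exp(- pi x / q)) this determines c.
   For a > 0, [a `^ alpha] is exp(alpha log a). *)
Definition theta_power_coefficients (R : realType) (q : nat) (chi : int -> R)
    (alpha : R) (c : nat -> R) : Prop :=
  forall x : R, 0 < x ->
    (fun M : nat => 2 `^ alpha *
       series (fun m : nat => c m * expR (- (pi * (m%:R + alpha) * x / q%:R))) M)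
    @ \oo --> theta q chi x `^ alpha.

Definition complex_exp (R : realType) (z : R[i]) : R[i] :=
  (expR (complex.Re z))%:C *
  (cos (complex.Im z) +i* sin (complex.Im z)).

(* L is locally the sum of a convergent power series.  The ascriptions give
   R[i] the topology of its modulus. *)
Definition analytic_at (R : realType) (L : R[i] -> R[i]) (s0 : R[i]) : Prop :=
  exists2 r : R, 0 < r &
  exists a : nat -> R[i], forall s : R[i], `|s - s0| < r%:C ->
    (series (fun k : nat => a k * (s - s0) ^+ k) : nat -> (R[i] : numFieldType))
    @ \oo --> (L s : (R[i] : numFieldType)).

(* L is the (unique) analytic continuation to the whole plane of the Dirichlet
   series sum_(n >= 1) chi(n) n^-s, Re s > 1; it is entire as soon as chi is
   not principal. *)
Definition is_dirichlet_L (R : realType) (chi : int -> R) (L : R[i] -> R[i])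
    : Prop :=
  (forall s : R[i], analytic_at L s) /\
  (forall s : R[i], 1 < complex.Re s ->
    (series (fun n : nat => (chi (Posz n.+1))%:C *
        complex_exp (- s * (ln (n.+1%:R : R))%:C))
      : nat -> (R[i] : numFieldType))
    @ \oo --> (L s : (R[i] : numFieldType))).

(* Real order nu only; the integral converges absolutely for x > 0. *)
Definition besselK (R : realType) (nu x : R) : R :=
  2^-1 * Rintegral (@lebesgue_measure R) `]0, +oo[
    (fun t : R => expR (- (x / 2 * (t + t^-1))) * t `^ (- nu) / t).

(* Converges absolutely for a > 0. *)
Definition Gamma (R : realType) (a : R) : R :=
  Rintegral (@lebesgue_measure R) `]0, +oo[
    (fun t : R => t `^ (a - 1) * expR (- t)).

(* sum_m sum_n u m n converges, as an iterated series, with sum S. *)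
Definition double_series_sum (R : realType) (u : nat -> nat -> R) (S : R)
    : Prop :=
  (forall m : nat, cvgn (series (u m))) /\
  series (fun m : nat => limn (series (u m))) @ \oo --> S.

(* Main.v *)
Require Import Defs.
From HB Require Import structures.
From mathcomp Require Import all_boot all_order all_algebra.
From mathcomp Require Import all_classical all_reals all_analysis.
From mathcomp Require Import complex cyclic measurable_realfun.
From mathcomp Require Import ring lra zify.

Set Implicit Arguments.
Unset Strict Implicit.
Unset Printing Implicit Defensive.

Import Order.TTheory GRing.Theory Num.Theory.
Import numFieldNormedType.Exports.

Local Open Scope classical_set_scope.
Local Open Scope ring_scope.
Local Open Scope complex_scope.

(* By the inversion formula theta(1/x) = x^(d + 1/2) theta(x), where d = 0 or 1 is
   the parity of chi, the Mellin integral of theta(x) x^(u - 1) equals that of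
   theta^(1/2)(x) theta^(1/2)(1/x) x^(p - 1) with p = u - 1/4 - d/2.  Inserting
   the expansion of theta^(1/2) in both factors and integrating term by term gives
   the double Bessel series, while the Mellin integral is L(2u - d) times a power
   of pi / q and Gamma(u): for large u by integrating the series of theta, and then
   for all u > d / 2 because both sides are real analytic in u.  The cases u = (1 + d) / 2
   and u = 1/4 + d/2 are the two formulas.

   Term by term integration rests on c_n = O(n): the square of sum c_m z^m has
   coefficients bounded by k + 1, so Parseval bounds c_n.  The inversion formula is
   obtained, following Polya, as a limit of a finite identity between the
   trigonometric kernel (2 cos t)^(2m) and binomial coefficients; the Gauss sum
   drops out because theta(1) > 0. *)

(** * Series and real analytic functions *)

(** Why the coefficients need a polynomial bound: their series converges for every x > 0, but this
    alone gives only subexponential growth, and then the sum of |c_m| exp(- pi (m + 1/2) x / q)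
    could grow faster than every exp(C / x) as x -> 0. Under a polynomial bound that sum is at most
    a power of x times a decaying exponential. In the product of the expansions at x and at 1/x, the
    exponential of one factor then gives decay at infinity and that of the other gives decay at 0,
    so the product can be integrated against every power of x. Hence the Mellin integral of theta
    exists for all real u, and only Gamma(u) restricts the range.

    The analysis stays on the real line. L is restricted to real s, its real and imaginary parts are
    continued separately, and the identity theorem is the one for real power series, started from
    large s, where the series of theta can be integrated directly. *)

Lemma series_tail_le (R : realType) (u b : nat -> R) (K n : nat) :
  (forall k, `|u k| <= b k) -> cvgn (series b) -> (K <= n)%N ->
  `|series u n - series u K| <= limn (series b) - series b K.
Proof.
move=> ub cb Kn; rewrite sub_series_geq//.
apply: (le_trans (ler_norm_sum _ _ _)).
apply: (@le_trans _ _ (\sum_(K <= k < n) b k)); first exact: ler_sum.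
rewrite -sub_series_geq// lerD2r.
apply: nondecreasing_cvgn_le => //; apply: nondecreasing_series => i _ _.
exact: (le_trans _ (ub i)).
Qed.

Lemma dominated_series_cvg (R : realType) (u b : nat -> R) :
  (forall k, `|u k| <= b k) -> cvgn (series b) -> cvgn (series u).
Proof.
move=> ub cb; apply: normed_cvg; apply: (series_le_cvg _ _ ub cb) => // n.
exact: (le_trans _ (ub n)).
Qed.

Lemma series_lim_tail_le (R : realType) (u b : nat -> R) (K : nat) :
  (forall k, `|u k| <= b k) -> cvgn (series b) ->
  `|limn (series u) - series u K| <= limn (series b) - series b K.
Proof.
move=> ub cb; have cu := dominated_series_cvg ub cb.
have h : (fun n => `|series u n - series u K|) @ \oo
    --> `|limn (series u) - series u K|.
  by apply: cvg_norm; apply: cvgB => //; exact: cvg_cst.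
rewrite -(cvg_lim _ h)//; apply: limr_le; first by apply/cvg_ex; eexists; exact: h.
by exists K => // n /= Kn; exact: series_tail_le.
Qed.

Lemma cvg_series_pointwise (R : realType) (f : nat -> nat -> R) (g : nat -> R)
    (K : nat) :
  (forall n, f^~ n @ \oo --> g n) ->
  (fun N => series (f N) K) @ \oo --> series g K.
Proof. by move=> fg; apply: cvg_big => [|i _]; [exact: add_continuous|exact: fg]. Qed.

(** Dominated convergence for sums whose length [h N] grows. Domination is asked only inside the
    range of summation and for large N, because the Gaussian bounds to which it is applied are
    available only there. *)
Lemma tannery (R : realType) (f : nat -> nat -> R) (g b : nat -> R)
    (h : nat -> nat) :
  (forall n, f^~ n @ \oo --> g n) ->
  (\forall N \near \oo, forall n, (n < h N)%N -> `|f N n| <= b n) ->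
  cvgn (series b) -> h @ \oo --> \oo ->
  (fun N => series (f N) (h N)) @ \oo --> limn (series g).
Proof.
move=> fg fb cb hoo.
have gb n : `|g n| <= b n.
  have cn : (fun N => `|f N n|) @ \oo --> `|g n| by apply: cvg_norm; exact: fg.
  rewrite -(cvg_lim _ cn)//; apply: limr_le; first by apply/cvg_ex; eexists; exact: cn.
  near=> N; apply: (near fb) => //.
  by near: N; apply: (hoo (fun k => (n < k)%N)); exists n.+1.
have b0 n : 0 <= b n by exact: (le_trans _ (gb n)).
apply/cvgrPdist_le => e e0.
have e3 : 0 < e / 3 by rewrite divr_gt0.
have /cvgrPdist_le /(_ _ e3) [K _ HK] := cb.
have {}HK : limn (series b) - series b K <= e / 3.
  exact: le_trans (ler_norm _) (HK K (leqnn _)).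
have cK : (fun N => series (f N) K) @ \oo --> series g K.
  exact: cvg_series_pointwise.
move/cvgrPdist_le : cK => /(_ _ e3) cK.
near=> N.
have hK : (K <= h N)%N by near: N; apply: (hoo (fun k => (K <= k)%N)); exists K.
have t1 : `|series (f N) (h N) - series (f N) K| <= e / 3.
  rewrite sub_series_geq//; apply: (le_trans (ler_norm_sum _ _ _)).
  apply: le_trans HK.
  apply: (@le_trans _ _ (\sum_(K <= k < h N) b k)).
    apply: ler_sum_nat => i /andP[_ ih].
    by apply: (near fb N).
  rewrite -sub_series_geq// lerD2r.
  by apply: nondecreasing_cvgn_le => //; apply: nondecreasing_series => i _ _.
have t2 : `|series g K - series (f N) K| <= e / 3 by apply: (near cK N).
have t3 := le_trans (series_lim_tail_le K gb cb) HK.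
have -> : limn (series g) - series (f N) (h N) =
  (limn (series g) - series g K) + (series g K - series (f N) K)
  - (series (f N) (h N) - series (f N) K) by ring.
apply: (le_trans (ler_normB _ _)).
have := ler_normD (limn (series g) - series g K) (series g K - series (f N) K).
lra.
Unshelve. all: by end_near. Qed.

Lemma sum_convolution (A : pzRingType) (a b : nat -> A) (n : nat) :
  \sum_(0 <= k < n) \sum_(i < k.+1) a i * b (k - i)%N =
  \sum_(0 <= i < n) a i * \sum_(0 <= j < n - i) b j.
Proof.
elim: n => [|n IH]; first by rewrite !big_geq.
rewrite big_nat_recr//= IH [RHS]big_nat_recr//= subSnn big_nat1.
under [X in _ = X + _]eq_big_nat => i /andP[_ ilt].
  by rewrite subSn 1?ltnW// big_nat_recr//= mulrDr; over.
rewrite big_split/= -addrA; congr (_ + _).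
by rewrite big_ord_recr/= subnn big_mkord.
Qed.

(** The n-th partial sum of the Cauchy product is the sum of a_i times the partial sum of b of
    length n - i. The latter are bounded, so [tannery] applies with a multiple of |a_i| as
    dominating sequence. *)
Lemma mertens (R : realType) (a b : nat -> R) :
  cvgn [normed series a] -> cvgn (series b) ->
  series (fun n => \sum_(i < n.+1) a i * b (n - i)%N) @ \oo -->
  limn (series a) * limn (series b).
Proof.
move=> ca cb.
have E n : series (fun n => \sum_(i < n.+1) a i * b (n - i)%N) n =
    series (fun i => a i * series b (n - i)%N) n.
  exact: sum_convolution.
under eq_cvg do rewrite E.
have -> : limn (series a) * limn (series b) =
    limn (series (fun i => a i * limn (series b))).
  have ca' : cvgn (series a) by exact: normed_cvg.
  rewrite mulrC -[LHS]/(_ *: _) -lim_seriesZ//; congr (limn (series _)).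
  by apply/funext => i /=; rewrite mulrC.
have [M [_ HM]] : bounded_fun (series b) by exact: cvg_seq_bounded.
have {}HM n : `|series b n| <= M + 1 by apply: HM => //; rewrite ltrDl.
apply: (@tannery _ (fun n i => a i * series b (n - i)%N) _
  (fun i => (M + 1) *: `|a i|)).
- move=> i; apply: cvgM; first exact: cvg_cst.
  rewrite -(cvg_shiftn i) (_ : [sequence _]_n = series b) //.
  by apply/funext => n /=; rewrite addnK.
- by near=> N => i _; rewrite normrM mulrC; apply: ler_wpM2r.
- exact: is_cvg_seriesZ.
- exact: cvg_id.
Unshelve. all: by end_near. Qed.

Definition real_analytic_at (R : realType) (f : R -> R) (s0 : R) : Prop :=
  exists2 r : R, 0 < r & exists a : nat -> R, forall s, `|s - s0| < r ->
    series (fun k => a k * (s - s0) ^+ k) @ \oo --> f s.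

Lemma real_analytic_atB (R : realType) (f g : R -> R) (s0 : R) :
  real_analytic_at f s0 -> real_analytic_at g s0 ->
  real_analytic_at (fun s => f s - g s) s0.
Proof.
move=> [r r0 [a Ha]] [r' r0' [b Hb]]; exists (Num.min r r').
  by rewrite lt_min r0.
exists (fun k => a k - b k) => s; rewrite lt_min => /andP[sr sr'].
have -> : series (fun k => (a k - b k) * (s - s0) ^+ k) =
  series (fun k => a k * (s - s0) ^+ k) - series (fun k => b k * (s - s0) ^+ k).
  by rewrite -seriesN -seriesD; congr series; apply/funext => k; rewrite mulrBl.
by apply: cvgB; [exact: Ha | exact: Hb].
Qed.

Lemma pseries_cvg_norm (R : realType) (a : nat -> R) (r z : R) :
  (forall y, 0 < y < r -> cvgn (series (fun k => a k * y ^+ k))) ->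
  `|z| < r -> cvgn [normed series (fun k => a k * z ^+ k)].
Proof.
move=> ca zr.
have y_in : 0 < (`|z| + r) / 2 < r by have := normr_ge0 z; lra.
have zy : `|z| < `|(`|z| + r) / 2| by have /andP[y0 _] := y_in; rewrite (gtr0_norm y0); lra.
have {}zy : `| `|z| | < `|(`|z| + r) / 2| by rewrite normr_id.
have := is_cvg_pseries_inside_norm (ca _ y_in) zy.
rewrite (_ : pseries _ _ = [normed series (fun k => a k * z ^+ k)])//.
by congr series; apply/funext => k /=; rewrite normrM normrX.
Qed.

Lemma real_analytic_atM (R : realType) (f g : R -> R) (s0 : R) :
  real_analytic_at f s0 -> real_analytic_at g s0 ->
  real_analytic_at (fun s => f s * g s) s0.
Proof.
move=> [r r0 [a Ha]] [r' r0' [b Hb]]; exists (Num.min r r').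
  by rewrite lt_min r0.
exists (fun n => \sum_(i < n.+1) a i * b (n - i)%N) => s.
rewrite lt_min => /andP[sr sr'].
have ca y : 0 < y < r -> cvgn (series (fun k => a k * y ^+ k)).
  move=> /andP[y0 yr]; apply/cvg_ex; exists (f (s0 + y)).
  have := Ha (s0 + y); rewrite (_ : s0 + y - s0 = y); last by ring.
  by rewrite gtr0_norm//; apply.
have -> : series (fun k => (\sum_(i < k.+1) a i * b (k - i)%N) * (s - s0) ^+ k)
  = series (fun k => \sum_(i < k.+1) a i * (s - s0) ^+ i *
                      (b (k - i)%N * (s - s0) ^+ (k - i))).
  congr series; apply/funext => k; rewrite mulr_suml; apply: eq_bigr => i _.
  have -> : (s - s0) ^+ k = (s - s0) ^+ (k - i) * (s - s0) ^+ i.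
    by rewrite -exprD subnK// -ltnS.
  by ring.
rewrite -(cvg_lim _ (Ha s sr))// -(cvg_lim _ (Hb s sr'))//.
apply: (@mertens _ (fun i => a i * (s - s0) ^+ i)
                   (fun i => b i * (s - s0) ^+ i)).
  exact: pseries_cvg_norm ca sr.
by apply/cvg_ex; eexists; exact: Hb.
Qed.

(** At the point t * y with 0 < t < 1 the terms after the first sum to at most t * M, so |a_0| <= t
    * M for all such t. Only points z > 0 occur, and this one-sided form is the one needed in
    [real_analytic_eq0]. *)
Lemma pseries_coef0_eq0 (R : realType) (r : R) (a : nat -> R) : 0 < r ->
  (forall z, 0 < z < r -> series (fun k => a k * z ^+ k) @ \oo --> (0 : R)) ->
  a 0%N = 0.
Proof.
move=> r0 Ha; pose y := r / 2.
have y0 : 0 < y by rewrite /y; lra.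
have cy : cvgn [normed series (fun k => a k * y ^+ k)].
  apply: (@pseries_cvg_norm _ _ r) => [z zr|].
    by apply/cvg_ex; exists 0; exact: Ha.
  by rewrite gtr0_norm// /y; lra.
set M := limn [normed series (fun k => a k * y ^+ k)] in cy.
have MN n : \sum_(0 <= k < n) `|a k * y ^+ k| <= M.
  apply: (@nondecreasing_cvgn_le _ [normed series (fun k => a k * y ^+ k)]) => //.
  by apply: nondecreasing_series => k _ _; exact: normr_ge0.
have M0 : 0 <= M by have := MN 0%N; rewrite big_geq.
have key t : 0 < t < 1 -> `|a 0%N| <= t * M.
  move=> /andP[t0 t1]; have ty : 0 < t * y < r by rewrite /y; nra.
  have h : (fun n => `|series (fun k => a k * (t * y) ^+ k) n.+1 - a 0%N|) @ \oo
      --> `|0 - a 0%N|.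
    apply: cvg_norm; apply: cvgB; last exact: cvg_cst.
    by have := Ha _ ty; rewrite -cvg_shiftS.
  rewrite -normrN -[- _]sub0r -(cvg_lim _ h)//; apply: limr_le.
    by apply/cvg_ex; eexists; exact: h.
  near=> n; rewrite /series/= big_nat_recl// expr0 mulr1 addrC addKr.
  apply: (le_trans (ler_norm_sum _ _ _)).
  apply: (@le_trans _ _ (t * \sum_(0 <= k < n) `|a k.+1 * y ^+ k.+1|)).
    rewrite mulr_sumr; apply: ler_sum => k _.
    rewrite exprMn mulrCA normrM ler_wpM2r// normrX gtr0_norm// exprS.
    rewrite ger_pMr//; apply: exprn_ile1; lra.
  rewrite ler_pM2l//; apply: le_trans (MN n.+1).
  by rewrite big_nat_recl// lerDr.
apply/eqP; rewrite -normr_eq0; apply/negPn/negP => a0.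
have {}a0 : 0 < `|a 0%N| by rewrite lt_def a0 normr_ge0.
have d0 : 0 < `|a 0%N| + M + 1 by lra.
(* This t lies in ]0, 1[ and turns [key] into |a_0| + M + 1 <= M, after division by |a_0|. *)
have := key (`|a 0%N| / (`|a 0%N| + M + 1)).
rewrite divr_gt0// ltr_pdivrMr// mul1r.
have -> : `|a 0%N| < `|a 0%N| + M + 1 by lra.
move=> /(_ isT); rewrite mulrAC ler_pdivlMr//; nra.
Unshelve. all: by end_near. Qed.

Lemma pseries_eq0 (R : realType) (r : R) (a : nat -> R) : 0 < r ->
  (forall z, 0 < z < r -> series (fun k => a k * z ^+ k) @ \oo --> (0 : R)) ->
  forall k, a k = 0.
Proof.
move=> r0 Ha k; elim: k a Ha => [|k IH] a Ha; first exact: (pseries_coef0_eq0 r0 Ha).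
have a0 : a 0%N = 0 by exact: (pseries_coef0_eq0 r0 Ha).
rewrite -[a k.+1]/((fun k => a k.+1) k); apply: IH => z zr.
have /andP[z0 _] := zr.
have E n : series (fun k => a k.+1 * z ^+ k) n =
    z^-1 * series (fun k => a k * z ^+ k) n.+1.
  rewrite /series/= big_nat_recl// a0 mul0r add0r mulr_sumr.
  by apply: eq_bigr => i _; rewrite exprS; field; rewrite gt_eqF.
have h : (fun n => z^-1 * series (fun k => a k * z ^+ k) n.+1) @ \oo --> z^-1 * 0.
  by apply: cvgM; [exact: cvg_cst | have := Ha z zr; rewrite -cvg_shiftS].
by rewrite mulr0 in h; rewrite (funext E).
Qed.

(** Take the infimum m of the points beyond which f vanishes. If m > A, the expansion of f at m
    vanishes for small positive increments, so all its coefficients are 0 and f vanishes to the left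
    of m as well, against the choice of m. *)
Lemma real_analytic_eq0 (R : realType) (f : R -> R) (A s1 : R) :
  (forall s, A < s -> real_analytic_at f s) -> (forall s, s1 < s -> f s = 0) ->
  forall s, A < s -> f s = 0.
Proof.
move=> fA fs1; pose E := [set s | A <= s /\ forall t, s < t -> f t = 0].
have E0 : E !=set0.
  exists (Num.max A s1); split; first by rewrite le_max lexx.
  by move=> t; rewrite gt_max => /andP[_]; exact: fs1.
have lbE : has_lbound E by exists A => s [].
have infE : has_inf E by [].
have fm t : inf E < t -> f t = 0.
  move=> mt; have e0 : 0 < t - inf E by rewrite subr_gt0.
  have [e [_ He]] := inf_adherent e0 infE.
  by rewrite addrC subrK => /He.
have [mA|mA] := leP (inf E) A; first by move=> s sA; apply: fm; exact: le_lt_trans sA.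
have [r r0 [a Ha]] := fA _ mA.
have a0 : forall k, a k = 0.
  apply: (@pseries_eq0 _ r) => // z /andP[z0 zr].
  rewrite -(fm (inf E + z)); last by rewrite ltrDl.
  have := Ha (inf E + z); rewrite addrAC subrr add0r gtr0_norm//; exact.
have fr s : `|s - inf E| < r -> f s = 0.
  move=> sr; have := Ha s sr.
  rewrite (_ : series _ = cst 0); last first.
    by apply/funext => n; rewrite /series/= big1// => i _; rewrite a0 mul0r.
  by move/cvg_lim => <-//; rewrite lim_cst.
pose s := Num.max A (inf E - r / 2).
have sm : s < inf E by rewrite /s gt_max mA /=; lra.
suff /(ge_inf lbE) : E s by rewrite leNgt sm.
split; first by rewrite /s le_max lexx.
move=> t; rewrite /s gt_max => /andP[tA tr].
have [mt|mt] := ltP (inf E) t; first exact: fm.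
by apply: fr; rewrite ler0_norm; lra.
Qed.

(** * Characters and Gauss sums *)

Section Character.
Context (R : realType) (q : nat) (chi : int -> R).
Hypothesis q_gt1 : (1 < q)%N.
Hypothesis chi_char : real_dirichlet_character q chi.

Let chiM m n : chi (m * n) = chi m * chi n.
Proof. by have [] := chi_char. Qed.

Let chi_coprime n : (chi n != 0) = coprimez n q%:Z.
Proof. by have [] := chi_char. Qed.

Lemma periodic_modz (T : Type) (f : int -> T) (N : nat) :
  (forall n, f (n + N%:Z) = f n) -> forall m n, (m = n %[mod N%:Z])%Z -> f m = f n.
Proof.
move=> fN.
have fNn n (k : nat) : f (n + k%:Z * N%:Z) = f n.
  elim: k => [|k IH]; first by rewrite mul0r addr0.
  by rewrite intS mulrDl mul1r addrCA addrC fN IH.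
have fNz n (k : int) : f (n + k * N%:Z) = f n.
  case: k => k; first exact: fNn.
  rewrite -[in RHS](subrK (k.+1%:Z * N%:Z) n) fNn NegzE.
  by rewrite mulNr.
move=> m n mn; rewrite (divz_eq m N%:Z) (divz_eq n N%:Z) mn.
by rewrite addrC fNz addrC fNz.
Qed.

Lemma chi_modz m n : (m = n %[mod q%:Z])%Z -> chi m = chi n.
Proof. by apply: periodic_modz; have [] := chi_char. Qed.

Lemma chi1 : chi 1 = 1.
Proof.
have h : chi 1 != 0 by rewrite chi_coprime coprimezE coprime1n.
by apply: (mulfI h); rewrite -chiM !mulr1.
Qed.

Lemma chi0 : chi 0 = 0.
Proof.
apply/eqP/negPn; rewrite chi_coprime coprimezE /coprime gcd0n; lia.
Qed.

Lemma chiX n k : chi (n ^+ k) = chi n ^+ k.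
Proof. by elim: k => [|k IH]; rewrite ?expr0 ?chi1// !exprS chiM IH. Qed.

(** By Euler's theorem chi(n) is a root of unity, and a real root of unity has absolute value 1. *)
Lemma chi_unit n : coprimez n q%:Z -> chi n ^+ 2 = 1.
Proof.
move=> cn; pose m := absz (modz n q).
have mE : (m%:Z = n %% q%:Z)%Z by rewrite /m gez0_abs// modz_ge0//; lia.
have <- : chi m = chi n by apply: chi_modz; rewrite mE modz_mod.
have cm : coprime m q.
  suff: coprimez m q%:Z by [].
  by rewrite mE /coprimez gcdz_modl.
have h : chi m ^+ totient q = 1.
  rewrite -chiX -chi1; apply: chi_modz.
  have := Euler_exp_totient cm; move/(congr1 Posz).
  by rewrite -!modz_nat => <-; rewrite -rmorphXn.
have t0 : (totient q == 0)%N = false by apply/negbTE; rewrite -lt0n totient_gt0; lia.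
have : `|chi m| ^+ totient q == 1 by rewrite -normrX h normr1.
rewrite pexpr_eq1 ?normr_ge0//; last by rewrite lt0n t0.
by move=> /eqP; rewrite -real_normK ?num_real// => ->; rewrite expr1n.
Qed.

Lemma chi_le1 n : `|chi n| <= 1.
Proof.
have [c|] := boolP (coprimez n q); last first.
  by rewrite -chi_coprime negbK => /eqP ->; rewrite normr0.
have := chi_unit c; rewrite -real_normK ?num_real// => /eqP.
by rewrite sqrf_eq1 => /orP[/eqP->//|/eqP->]; lra.
Qed.

Lemma chiN1 : chi (-1) = (-1) ^+ parity chi.
Proof.
have c1 : coprimez (-1) q by rewrite coprimezE coprime1n.
have := chi_unit c1; rewrite /parity => /eqP; rewrite sqrf_eq1.
by case: eqP => [->//|_] /= /eqP ->.
Qed.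

Lemma chiN n : chi (- n) = (-1) ^+ parity chi * chi n.
Proof. by rewrite -chiN1 -chiM mulN1r. Qed.

Lemma sum_periodic_mulz (V : nmodType) (g : int -> V) (n : int) :
  (forall a, g (a + q%:Z) = g a) -> coprimez n q%:Z ->
  \sum_(a < q) g (n * a%:Z) = \sum_(a < q) g a.
Proof.
move=> gq cn.
have q0 : (q != 0 :> int)%R by lia.
have h_lt (a : 'I_q) : (`|(n * a%:Z %% q%:Z)%Z| < q)%N.
  have := ltz_mod (n * a%:Z) q0; have := modz_ge0 (n * a%:Z) q0; lia.
pose h a := Ordinal (h_lt a).
have hE a : ((h a)%:Z = n * a%:Z %% q%:Z)%Z by rewrite /= gez0_abs// modz_ge0.
have h_inj : injective h.
  move=> a b hab; apply: val_inj => /=.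
  have : (n * a%:Z = n * b%:Z %[mod q%:Z])%Z by rewrite -!hE hab.
  move/eqP; rewrite eqz_mod_dvd -mulrBr Gauss_dvdzr; last by rewrite coprimez_sym.
  rewrite -eqz_mod_dvd !modz_nat !modn_small//; lia.
rewrite [RHS](reindex_inj h_inj); apply: eq_bigr => a _.
by apply: (periodic_modz gq); rewrite hE modz_mod.
Qed.

End Character.

(** * The exponential exp(i x) and sums over roots of unity *)

Section Cis.
Context (R : realType).
Implicit Types x y t : R.

Definition cis x : R[i] := cos x +i* sin x.

Lemma cisD x y : cis (x + y) = cis x * cis y.
Proof. by rewrite /cis cosD sinD; simpc; rewrite [X in _ +i* X]addrC. Qed.

Lemma cis0 : cis 0 = 1.
Proof. by apply/eqP; rewrite eq_complex /cis cos0 sin0 /= !eqxx. Qed.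

Lemma cis_neq0 x : cis x != 0.
Proof.
apply/eqP => h; have : cis x * cis (- x) = 1 by rewrite -cisD subrr cis0.
by rewrite h mul0r => e; have := oner_neq0 (R[i]); rewrite -e eqxx.
Qed.

Lemma cisN x : cis (- x) = (cis x)^-1.
Proof.
by apply: (mulfI (cis_neq0 x)); rewrite -cisD subrr cis0 divff// cis_neq0.
Qed.

Lemma cisX x n : cis (n%:R * x) = cis x ^+ n.
Proof.
elim: n => [|n IH]; first by rewrite mul0r cis0.
by rewrite exprS -IH -cisD -natr1 mulrDl mul1r addrC.
Qed.

Lemma cis2pi_int (k : int) : cis (2 * pi * k%:~R) = 1.
Proof.
have c1 : cis (2 * pi) = 1 by rewrite mulr_natl /cis cos2pi sin2pi.
case: k => k; first by rewrite mulrC cisX c1 expr1n.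
by rewrite NegzE mulrNz mulrN cisN mulrC cisX c1 expr1n invr1.
Qed.

Lemma cisDN x : cis x + cis (- x) = (2 * cos x)%:C.
Proof. by rewrite /cis cosN sinN; apply/eqP; rewrite eq_complex /=; apply/andP; split; apply/eqP; ring. Qed.

Lemma cisBN x : cis x - cis (- x) = 'i%C * (2 * sin x)%:C.
Proof. by rewrite /cis cosN sinN; apply/eqP; rewrite eq_complex /=; apply/andP; split; apply/eqP; ring. Qed.

Lemma cis_neq1 t : 0 < t < 2 * pi -> cis t != 1.
Proof.
move=> t2; apply/negP => /eqP[/eqP + _].
have -> : t = (t / 2) *+ 2 by rewrite -mulr_natr divfK.
rewrite cos_mulr2n cos2sin2.
have : 0 < sin (t / 2) by apply: sin_gt0_pi; move: t2; lra.
move=> s0; rewrite mulrnBl => /eqP h.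
have : sin (t / 2) ^+ 2 = 0 by move: h; rewrite !mulr2n; lra.
by move/eqP; rewrite sqrf_eq0 gt_eqF.
Qed.

Lemma sum_cis (l : nat) (k : int) : (0 < l)%N ->
  \sum_(b < l) cis (2 * pi * (k * b%:Z)%:~R / l%:R) =
  if (l%:Z %| k)%Z then l%:R else 0.
Proof.
move=> l0; have l0' : l%:R != 0 :> R by rewrite pnatr_eq0 -lt0n.
pose z := cis (2 * pi * k%:~R / l%:R).
have -> : \sum_(b < l) cis (2 * pi * (k * b%:Z)%:~R / l%:R) = \sum_(b < l) z ^+ b.
  by apply: eq_bigr => b _; rewrite /z -cisX intrM; congr cis; rewrite pmulrn; ring.
have zl : z ^+ l = 1.
  by rewrite /z -cisX -(cis2pi_int k); congr cis; field.
case: ifPn => lk.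
  have -> : z = 1.
    move: lk => /dvdzP[m km]; rewrite /z km -(cis2pi_int m); congr cis.
    by rewrite intrM -pmulrn; field.
  by under eq_bigr do rewrite expr1n; rewrite sumr_const card_ord.
have z1 : z - 1 != 0.
  rewrite subr_eq0 /z (divz_eq k l) intrD intrM mulrDr mulrDl.
  rewrite [X in cis (X + _)](_ : _ = 2 * pi * (k %/ l)%Z%:~R); last first.
    by rewrite -pmulrn; field.
  rewrite cisD cis2pi_int mul1r; apply: cis_neq1.
  have r0 : 0 < (k %% l)%Z by rewrite lt_def modz_ge0 ?andbT -?dvdz_mod0P//; lia.
  have rl : (k %% l)%Z < l by rewrite ltz_pmod.
  have p0 := pi_gt0 R.
  apply/andP; split.
    by rewrite divr_gt0 ?ltr0n// !mulr_gt0// ltr0z.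
  rewrite ltr_pdivrMr ?ltr0n// ltr_pM2l ?mulr_gt0//.
  by rewrite pmulrn ltr_int.
apply: (mulfI z1); rewrite -subrX1 zl subrr mulr0//.
Qed.

End Cis.

Section Gauss.
Context (R : realType) (q : nat) (chi : int -> R).
Hypothesis q_gt1 : (1 < q)%N.
Hypothesis chi_char : real_dirichlet_character q chi.
Hypothesis chi_prim : primitive_character q chi.

Definition gauss_sum (j : int) : R[i] :=
  \sum_(a < q) (chi a)%:C * cis (2 * pi * (j * a%:Z)%:~R / q%:R).

Let q_neq0 : q%:R != 0 :> R.
Proof. rewrite pnatr_eq0; lia. Qed.

Let cis_modz (j k : int) : (j = k %[mod q%:Z])%Z ->
  cis (2 * pi * j%:~R / q%:R : R) = cis (2 * pi * k%:~R / q%:R).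
Proof.
apply: (@periodic_modz _ (fun j : int => cis (2 * pi * j%:~R / q%:R : R))) => n.
rewrite intrD mulrDr mulrDl cisD -[RHS]mulr1; congr (_ * _).
by rewrite -[RHS](@cis2pi_int R 1) mulr1; congr cis; rewrite -pmulrn; field.
Qed.

Lemma gauss_sum_modz j k : (j = k %[mod q%:Z])%Z -> gauss_sum j = gauss_sum k.
Proof.
move=> jk; apply: eq_bigr => a _; congr (_ * _); apply: cis_modz.
by rewrite -modzMml jk modzMml.
Qed.

Lemma gauss_sumM j n : coprimez n q%:Z -> gauss_sum j = (chi n)%:C * gauss_sum (j * n).
Proof.
move=> cn.
have := @sum_periodic_mulz q q_gt1 _
  (fun a => (chi a)%:C * cis (2 * pi * (j * a)%:~R / q%:R : R)) n _ cn.
rewrite /gauss_sum => <-; last first.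
  move=> a; congr (_%:C * _); first by have [] := chi_char.
  by apply: cis_modz; rewrite mulrDr addrC modzMDl.
rewrite mulr_sumr; apply: eq_bigr => a _.
have [chiM _ _] := chi_char.
by rewrite chiM rmorphM/= !mulrA.
Qed.

(** For j prime to q, chi(j) is its own inverse. Otherwise primitivity, applied to d = q / gcd(j,
    q), gives n prime to q with n = 1 mod d and chi(n) != 1. Then j n = j mod q, so the Gauss sum at
    j equals chi(n) times itself and is 0. *)
Lemma gauss_sumE j : gauss_sum j = (chi j)%:C * gauss_sum 1.
Proof.
have [_ _ chi_coprime] := chi_char.
have [cj|ncj] := boolP (coprimez j q).
  rewrite (gauss_sumM 1 cj) mul1r mulrA -rmorphM/= -expr2.
  by rewrite (chi_unit q_gt1 chi_char cj) mul1r.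
have -> : chi j = 0 by apply/eqP; rewrite -[_ == _]negbK chi_coprime.
rewrite mul0r.
pose d := (q %/ gcdn `|j| q)%N.
have g_gt1 : (1 < gcdn `|j| q)%N.
  have : (0 < gcdn `|j| q)%N by rewrite gcdn_gt0; lia.
  by move: ncj; rewrite coprimezE /coprime; case: gcdn => [|[]].
have dq : (d %| q)%N by rewrite /d; apply/dvdnP; exists (gcdn `|j| q); rewrite mulnC divnK// dvdn_gcdr.
have dltq : (d < q)%N by rewrite /d ltn_Pdiv//; lia.
have [n [cn n1 chin]] := chi_prim dq dltq.
have jn : (j * n = j %[mod q%:Z])%Z.
  apply/eqP; rewrite eqz_mod_dvd -[X in _ - X]mulr1 -mulrBr.
  have dn : (d%:Z %| n - 1)%Z by rewrite -eqz_mod_dvd; exact/eqP.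
  have gj : ((gcdn `|j| q)%:Z %| j)%Z by rewrite dvdzE /= dvdn_gcdl.
  have -> : q%:Z = (gcdn `|j| q)%:Z * d%:Z by rewrite -PoszM mulnC divnK// dvdn_gcdr.
  exact: dvdz_mul.
have := gauss_sumM j cn; rewrite (gauss_sum_modz jn) => /eqP.
rewrite -subr_eq0 -[X in X - _]mul1r -mulrBl mulf_eq0 => /orP[|/eqP//].
rewrite subr_eq0 eq_sym -(rmorph1 (real_complex R)) => /eqP/complexI h.
by rewrite h eqxx in chin.
Qed.

Lemma sum_nat_mul_rect (V : nmodType) (l : nat) (F : nat -> V) :
  \sum_(n < q * l) F n = \sum_(a < q) \sum_(b < l) F (a + q * b)%N.
Proof.
rewrite exchange_big/=; elim: l => [|l IH]; first by rewrite muln0 !big_ord0.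
rewrite big_ord_recr/= -IH mulnS addnC big_split_ord/=; congr (_ + _).
by apply: eq_bigr => i _; rewrite addnC.
Qed.

(** Write n = a + q b: chi depends on a only, and the sum over b is a full sum of powers of an l-th
    root of unity, which selects the multiples of l among the frequencies k. *)
Lemma gauss_sum_dilate (l : nat) (k : int) : (0 < l)%N ->
  \sum_(n < q * l) (chi n)%:C * cis (2 * pi * (k * n%:Z)%:~R / (q * l)%:R) =
  if (l%:Z %| k)%Z then l%:R * (chi (k %/ l%:Z)%Z)%:C * gauss_sum 1 else 0.
Proof.
move=> l0; have l_neq0 : l%:R != 0 :> R by rewrite pnatr_eq0 -lt0n.
rewrite (sum_nat_mul_rect _ (fun n => (chi n)%:C * cis (2 * pi * (k * n%:Z)%:~R / (q * l)%:R))).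
have E (a : 'I_q) : \sum_(b < l) (chi (a + q * b)%N)%:C *
     cis (2 * pi * (k * (a + q * b)%N%:Z)%:~R / (q * l)%:R) =
   (chi a)%:C * cis (2 * pi * (k * a%:Z)%:~R / (q * l)%:R) *
     \sum_(b < l) cis (2 * pi * (k * b%:Z)%:~R / l%:R).
  rewrite mulr_sumr; apply: eq_bigr => b _.
  have -> : chi (a + q * b)%N = chi a.
    by apply: (chi_modz chi_char); rewrite PoszD PoszM addrC mulrC modzMDl.
  rewrite -[RHS]mulrA -cisD; congr (_ * cis _).
  rewrite PoszD PoszM !intrM intrD intrM natrM -!pmulrn; field.
  by rewrite ?q_neq0 ?l_neq0.
rewrite (eq_bigr _ (fun a _ => E a)) sum_cis//; case: ifPn => lk; last first.
  by rewrite big1// => a _; rewrite mulr0.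
rewrite -mulrA -gauss_sumE /gauss_sum mulr_sumr; apply: eq_bigr => a _.
rewrite mulrC; congr (_ * (_ * cis _)).
rewrite -{1}(divzK lk) !intrM natrM -!pmulrn; field.
by rewrite ?q_neq0 ?l_neq0.
Qed.

End Gauss.

(** * The trigonometric kernel and the finite inversion identity *)

Section Kernel.
Context (R : realType).

(* Fourier coefficients, shifted by m, of the kernel
   (2 cos t)^(2m - d) (2i sin t)^d for d = 0, 1; the factor ((i - m) / m)^d is
   a normalised derivative of (2 cos t)^(2m). *)
Definition kernel_weight (d m i : nat) : R :=
  ((i%:Z - m%:Z)%:~R / m%:R) ^+ d * 'C(m.*2, i)%:R.

Let cis_pow (t : R) (m i : nat) : (i <= m.*2)%N ->
  cis (- t) ^+ (m.*2 - i) * cis t ^+ i = cis (2 * t * (i%:Z - m%:Z)%:~R).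
Proof.
move=> im; rewrite -!cisX -cisD natrB// intrD rmorphN/= -!pmulrn.
by congr cis; rewrite -mul2n natrM; ring.
Qed.

Lemma kernel_sum0 (m : nat) (t : R) :
  \sum_(i < m.*2.+1) (kernel_weight 0 m i)%:C * cis (2 * t * (i%:Z - m%:Z)%:~R) =
  ((2 * cos t) ^+ m.*2)%:C.
Proof.
rewrite rmorphXn/= -cisDN addrC exprDn; apply: eq_bigr => i _.
rewrite cis_pow; last by rewrite -ltnS.
rewrite /kernel_weight expr0 mul1r.
by rewrite -[RHS]mulr_natl; congr (_ * _); exact: rmorph_nat.
Qed.

(** The right side is the coefficient of y^(j + 1) in (x + y)^(2m - 1) (y - x), the form that the
    odd kernel takes for x = exp(- i t), y = exp(i t). *)
Lemma kernel_weight1_rec (m j : nat) : (0 < m)%N -> (j < m.*2)%N ->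
  kernel_weight 1 m j.+1 = 'C(m.*2.-1, j)%:R - 'C(m.*2.-1, j.+1)%:R.
Proof.
move=> m0 jm; have m_neq0 : m%:R != 0 :> R by rewrite pnatr_eq0 -lt0n.
have h1 := congr1 (fun n => n%:R : R) (mul_bin_diag m.*2 j).
have h2 := congr1 (fun n => n%:R : R) (mul_bin_down m.*2 j.+1).
rewrite !natrM natrB// in h1 h2.
apply: (mulfI m_neq0); rewrite /kernel_weight expr1 mulrA [m%:R * (_ / _)]mulrC.
rewrite divfK// intrD rmorphN/= -!pmulrn.
by move: h1 h2; rewrite -mul2n natrM; lra.
Qed.

Lemma kernel_sum1 (m : nat) (t : R) : (0 < m)%N ->
  \sum_(i < m.*2.+1) (kernel_weight 1 m i)%:C * cis (2 * t * (i%:Z - m%:Z)%:~R) =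
  ((2 * cos t) ^+ (m.*2 - 1) * (2 * sin t))%:C * 'i.
Proof.
move=> m0; pose x := cis (- t); pose y := cis t.
have m_neq0 : m%:R != 0 :> R by rewrite pnatr_eq0 -lt0n.
have -> : ((2 * cos t) ^+ (m.*2 - 1) * (2 * sin t))%:C * 'i =
    (x + y) ^+ m.*2.-1 * (y - x).
  by rewrite addrC cisDN cisBN subn1 rmorphM rmorphXn/= -mulrA [_ * 'i]mulrC.
have E (i : 'I_m.*2.+1) : (kernel_weight 1 m i)%:C * cis (2 * t * (i%:Z - m%:Z)%:~R) =
    (kernel_weight 1 m i)%:C * (x ^+ (m.*2 - i) * y ^+ i).
  by rewrite cis_pow//; rewrite -ltnS.
rewrite (eq_bigr _ (fun i _ => E i)) mulrBr exprDn !mulr_suml.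
have -> : m.*2.-1.+1 = m.*2 by lia.
(* The added term has the coefficient C(2m - 1, 2m) = 0; the part multiplied by x now has one term
   for each weight. *)
have -> : \sum_(i < m.*2) x ^+ (m.*2.-1 - i) * y ^+ i *+ 'C(m.*2.-1, i) * x =
    \sum_(i < m.*2.+1) x ^+ (m.*2 - i) * y ^+ i *+ 'C(m.*2.-1, i).
  rewrite big_ord_recr/= [in X in _ = _ + X]bin_small; last by lia.
  rewrite mulr0n addr0; apply: eq_bigr => i _.
  rewrite mulrnAl mulrAC -exprSr; congr (x ^+ _ * _ *+ _); have := ltn_ord i; lia.
rewrite [in RHS]big_ord_recl [in LHS]big_ord_recl opprD addrCA; congr (_ + _).
  rewrite /kernel_weight !bin0 expr1 sub0r mulr1 rmorphN/= -pmulrn mulNr divff//.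
  by rewrite rmorphN1 mulN1r.
rewrite -sumrB; apply: eq_bigr => i _; rewrite lift0.
rewrite kernel_weight1_rec// rmorphB/= !rmorph_nat mulrBl.
rewrite !mulr_natl.
rewrite (_ : (m.*2.-1 - i = m.*2 - i.+1)%N); last by have := ltn_ord i; lia.
by rewrite mulrnAl exprSr !mulrA.
Qed.

Lemma kernel_sum (d m : nat) (t : R) : (d <= 1)%N -> (0 < m)%N ->
  \sum_(i < m.*2.+1) (kernel_weight d m i)%:C * cis (2 * t * (i%:Z - m%:Z)%:~R) =
  ((2 * cos t) ^+ (m.*2 - d) * (2 * sin t) ^+ d)%:C * 'i ^+ d.
Proof.
case: d => [|[|//]] _ m0; first by rewrite kernel_sum0 subn0 !mulr1.
by rewrite kernel_sum1// !expr1.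
Qed.

End Kernel.

Lemma sum_sym_even (V : nmodType) (F : nat -> V) (h : nat) :
  F 0%N = 0 -> F h = 0 ->
  (forall n, (0 < n < h.*2)%N -> F (h.*2 - n)%N = F n) ->
  \sum_(n < h.*2) F n = (\sum_(n < h) F n) *+ 2.
Proof.
move=> F0 Fh Fsym; rewrite mulr2n -addnn big_split_ord/=; congr (_ + _).
case: h Fh Fsym => [|h] Fh Fsym; first by rewrite !big_ord0.
rewrite [RHS]big_ord_recl F0 add0r [LHS]big_ord_recl/= addn0 Fh add0r.
rewrite [RHS](reindex_inj rev_ord_inj)/=; apply: eq_bigr => i _; rewrite /= /bump /=.
rewrite -Fsym; last by have := ltn_ord i; lia.
by congr F; have := ltn_ord i; lia.
Qed.

Lemma sum_sym_odd (V : nmodType) (F : nat -> V) (m : nat) :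
  F m = 0 -> (forall n, (n <= m.*2)%N -> F (m.*2 - n)%N = F n) ->
  \sum_(n < m.*2.+1) F n = (\sum_(k < m) F (m + k.+1)%N) *+ 2.
Proof.
move=> Fm Fsym; rewrite mulr2n -addnn -addnS big_split_ord/=; congr (_ + _).
  rewrite (reindex_inj rev_ord_inj)/=; apply: eq_bigr => i _.
  by rewrite -Fsym; [congr F|]; have := ltn_ord i; lia.
by rewrite big_ord_recl addn0 Fm add0r; apply: eq_bigr => i _.
Qed.

Lemma sum_multiples (V : nmodType) (F : nat -> V) (l m : nat) : (0 < l)%N ->
  (forall k, (m < k)%N -> F k = 0) ->
  \sum_(k < m) (if (l %| k.+1)%N then F k.+1 else 0) = \sum_(j < m) F (l * j.+1)%N.
Proof.
move=> l0 F0.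
have E M : \sum_(k < l * M) (if (l %| k.+1)%N then F k.+1 else 0) =
    \sum_(j < M) F (l * j.+1)%N.
  elim: M => [|M IH]; first by rewrite muln0 !big_ord0.
  rewrite big_ord_recr/= -IH mulnS addnC big_split_ord/=; congr (_ + _).
  case: l l0 {IH} => // l _; rewrite big_ord_recr/= big1 ?add0r => [|i _].
    by rewrite -addnS addnC -mulnS dvdn_mulr.
  rewrite -addnS dvdn_addr ?dvdn_mulr// gtnNdvd//; have := ltn_ord i; lia.
rewrite -E -!(big_mkord xpredT (fun k => if (l %| k.+1)%N then F k.+1 else 0)).
rewrite [RHS](@big_cat_nat _ _ _ m)//=; last by rewrite leq_pmull.
rewrite [X in _ = _ + X]big_nat_cond [X in _ = _ + X]big1 ?addr0// => i.
by rewrite andbT => /andP[mi _]; case: ifP => // _; rewrite F0.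
Qed.

Section FiniteTheta.
Context (R : realType) (q : nat) (chi : int -> R).
Hypothesis q_gt1 : (1 < q)%N.
Hypothesis chi_char : real_dirichlet_character q chi.
Hypothesis chi_prim : primitive_character q chi.
Let d := parity chi.

Let d1 : (d <= 1)%N.
Proof. by rewrite /d /parity; case: ifP. Qed.

Let signM : (-1) ^+ d * (-1) ^+ d = 1 :> R.
Proof. by rewrite -exprD addnn -mul2n exprM sqrrN !expr1n. Qed.

(* A finite form of theta inversion: the kernel and its binomial Fourier
   coefficients both become Gaussians when m, l -> oo with l^2 / m fixed. *)
Lemma finite_theta : exists tau : R, forall l m h : nat,
  (0 < l)%N -> (0 < m)%N -> (q * l)%N = h.*2 ->
  \sum_(n < h) chi n * ((2 * cos (pi * n%:R / h.*2%:R)) ^+ (m.*2 - d) *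
                        (2 * sin (pi * n%:R / h.*2%:R)) ^+ d) =
  tau * l%:R * \sum_(j < m) chi j.+1 * (((l * j.+1)%:R / m%:R) ^+ d *
                                   'C(m.*2, m + l * j.+1)%:R).
Proof.
pose g := gauss_sum q chi 1.
(* The factor i^d of the kernel is moved to the Gauss sum. Both sums of the identity are real, so
   taking real parts loses nothing. *)
exists (complex.Re (g * 'i^-1 ^+ d)) => l m h l0 m0 qlh.
have i0 : 'i != 0 :> R[i] by rewrite eq_complex /= oner_eq0 andbF.
have h0 : (0 < h)%N by rewrite -double_gt0 -qlh muln_gt0 l0 andbT; lia.
have h_neq0 : h.*2%:R != 0 :> R by rewrite pnatr_eq0 -lt0n double_gt0.
pose t (n : nat) : R := pi * n%:R / h.*2%:R.
pose A (n : nat) : R := chi n * ((2 * cos (t n)) ^+ (m.*2 - d) * (2 * sin (t n)) ^+ d).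
(* Under n -> 2h - n the angle t becomes pi - t: the sine is fixed, the power of the cosine gains
   (-1)^d, and chi gains another (-1)^d. The fixed points 0 and h contribute 0. *)
have SA : \sum_(n < h.*2) A n = (\sum_(n < h) A n) *+ 2.
  apply: sum_sym_even => [||n /andP[n0 nh]].
  - by rewrite /A (chi0 q_gt1 chi_char) mul0r.
  - have th : t h = pi / 2.
      rewrite /t -mul2n natrM; field.
      by rewrite pnatr_eq0 -lt0n.
    rewrite /A th cos_pihalf mulr0 expr0n.
    have -> : (m.*2 - d == 0)%N = false by move: d1; lia.
    by rewrite mul0r mulr0.
  - have tE : t (h.*2 - n)%N = pi - t n.
      rewrite /t natrB 1?ltnW// mulrBr mulrBl mulfK//.
    have chiE : chi (h.*2 - n)%N = (-1) ^+ d * chi n.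
      rewrite -(chiN q_gt1 chi_char); apply: (chi_modz chi_char).
      rewrite -subzn 1?ltnW// -qlh PoszM mulrC.
      by rewrite modzMDl.
    rewrite /A tE chiE cosB sinB cospi sinpi !mul0r addr0 sub0r !mulN1r opprK.
    rewrite [2 * - _]mulrN [(- (_ * _)) ^+ _]exprNn.
    have -> : (-1) ^+ (m.*2 - d) = (-1) ^+ d :> R.
      by rewrite -signr_odd oddB ?odd_double ?addFb ?signr_odd//; move: d1; lia.
    by move: signM; set s : R := (-1) ^+ d => s2; rewrite -[RHS]mul1r -s2; ring.
(* Up to the factor l times the Gauss sum, this is what is left of the i-th Fourier term of the
   kernel after summation over n: only the frequencies i - m divisible by l survive. *)
pose B (i : nat) : R := if (l%:Z %| i%:Z - m%:Z)%Z
  then chi ((i%:Z - m%:Z) %/ l%:Z)%Z * kernel_weight R d m i else 0.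
have B1 k : B (m + k)%N = if (l %| k)%N
    then chi (k %/ l)%N * ((k%:R / m%:R) ^+ d * 'C(m.*2, m + k)%:R) else 0.
  by rewrite /B /kernel_weight PoszD addrAC subrr add0r -pmulrn divz_nat.
have SB : \sum_(i < m.*2.+1) B i =
    (\sum_(j < m) chi j.+1 * (((l * j.+1)%:R / m%:R) ^+ d *
                                   'C(m.*2, m + l * j.+1)%:R)) *+ 2.
  rewrite sum_sym_odd; first last.
  - move=> i im; rewrite /B.
    have -> : (m.*2 - i)%N%:Z - m%:Z = - (i%:Z - m%:Z).
      by rewrite -subzn// -addnn PoszD; ring.
    rewrite rpredN; case: ifP => // li.
    have -> : (- (i%:Z - m%:Z) %/ l)%Z = - ((i%:Z - m%:Z) %/ l)%Z.
      by have [k ->] := dvdzP li; rewrite -mulNr !mulzK//; lia.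
    rewrite (chiN q_gt1 chi_char) /kernel_weight bin_sub//.
    have -> : ((m.*2 - i)%N%:Z - m%:Z)%:~R = - (i%:Z - m%:Z)%:~R :> R.
      by rewrite -rmorphN/= -subzn// -addnn PoszD; congr (_%:~R); ring.
    rewrite -/d [in LHS]mulNr [(- (_ / _)) ^+ _]exprNn.
    by move: signM; set s : R := (-1) ^+ d => s2; rewrite -[RHS]mul1r -s2; ring.
  - by rewrite -[m in B m]addn0 B1 dvdn0 div0n (chi0 q_gt1 chi_char) mul0r.
  congr (_ *+ 2).
  pose F (k : nat) : R := chi (k %/ l)%N * ((k%:R / m%:R) ^+ d * 'C(m.*2, m + k)%:R).
  transitivity (\sum_(k < m) (if (l %| k.+1)%N then F k.+1 else 0)).
    by apply: eq_bigr => k _; exact: B1.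
  rewrite sum_multiples//; last by move=> k mk; rewrite /F bin_small ?mulr0//; lia.
  by apply: eq_bigr => j _; rewrite /F mulKn.
(* The kernel is expanded into frequencies and the sums are exchanged, so that n is summed first and
   [gauss_sum_dilate] applies. *)
have key : (\sum_(n < h.*2) A n)%:C * 'i ^+ d =
    l%:R * (\sum_(i < m.*2.+1) B i)%:C * g.
  rewrite !rmorph_sum/= mulr_suml.
  transitivity (\sum_(n < h.*2) \sum_(i < m.*2.+1) (kernel_weight R d m i)%:C *
     ((chi n)%:C * cis (2 * pi * ((i%:Z - m%:Z) * n%:Z)%:~R / (q * l)%:R))).
    apply: eq_bigr => n _; rewrite /A rmorphM/= -mulrA -kernel_sum// mulr_sumr.
    apply: eq_bigr => i _; rewrite mulrCA; congr (_ * (_ * cis _)).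
    by rewrite /t intrM -pmulrn qlh; field.
  rewrite exchange_big/= [l%:R * _]mulr_sumr [RHS]mulr_suml; apply: eq_bigr => i _.
  rewrite -mulr_sumr -qlh gauss_sum_dilate// /B; case: ifP => _; last first.
    by rewrite !mulr0 mul0r.
  rewrite [in RHS]rmorphM/= -/g; move: (kernel_weight R d m i)%:C (_%:C) => w x.
  by rewrite -!mulrA [in LHS]mulrCA; congr (_ * _); rewrite mulrCA.
have : \sum_(n < h) A n = l%:R * (\sum_(j < m) chi j.+1 *
    (((l * j.+1)%:R / m%:R) ^+ d * 'C(m.*2, m + l * j.+1)%:R)) *
    complex.Re (g * 'i^-1 ^+ d).
  have two : 2 != 0 :> R by [].
  apply: (mulfI two).
  transitivity (l%:R * (\sum_(i < m.*2.+1) B i) * complex.Re (g * 'i^-1 ^+ d)).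
    rewrite [LHS]mulr_natl -SA.
    have keyi : (\sum_(n < h.*2) A n)%:C =
        (l%:R * (\sum_(i < m.*2.+1) B i))%:C * (g * 'i^-1 ^+ d).
      rewrite mulrA [in RHS]rmorphM/= rmorph_nat -key.
      by rewrite -mulrA -exprMn divff// expr1n mulr1.
    rewrite -[LHS]/(complex.Re ((\sum_(n < h.*2) A n)%:C)) keyi.
    by case: (g * _) => u v; simpc.
  by rewrite SB -mulr_natl; ring.
by rewrite /A /t => ->; ring.
Qed.

End FiniteTheta.

(** * Inversion of the theta series *)

Section ElementaryBounds.
Context (R : realType).
Implicit Types a u t s : R.

Lemma onem_le_expR u : 1 - u <= expR (- u).
Proof. exact: expR_ge1Dx. Qed.

(** This is 1 + v <= exp(v) at v = u / (1 - u), where 1 + v = 1 / (1 - u). *)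
Lemma onem_ge_expR u : u < 1 -> expR (- (u / (1 - u))) <= 1 - u.
Proof.
move=> u1; have d0 : 0 < 1 - u by lra.
rewrite expRN -[leRHS]invrK lef_pV2 ?posrE ?expR_gt0 ?invr_gt0//.
have := expR_ge1Dx (u / (1 - u)); apply: le_trans.
by rewrite le_eqVlt; apply/orP; left; apply/eqP; field; lra.
Qed.

Lemma sin_bounds s : 0 < s <= pi -> s * cos s <= sin s <= s.
Proof.
move=> /andP[s0 spi].
have sinc : {within `[0, s], continuous (@sin R)}.
  by apply: continuous_subspaceT => x; exact: continuous_sin.
have [c] := MVT s0 (fun x _ => is_derive_sin x) sinc.
rewrite in_itv/= => /andP[c0 cs]; rewrite sin0 !subr0 => ->.
apply/andP; split; last by rewrite ger_pMl// cos_le1.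
rewrite mulrC ler_pM2r//; apply/ltW.
by rewrite ltr_cos ?in_itv/= ?(ltW c0) ?(ltW s0) ?spi//= ltW// (lt_le_trans cs).
Qed.

(** From cos t = 1 - 2 sin^2(t/2), sin(t/2) >= (t/2) cos(t/2) and cos^2(t/2) >= 1/2 one gets cos t
    <= 1 - t^2/4. The constant is not sharp; the bound serves only for domination. *)
Lemma cos_le_expR t : 0 <= t <= pi / 2 -> cos t <= expR (- (t ^+ 2 / 4)).
Proof.
rewrite le_eqVlt => /andP[/predU1P[<- _|t0 tpi]].
  by rewrite expr0n mul0r oppr0 expR0 cos0.
apply: le_trans (onem_le_expR _).
have E : t = (t / 2) *+ 2 by rewrite mulr2n; lra.
have p0 := pi_gt0 R.
have c0 : 0 <= cos t by apply: cos_ge0_pihalf; lra.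
have C : 1 / 2 <= cos (t / 2) ^+ 2.
  by move: c0; rewrite {1}E cos_mulr2n mulr2n; lra.
have S : cos t = 1 - 2 * sin (t / 2) ^+ 2.
  by rewrite {1}E cos_mulr2n cos2sin2 mulr2n; ring.
have /andP[+ _] : t / 2 * cos (t / 2) <= sin (t / 2) <= t / 2.
  by apply: sin_bounds; lra.
have cc : 0 <= cos (t / 2) by apply: cos_ge0_pihalf; lra.
move=> h; have : (t / 2 * cos (t / 2)) ^+ 2 <= sin (t / 2) ^+ 2.
  by rewrite ler_sqr// nnegrE ?mulr_ge0//; [lra| apply: le_trans h; rewrite mulr_ge0//; lra].
rewrite exprMn expr_div_n S; nra.
Qed.

Lemma cvg_sinc (s_ : nat -> R) : (\forall n \near \oo, 0 < s_ n <= pi) ->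
  s_ @ \oo --> (0 : R) -> (fun n => sin (s_ n) / s_ n) @ \oo --> (1 : R).
Proof.
move=> s0 cs.
have cc : (fun n => cos (s_ n)) @ \oo --> (1 : R).
  by rewrite -cos0; apply: (cvg_comp _ _ cs); exact: continuous_cos.
apply: (squeeze_cvgr _ cc (cvg_cst (1 : R))); near=> n.
have sn : 0 < s_ n <= pi by apply: (near s0 n).
have /andP[p0 _] := sn; have /andP[l1 l2] := sin_bounds sn.
by rewrite ler_pdivlMr// ler_pdivrMr// mul1r l2 andbT mulrC.
Unshelve. all: by end_near. Qed.

Lemma cvg_onemX (u_ : nat -> R) (K : nat -> nat) (c : R) :
  (\forall n \near \oo, 0 <= u_ n) -> u_ @ \oo --> (0 : R) ->
  (fun n => (K n)%:R * u_ n) @ \oo --> c ->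
  (fun n => (1 - u_ n) ^+ K n) @ \oo --> expR (- c).
Proof.
move=> u0 cu cK.
have c1 : (fun n => 1 - u_ n) @ \oo --> (1 : R).
  have : (fun n => 1 - u_ n) @ \oo --> 1 - (0 : R) by apply: cvgB => //; exact: cvg_cst.
  by rewrite subr0.
have cl : (fun n => expR (- ((K n)%:R * u_ n / (1 - u_ n)))) @ \oo --> expR (- c).
  apply: continuous_cvg; first exact: continuous_expR.
  have : (fun n => (K n)%:R * u_ n / (1 - u_ n)) @ \oo --> c / 1.
    by apply: cvgM => //; apply: cvgV.
  by rewrite divr1 => h; exact: cvgN.
have cr : (fun n => expR (- ((K n)%:R * u_ n))) @ \oo --> expR (- c).
  by apply: continuous_cvg; [exact: continuous_expR | exact: cvgN].
apply: (squeeze_cvgr _ cl cr); near=> n.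
have un : u_ n < 1 by near: n; exact: (cvgr_lt _ cu).
have un0 : 0 <= u_ n by apply: (near u0 n).
have -> : - ((K n)%:R * u_ n / (1 - u_ n)) = - (u_ n / (1 - u_ n)) * (K n)%:R by ring.
have -> : - ((K n)%:R * u_ n) = - u_ n * (K n)%:R by ring.
rewrite !expRM_natr; apply/andP; split.
  apply: lerXn2r; [exact: expR_ge0 | by rewrite nnegrE subr_ge0 ltW |].
  exact: onem_ge_expR.
apply: lerXn2r; [by rewrite nnegrE subr_ge0 ltW | exact: expR_ge0 |].
exact: onem_le_expR.
Unshelve. all: by end_near. Qed.

Lemma cvg_cosX (s_ : nat -> R) (K : nat -> nat) (c : R) :
  (\forall n \near \oo, 0 < s_ n <= pi) -> s_ @ \oo --> (0 : R) ->
  (fun n => (K n)%:R * s_ n ^+ 2 / 2) @ \oo --> c ->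
  (fun n => cos (s_ n) ^+ K n) @ \oo --> expR (- c).
Proof.
move=> s0 cs cK.
have E n : cos (s_ n) = 1 - (1 - cos (s_ n)) by ring.
under eq_cvg do rewrite E.
apply: cvg_onemX.
- by apply: nearW => n; rewrite subr_ge0 cos_le1.
- have : (fun n => 1 - cos (s_ n)) @ \oo --> (1 - cos 0 : R).
    apply: cvgB; first exact: cvg_cst.
    by apply: (cvg_comp _ _ cs); exact: continuous_cos.
  by rewrite cos0 subrr.
pose v n := (K n)%:R * s_ n ^+ 2 / 2 * (sin (s_ n / 2) / (s_ n / 2)) ^+ 2.
have cv : v @ \oo --> c.
  have h : (fun n => sin (s_ n / 2) / (s_ n / 2)) @ \oo --> (1 : R).
    apply: (@cvg_sinc (fun n => s_ n / 2)).
      by apply: filterS s0 => n; have := pi_gt0 R; lra.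
    have : (fun n => s_ n / 2) @ \oo --> 0 / (2 : R) by apply: cvgM => //; exact: cvg_cst.
    by rewrite mul0r.
  have : v @ \oo --> c * (1 * 1) by apply: cvgM => //; exact: cvgM.
  by rewrite !mulr1.
apply: cvg_trans cv; apply: near_eq_cvg; near=> n.
have sn : 0 < s_ n <= pi by apply: (near s0 n).
have sE : s_ n = (s_ n / 2) *+ 2 by rewrite mulr2n; lra.
rewrite /v {1 4}sE cos_mulr2n cos2sin2 mulr2n; field.
by lra.
Unshelve. all: by end_near. Qed.

(** A geometric sum, with 1 - exp(- a) >= a / (1 + a). The factor exp(- a) is kept since the bounds
    must also decay for large a. *)
Lemma sum_expR_le a (N : nat) : 0 < a ->
  \sum_(n < N) expR (- (a * n.+1%:R)) <= (1 + a^-1) * expR (- a).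
Proof.
move=> a0; pose z := expR (- a).
have z1 : 0 < z < 1 by rewrite expR_gt0 expR_lt1; lra.
have E n : expR (- (a * n.+1%:R)) = z * z ^+ n by rewrite -exprS -mulNr expRM_natr.
under eq_bigr do rewrite E.
rewrite -mulr_sumr mulrC; apply: ler_wpM2r; first by lra.
have : (1 - z) * (\sum_(i < N) z ^+ i) <= 1.
  by rewrite -opprB mulNr -subrX1 opprB gerBl exprn_ge0//; lra.
have : 1 - z >= a / (1 + a).
  rewrite lerBrDr -lerBrDl /z expRN.
  have -> : 1 - a / (1 + a) = (1 + a)^-1 by field; lra.
  by rewrite lef_pV2 ?posrE ?expR_gt0//; [exact: expR_ge1Dx|lra].
move=> h1 h2; have d0 : 0 < a / (1 + a) by rewrite divr_gt0//; lra.
rewrite (_ : 1 + a^-1 = (a / (1 + a))^-1); last by field; lra.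
rewrite -[leRHS]div1r ler_pdivlMr// mulrC; apply: le_trans h2.
by apply: ler_wpM2r => //; apply: sumr_ge0 => i _; apply: exprn_ge0; lra.
Qed.

(** Half of the exponential absorbs the linear factor: n exp(- a n / 2) <= 2 / a. *)
Lemma sum_natM_expR_le a (N : nat) : 0 < a ->
  \sum_(n < N) n.+1%:R * expR (- (a * n.+1%:R)) <=
  2 / a * (1 + 2 / a) * expR (- (a / 2)).
Proof.
move=> a0; have a20 : 0 < a / 2 by lra.
have := sum_expR_le N a20; rewrite invf_div => h.
rewrite -[leRHS]mulrA; apply: (@le_trans _ _ (2 / a * \sum_(n < N) expR (- (a / 2 * n.+1%:R)))).
  rewrite mulr_sumr; apply: ler_sum => n _.
  have -> : expR (- (a * n.+1%:R)) = expR (- (a / 2 * n.+1%:R)) * expR (- (a / 2 * n.+1%:R)).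
    by rewrite -expRD; congr expR; field.
  rewrite mulrA; apply: ler_wpM2r; first exact: expR_ge0.
  rewrite expRN ler_pdivrMr ?expR_gt0// -ler_pdivrMl ?divr_gt0// invf_div.
  by apply: le_trans (expR_ge1Dx _); rewrite lerDr.
by rewrite ler_pM2l// divr_gt0.
Qed.

Lemma is_cvg_natM_expR a : 0 < a ->
  cvgn (series (fun n => n%:R * expR (- (a * n%:R)))).
Proof.
move=> a0; apply: nondecreasing_is_cvgn.
  by apply: nondecreasing_series => n _ _; rewrite mulr_ge0 ?expR_ge0.
exists (2 / a * (1 + 2 / a) * expR (- (a / 2))) => _ [[|N] _ <-].
  rewrite /series/= big_geq// !mulr_ge0 ?expR_ge0//; first by rewrite invr_ge0 ltW.
  by rewrite addr_ge0// divr_ge0// ltW.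
rewrite /series/= big_nat_recl// mul0r add0r big_mkord.
exact: sum_natM_expR_le.
Qed.

End ElementaryBounds.

(** * Central binomial coefficients and their Gaussian neighbourhood *)

Section CentralBinomial.
Context (R : realType).

Definition central_bin (m : nat) : R := 'C(m.*2, m)%:R / 4 ^+ m.

Lemma central_binS m :
  central_bin m.+1 = central_bin m * ((2 * m%:R + 1) / (2 * m%:R + 2)).
Proof.
have h1 := congr1 (fun n => n%:R : R) (mul_bin_diag m.*2.+2 m).
have h2 := congr1 (fun n => n%:R : R) (mul_bin_down m.*2.+1 m).
rewrite !natrM /= in h1 h2.
have E : (m.*2.+1 - m)%N = m.+1 by lia.
rewrite E in h2.
rewrite /central_bin doubleS exprS.
have m0 : m%:R + 1 != 0 :> R by rewrite natr1 pnatr_eq0.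
have -> : 'C(m.*2.+2, m.+1)%:R = 'C(m.*2, m)%:R * (2 * (2 * m%:R + 1)) / (m%:R + 1) :> R.
  apply: (mulfI m0).
  move: h1 h2; rewrite -[m.*2.+2]addn2 -[m.*2.+1]addn1 -[m.+1]addn1 !natrD -muln2 natrM.
  move=> h1 h2; rewrite -h1.
  apply: (mulfI m0).
  rewrite [(m%:R + 1) * (_ * 'C(_, _)%:R)]mulrCA -h2; field.
  by rewrite ?m0.
field; rewrite expf_neq0//=.
by have := ler0n R m; lra.
Qed.

Lemma central_bin_gt0 m : 0 < central_bin m.
Proof.
by rewrite divr_gt0 ?exprn_gt0// ltr0n bin_gt0; lia.
Qed.

(** With p_m for [central_bin], m p_m^2 increases and (2m + 1) p_m^2 decreases from 1, so the former
    converges. Its limit, which Wallis's product would give, is left unidentified. *)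
Lemma cvg_central_bin : cvgn (fun m => central_bin m * Num.sqrt m%:R).
Proof.
have E : (fun m => central_bin m * Num.sqrt m%:R) =
    (fun m => Num.sqrt (m%:R * central_bin m ^+ 2)).
  apply/funext => m; rewrite mulrC sqrtrM ?ler0n// sqrtr_sqr gtr0_norm//.
  exact: central_bin_gt0.
rewrite {}E.
suff /cvg_ex[K cK] : cvgn (fun m => m%:R * central_bin m ^+ 2).
  by apply/cvg_ex; exists (Num.sqrt K); apply: (cvg_comp _ _ cK); exact: sqrt_continuous.
apply: nondecreasing_is_cvgn.
  apply/nondecreasing_seqP => m; rewrite central_binS -[m.+1%:R]natr1.
  move: (central_bin m) (ler0n R m) => p; move: (m%:R : R) => x x0.
  rewrite exprMn [leRHS]mulrCA [leLHS]mulrC; apply: ler_wpM2l; first exact: sqr_ge0.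
  rewrite exprMn exprVn mulrA ler_pdivlMr ?exprn_gt0; [nra|lra..].
have B m : (2 * m%:R + 1) * central_bin m ^+ 2 <= 1.
  elim: m => [|m IH]; first by rewrite /central_bin bin0 expr0 divr1 expr1n; lra.
  apply: le_trans IH; rewrite central_binS -[m.+1%:R]natr1.
  move: (central_bin m) (ler0n R m) => p; move: (m%:R : R) => x x0.
  rewrite exprMn [leLHS]mulrCA [leRHS]mulrC; apply: ler_wpM2l; first exact: sqr_ge0.
  rewrite exprMn exprVn mulrA ler_pdivrMr ?exprn_gt0; [|lra..].
  by rewrite -subr_ge0 (_ : _ - _ = 2 * x + 1); [lra|ring].
exists 1 => _ [m _ <-]; apply: le_trans (B m).
by have m0 := ler0n R m; apply: ler_wpM2r; [exact: sqr_ge0|lra].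
Qed.

(** The factors are (m - i) / (m + k - i). Their denominators lie between m and m + k, and
    estimating each of them by an exponential gives the two Gaussian bounds that follow. *)
Lemma bin_ratio (m k : nat) : (k <= m)%N ->
  'C(m.*2, m + k)%:R / 'C(m.*2, m)%:R = \prod_(i < k) (1 - k%:R / (m + k - i)%:R) :> R.
Proof.
move=> km.
have h1 : ('C(m.*2, m + k) * ((m + k)`! * (m - k)`!) = m.*2`!)%N.
  by rewrite -(@bin_fact m.*2 (m + k)%N); [congr (_ * (_ * _`!))%N; lia|lia].
have h2 : ('C(m.*2, m) * (m`! * m`!) = m.*2`!)%N.
  by rewrite -(@bin_fact m.*2 m); [congr (_ * (_ * _`!))%N; lia|lia].
have h3 : ((m + k)^_k * m`! = (m + k)`!)%N.
  by rewrite -(@ffact_fact (m + k)%N k) ?leq_addl// addnK.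
have h4 := ffact_fact km.
have f0 n : n`!%:R != 0 :> R by rewrite pnatr_eq0 -lt0n fact_gt0.
have b0 : 'C(m.*2, m)%:R != 0 :> R by rewrite pnatr_eq0 -lt0n bin_gt0; lia.
have e0 : ((m + k)^_k)%:R != 0 :> R by rewrite pnatr_eq0 -lt0n ffact_gt0 leq_addl.
have -> : 'C(m.*2, m + k)%:R / 'C(m.*2, m)%:R = (m^_k)%:R / ((m + k)^_k)%:R :> R.
  apply/eqP; rewrite eqr_div//; apply/eqP.
  apply: (mulIf (f0 m)); apply: (mulIf (f0 (m - k)%N)).
  rewrite -!natrM; congr (_%:R).
  have -> : ('C(m.*2, m + k) * (m + k) ^_ k * m`! * (m - k)`! = m.*2`!)%N.
    by rewrite -h1 -h3; ring.
  by rewrite -h2 -{1}h4; ring.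
rewrite !ffact_prod !natr_prod -prodf_div; apply: eq_bigr => i _.
have ik := ltn_ord i.
rewrite !natrB; [|lia..]; rewrite natrD; field.
by rewrite -natrD -natrB ?pnatr_eq0; lia.
Qed.

Lemma bin_ratio_le (m k : nat) : (0 < k <= m)%N ->
  'C(m.*2, m + k)%:R / 'C(m.*2, m)%:R <= expR (- (k%:R ^+ 2 / (m + k)%:R)) :> R.
Proof.
move=> /andP[k0 km]; rewrite bin_ratio//.
rewrite (_ : - _ = - (k%:R / (m + k)%:R) * k%:R); last by ring.
rewrite expRM_natr -[k in expR _ ^+ k]card_ord -prodr_const.
apply: ler_prod => i _; have ik := ltn_ord i; apply/andP; split.
  by rewrite subr_ge0 ler_pdivrMr ?ltr0n ?mul1r ?ler_nat; lia.
apply: le_trans (onem_le_expR _); rewrite lerD2l lerN2 ler_pM2l ?ltr0n//.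
by rewrite lef_pV2 ?posrE ?ltr0n ?ler_nat; lia.
Qed.

Lemma bin_ratio_ge (m k : nat) : (0 < k < m)%N ->
  expR (- (k%:R ^+ 2 / (m - k)%:R)) <= 'C(m.*2, m + k)%:R / 'C(m.*2, m)%:R :> R.
Proof.
move=> /andP[k0 km]; rewrite bin_ratio ?(ltnW km)//.
have m0 : 0 < m%:R :> R by rewrite ltr0n; lia.
have km' : k%:R < m%:R :> R by rewrite ltr_nat.
rewrite (_ : - _ = - (k%:R / m%:R / (1 - k%:R / m%:R)) * k%:R); last first.
  by rewrite natrB 1?ltnW//; field; lra.
rewrite expRM_natr -[k in expR _ ^+ k]card_ord -prodr_const.
apply: ler_prod => i _; have ik := ltn_ord i; rewrite expR_ge0/=.
apply: le_trans (onem_ge_expR _) _; first by rewrite ltr_pdivrMr// mul1r.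
rewrite lerD2l lerN2 ler_pM2l ?ltr0n//.
by rewrite lef_pV2 ?posrE ?ltr0n ?ler_nat; lia.
Qed.

End CentralBinomial.

Lemma leqn_sqr (n : nat) : (n <= n ^ 2)%N.
Proof. by case: n => // n; rewrite -mulnn leq_pmulr. Qed.

Section FunctionalEquation.
Context (R : realType) (q : nat) (chi : int -> R).
Hypothesis q_gt1 : (1 < q)%N.
Hypothesis chi_char : real_dirichlet_character q chi.
Hypothesis chi_prim : primitive_character q chi.
Let d := parity chi.

Lemma parity_le1 : (parity chi <= 1)%N.
Proof. by rewrite /parity; case: ifP. Qed.

Let q_gt0 : 0 < q%:R :> R.
Proof. by rewrite ltr0n; lia. Qed.

Definition half_theta_term (x : R) (n : nat) : R :=
  n%:R ^+ parity chi * chi n * expR (- (pi * n%:R ^+ 2 * x / q%:R)).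

Definition half_theta (x : R) : R := limn (series (half_theta_term x)).

Lemma natX_chi_le (n : nat) : `|n%:R ^+ parity chi * chi n| <= n%:R :> R.
Proof.
case: n => [|n]; first by rewrite (chi0 q_gt1 chi_char) mulr0 normr0.
rewrite normrM -[leRHS]mulr1; apply: ler_pM => //; last exact: (chi_le1 q_gt1 chi_char).
rewrite normrX normr_nat; move: parity_le1.
by case: parity => [|[|//]] _; rewrite ?expr1// expr0 ler1n.
Qed.

Lemma half_theta_term_le (x : R) (n : nat) : 0 < x ->
  `|half_theta_term x n| <= n%:R * expR (- (pi * x / q%:R * n%:R)).
Proof.
move=> x0; rewrite normrM [X in _ * X]ger0_norm ?expR_ge0//.
apply: ler_pM => //; first exact: natX_chi_le.
rewrite ler_expR lerN2.
have -> : pi * n%:R ^+ 2 * x / q%:R = pi * x / q%:R * n%:R ^+ 2 by ring.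
rewrite ler_pM2l; last by rewrite divr_gt0// mulr_gt0// pi_gt0.
by rewrite -natrX ler_nat leqn_sqr.
Qed.

Lemma pixq_gt0 (x : R) : 0 < x -> 0 < pi * x / q%:R.
Proof. by move=> x0; rewrite divr_gt0// mulr_gt0// pi_gt0. Qed.

Lemma is_cvg_half_theta (x : R) : 0 < x -> cvgn (series (half_theta_term x)).
Proof.
move=> x0; apply: (dominated_series_cvg (fun n => half_theta_term_le n x0)).
exact/is_cvg_natM_expR/pixq_gt0.
Qed.

Lemma half_theta_term0 x : half_theta_term x 0 = 0.
Proof. by rewrite /half_theta_term (chi0 q_gt1 chi_char) mulr0 mul0r. Qed.

Lemma cvg_half_theta_succ (x : R) : 0 < x ->
  series (fun n => half_theta_term x n.+1) @ \oo --> half_theta x.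
Proof.
move=> x0.
have -> : series (fun n => half_theta_term x n.+1) =
    [sequence series (half_theta_term x) n.+1]_n.
  by apply/funext => n; rewrite /series/= big_nat_recl// half_theta_term0 add0r.
by rewrite cvg_shiftS; exact: is_cvg_half_theta.
Qed.

(** The signs of n^d and chi(n) under n -> - n cancel, and the term n = 0 vanishes because chi(0) =
    0. *)
Lemma theta_half_theta (x : R) : 0 < x -> theta q chi x = 2 * half_theta x.
Proof.
move=> x0; rewrite /theta /bilateral_sum mulr2n mulrDl mul1r; congr (_ + _).
rewrite -[RHS](cvg_lim _ (cvg_half_theta_succ x0))//; congr (limn (series _)).
apply/funext => n; rewrite /half_theta_term NegzE (chiN q_gt1 chi_char) rmorphN/=.
rewrite sqrrN -pmulrn; congr (_ * _).
by rewrite mulrA -exprMn mulrN1 opprK.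
Qed.

Section Scaling.
Context (x y : R).
Hypothesis x0 : 0 < x.
Hypothesis yE : y = pi * x / q%:R.
Let y0 : 0 < y.
Proof. by rewrite yE pixq_gt0. Qed.
(** An even l makes q l twice an integer for every q. The choice of m gives l^2 / m -> y, so that
    C(2m, m + l j) / C(2m, m) tends to exp(- y j^2) = exp(- pi j^2 x / q), while cos^(2m)(pi n / (q
    l)) tends to exp(- pi^2 n^2 / (q^2 y)) = exp(- pi n^2 / (q x)). These are the terms of theta at
    x and at 1/x. *)
Let l (N : nat) : nat := N.+1.*2.
Let h (N : nat) : nat := (q * N.+1)%N.
Let m (N : nat) : nat := (Num.truncn ((l N)%:R ^+ 2 / y)).+1.

Let l_gt0 N : 0 < (l N)%:R :> R. Proof. by rewrite ltr0n. Qed.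
Let m_gt0 N : 0 < (m N)%:R :> R. Proof. by rewrite ltr0n. Qed.

Let m_bounds N : (l N)%:R ^+ 2 / y < (m N)%:R <= (l N)%:R ^+ 2 / y + 1.
Proof.
have g0 : 0 <= (l N)%:R ^+ 2 / y by rewrite divr_ge0 ?sqr_ge0// ltW.
have /andP[h1 h2] := truncn_itv g0.
by rewrite /m h2 -natr1 lerD2r.
Qed.

Let cvg_lV : (fun N => (l N)%:R^-1) @ \oo --> (0 : R).
Proof.
have : (fun N : nat => (2^-1 : R) * N.+1%:R^-1) @ \oo --> 2^-1 * (0 : R).
  by apply: cvgM; [exact: cvg_cst | exact: cvg_harmonic].
rewrite mulr0; apply: cvg_trans; apply: near_eq_cvg; apply: nearW => N.
by rewrite /l -mul2n natrM invfM.
Qed.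

Let cvg_ml2 : (fun N => (m N)%:R / (l N)%:R ^+ 2) @ \oo --> y^-1.
Proof.
have cr : (fun N => y^-1 + (l N)%:R^-1 * (l N)%:R^-1) @ \oo --> y^-1.
  have : (fun N => y^-1 + (l N)%:R^-1 * (l N)%:R^-1) @ \oo --> y^-1 + 0 * 0.
    by apply: cvgD; [exact: cvg_cst | exact: cvgM].
  by rewrite mulr0 addr0.
apply: (squeeze_cvgr _ (cvg_cst y^-1) cr); apply: nearW => N.
have /andP[h1 h2] := m_bounds N; have l0 := l_gt0 N.
have l20 : 0 < (l N)%:R ^+ 2 :> R by rewrite exprn_gt0.
rewrite ler_pdivlMr// ler_pdivrMr// mulrC ltW//=.
apply: le_trans h2 _; rewrite le_eqVlt; apply/orP; left; apply/eqP; field.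
by rewrite !gt_eqF.
Qed.

Let cvg_l2m : (fun N => (l N)%:R ^+ 2 / (m N)%:R) @ \oo --> y.
Proof.
have : (fun N => ((m N)%:R / (l N)%:R ^+ 2)^-1) @ \oo --> y^-1^-1.
  by apply: cvgV => //; rewrite invr_neq0// gt_eqF.
rewrite invrK; apply: cvg_trans; apply: near_eq_cvg; apply: nearW => N.
by rewrite invf_div.
Qed.

Let cvg_lm : (fun N => (l N)%:R / (m N)%:R) @ \oo --> (0 : R).
Proof.
have : (fun N => (l N)%:R ^+ 2 / (m N)%:R * (l N)%:R^-1) @ \oo --> y * 0 by exact: cvgM.
rewrite mulr0; apply: cvg_trans; apply: near_eq_cvg; apply: nearW => N.
by field; rewrite !gt_eqF.
Qed.

Let cvg_m : m @ \oo --> \oo.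
Proof.
apply/cvgnyPge => A; have : (fun N => y * A%:R * ((l N)%:R^-1)) @ \oo --> y * A%:R * 0.
  by apply: cvgM => //; exact: cvg_cst.
rewrite mulr0 => /cvgr_lt => /(_ 1 ltr01); apply: filterS => N hN.
have /andP[h1 _] := m_bounds N.
rewrite -(ler_nat R) ltW//; apply: le_lt_trans h1.
rewrite ler_pdivlMr// mulrC.
have l1 : 1 <= (l N)%:R :> R by rewrite ler1n.
have : y * A%:R < (l N)%:R by move: hN; rewrite ltr_pdivrMr// mul1r.
have := l_gt0 N; nra.
Qed.

Let cvg_h : h @ \oo --> \oo.
Proof.
apply/cvgnyPge => A; exists A => // N /= AN; rewrite /h.
by nia.
Qed.

Let cvg_ratio (j : nat) :
  (fun N => 'C((m N).*2, m N + l N * j.+1)%:R / 'C((m N).*2, m N)%:R) @ \oo -->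
  expR (- (y * j.+1%:R ^+ 2)).
Proof.
pose k N := (l N * j.+1)%N.
have ck2 : (fun N => (k N)%:R ^+ 2 / (m N)%:R) @ \oo --> y * j.+1%:R ^+ 2.
  have : (fun N => (l N)%:R ^+ 2 / (m N)%:R * j.+1%:R ^+ 2) @ \oo --> y * j.+1%:R ^+ 2.
    by apply: cvgM => //; exact: cvg_cst.
  apply: cvg_trans; apply: near_eq_cvg; apply: nearW => N.
  by rewrite /k natrM; ring.
have ck : (fun N => (k N)%:R / (m N)%:R) @ \oo --> (0 : R).
  have : (fun N => (l N)%:R / (m N)%:R * j.+1%:R) @ \oo --> (0 : R) * j.+1%:R.
    by apply: cvgM => //; exact: cvg_cst.
  rewrite mul0r; apply: cvg_trans; apply: near_eq_cvg; apply: nearW => N.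
  by rewrite /k natrM; ring.
have near1 : \forall N \near \oo, (k N)%:R / (m N)%:R < 1 :> R by exact: (cvgr_lt _ ck).
(* The values s = -1 and s = 1 give the denominators m - k and m + k of the lower and upper Gaussian
   bounds. *)
have c1 (s : R) : (fun N => expR (- ((k N)%:R ^+ 2 / (m N)%:R / (1 + s * ((k N)%:R / (m N)%:R)))))
    @ \oo --> expR (- (y * j.+1%:R ^+ 2)).
  apply: continuous_cvg; first exact: continuous_expR.
  apply: cvgN; have cs : (fun N => 1 + s * ((k N)%:R / (m N)%:R)) @ \oo --> 1 + s * 0.
    by apply: cvgD; [exact: cvg_cst | apply: cvgM => //; exact: cvg_cst].
  rewrite mulr0 addr0 in cs.
  have : (fun N => (k N)%:R ^+ 2 / (m N)%:R / (1 + s * ((k N)%:R / (m N)%:R))) @ \oo -->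
      y * j.+1%:R ^+ 2 / 1 by apply: cvgM => //; exact: cvgV.
  by rewrite divr1.
apply: (squeeze_cvgr _ (c1 (-1)) (c1 1)); near=> N.
have k0 : (0 < k N)%N by rewrite muln_gt0.
have km : (k N < m N)%N.
  have : (k N)%:R / (m N)%:R < 1 :> R by near: N.
  by rewrite ltr_pdivrMr// mul1r ltr_nat.
have km' : (k N)%:R < (m N)%:R :> R by rewrite ltr_nat.
have m0 := m_gt0 N; have k0' : 0 < (k N)%:R :> R by rewrite ltr0n.
have -> : (k N)%:R ^+ 2 / (m N)%:R / (1 + -1 * ((k N)%:R / (m N)%:R)) =
    (k N)%:R ^+ 2 / (m N - k N)%:R :> R.
  by rewrite natrB 1?ltnW//; field; lra.
have -> : (k N)%:R ^+ 2 / (m N)%:R / (1 + 1 * ((k N)%:R / (m N)%:R)) =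
    (k N)%:R ^+ 2 / (m N + k N)%:R :> R.
  by rewrite natrD; field; lra.
by rewrite bin_ratio_ge ?k0// bin_ratio_le ?k0//= ltnW.
Unshelve. all: by end_near. Qed.

Let cvg_bin_side :
  (fun N => \sum_(j < m N) chi j.+1 * j.+1%:R ^+ d *
     ('C((m N).*2, m N + l N * j.+1)%:R / 'C((m N).*2, m N)%:R)) @ \oo --> half_theta x.
Proof.
have -> : (fun N => \sum_(j < m N) chi j.+1 * j.+1%:R ^+ d *
     ('C((m N).*2, m N + l N * j.+1)%:R / 'C((m N).*2, m N)%:R)) =
   (fun N => series (fun j : nat => chi j.+1 * j.+1%:R ^+ d *
     ('C((m N).*2, m N + l N * j.+1)%:R / 'C((m N).*2, m N)%:R)) (m N)).
  by apply/funext => N; rewrite /series/= big_mkord.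
rewrite -(cvg_lim _ (cvg_half_theta_succ x0))//.
(* For k = l (j + 1) <= m the exponent k^2 / (m + k) is at least k^2 / (2m), and l^2 / m > y / 2
   eventually; together they leave y / 4. For k > m the binomial is 0. *)
have y40 : 0 < y / 4 by rewrite divr_gt0.
apply: (@tannery _ _ _ (fun j => j.+1%:R * expR (- (y / 4 * j.+1%:R)))) => //.
- move=> j; rewrite /half_theta_term -/d [_ ^+ d * _]mulrC.
  apply: cvgM; first exact: cvg_cst.
  by rewrite (_ : _ / q%:R = y * j.+1%:R ^+ 2) ?cvg_ratio// yE; ring.
- have : \forall N \near \oo, y / 2 < (l N)%:R ^+ 2 / (m N)%:R.
    by apply: (cvgr_gt _ cvg_l2m); rewrite ltr_pdivrMr// ltr_pMr// ltr1n.
  apply: filterS => N hN j jm; rewrite [chi _ * _]mulrC normrM.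
  apply: ler_pM => //; first exact: natX_chi_le.
  rewrite ger0_norm ?divr_ge0//.
  have [kgt|kle] := ltnP (m N) (l N * j.+1).
    by rewrite bin_small ?mul0r ?expR_ge0//; lia.
  apply: le_trans (bin_ratio_le _ _) _; first by rewrite kle muln_gt0.
  rewrite ler_expR lerN2.
  apply: (@le_trans _ _ ((l N * j.+1)%:R ^+ 2 / (2 * (m N)%:R))); last first.
    rewrite ler_pM2l ?exprn_gt0 ?ltr0n ?muln_gt0//.
    rewrite lef_pV2 ?posrE ?ltr0n ?mulr_gt0// natrD mulrDl mul1r lerD2l ler_nat//.
  have -> : (l N * j.+1)%:R ^+ 2 / (2 * (m N)%:R) =
      (l N)%:R ^+ 2 / (m N)%:R / 2 * j.+1%:R ^+ 2 :> R.
    by rewrite natrM; field; rewrite gt_eqF.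
  apply: ler_pM => //; first exact: ltW.
    by move: (_ / _) hN => z; lra.
  by rewrite -natrX ler_nat leqn_sqr.
- have := is_cvg_natM_expR y40; set b := (fun n => _ * _) => cb.
  have -> : series (fun j => j.+1%:R * expR (- (y / 4 * j.+1%:R))) =
      [sequence series b n.+1]_n.
    by apply/funext => n; rewrite /series/= big_nat_recl// /b mul0r add0r.
  by apply/cvg_ex; exists (limn (series b)); rewrite cvg_shiftS.
Qed.

Let t (N n : nat) : R := pi * n%:R / (h N).*2%:R.

Let h2_gt0 N : 0 < (h N).*2%:R :> R.
Proof. by rewrite ltr0n double_gt0 muln_gt0 andbT; lia. Qed.

Let h2E N : (h N).*2%:R = q%:R * (l N)%:R :> R.
Proof. by rewrite -natrM; congr (_%:R); rewrite /h /l; lia. Qed.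

Let t_range N n : (0 < n < h N)%N -> 0 < t N n <= pi / 2.
Proof.
move=> /andP[n0 nh]; have p0 := pi_gt0 R; have h0 := h2_gt0 N.
rewrite /t; apply/andP; split; first by rewrite divr_gt0// mulr_gt0// ltr0n.
rewrite ler_pdivrMr//.
have -> : pi / 2 * (h N).*2%:R = pi * (h N)%:R :> R.
  by rewrite -muln2 natrM; field.
by rewrite ler_pM2l// ler_nat ltnW.
Qed.

Let near_t n : \forall N \near \oo, (n < h N)%N.
Proof. by have /cvgnyPge/(_ n.+1) := cvg_h. Qed.

Let cvg_t n : t^~ n @ \oo --> (0 : R).
Proof.
have : (fun N => pi * n%:R / q%:R * (l N)%:R^-1) @ \oo --> pi * n%:R / q%:R * (0 : R).
  by apply: cvgM => //; exact: cvg_cst.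
rewrite mulr0; apply: cvg_trans; apply: near_eq_cvg; apply: nearW => N.
by rewrite /t h2E invfM mulrA.
Qed.

Let mt2E N n : (m N)%:R * t N n ^+ 2 =
  (m N)%:R / (l N)%:R ^+ 2 * (pi ^+ 2 * n%:R ^+ 2 / q%:R ^+ 2).
Proof. by rewrite /t h2E; field; rewrite !gt_eqF. Qed.

Let cvg_cos_side :
  (fun N => \sum_(n < h N) chi n * (cos (t N n) ^+ ((m N).*2 - d) *
     ((h N).*2%:R / pi * sin (t N n)) ^+ d)) @ \oo --> half_theta x^-1.
Proof.
pose f N (n : nat) : R := chi n * (cos (t N n) ^+ ((m N).*2 - d) *
     ((h N).*2%:R / pi * sin (t N n)) ^+ d).
have -> : (fun N => \sum_(n < h N) chi n * (cos (t N n) ^+ ((m N).*2 - d) *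
     ((h N).*2%:R / pi * sin (t N n)) ^+ d)) = (fun N => series (f N) (h N)).
  by apply/funext => N; rewrite /series/= big_mkord.
have p0 := pi_gt0 R.
(* This comes from cos t <= exp(- t^2 / 4), an exponent 2m - d >= m, and m >= l^2 / y at t = pi n /
   (q l). The range n < h keeps t below pi / 2, as the cosine bound requires. *)
pose b := pi ^+ 2 / (4 * q%:R ^+ 2 * y).
have b0 : 0 < b by rewrite divr_gt0 ?exprn_gt0 ?mulr_gt0 ?exprn_gt0.
apply: (@tannery _ f _ (fun n => n%:R * expR (- (b * n%:R)))) => //.
- case=> [|n].
    rewrite half_theta_term0 /f (chi0 q_gt1 chi_char).
    by under eq_cvg do rewrite mul0r; exact: cvg_cst.
  have n1 : 0 < n.+1%:R :> R by rewrite ltr0n.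
  have t0 : \forall N \near \oo, 0 < t N n.+1 <= pi.
    by apply: filterS (near_t n.+1) => N hN; have := @t_range N n.+1 hN; lra.
  have c2 : (fun N => (h N).*2%:R / pi * sin (t N n.+1)) @ \oo --> (n.+1%:R : R).
    have : (fun N => n.+1%:R * (sin (t N n.+1) / t N n.+1)) @ \oo --> n.+1%:R * (1 : R).
      apply: cvgM; first exact: cvg_cst.
      by apply: cvg_sinc => //; exact: cvg_t.
    rewrite mulr1; apply: cvg_trans; apply: near_eq_cvg; apply: nearW => N.
    have E (p H a z : R) : 0 < p -> 0 < H -> 0 < a -> a * (z / (p * a / H)) = H / p * z.
      by move=> p1 H1 a1; field; rewrite !gt_eqF.
    exact: (E _ _ _ _ p0 (h2_gt0 N) n1).
  have c1 : (fun N => cos (t N n.+1) ^+ ((m N).*2 - d)) @ \oo -->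
      expR (- (pi * n.+1%:R ^+ 2 * x^-1 / q%:R)).
    apply: (@cvg_cosX _ (t^~ n.+1) (fun N => (m N).*2 - d)%N); [exact: t0 | exact: cvg_t |].
    have : (fun N => (m N)%:R / (l N)%:R ^+ 2 * (pi ^+ 2 * n.+1%:R ^+ 2 / q%:R ^+ 2) -
        d%:R / 2 * (t N n.+1 * t N n.+1)) @ \oo -->
        y^-1 * (pi ^+ 2 * n.+1%:R ^+ 2 / q%:R ^+ 2) - d%:R / 2 * ((0 : R) * 0).
      apply: cvgB; first by apply: cvgM => //; exact: cvg_cst.
      by apply: cvgM; [exact: cvg_cst | apply: cvgM; exact: cvg_t].
    have -> : y^-1 * (pi ^+ 2 * n.+1%:R ^+ 2 / q%:R ^+ 2) - d%:R / 2 * ((0 : R) * 0) =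
        pi * n.+1%:R ^+ 2 * x^-1 / q%:R.
      have E (p Q a z : R) : 0 < p -> 0 < Q -> 0 < z ->
          (p * z / Q)^-1 * (p ^+ 2 * a ^+ 2 / Q ^+ 2) = p * a ^+ 2 * z^-1 / Q.
        by move=> p1 Q1 z1; field; rewrite !gt_eqF.
      by rewrite !mulr0 subr0 yE E.
    apply: cvg_trans; apply: near_eq_cvg; apply: nearW => N.
    rewrite -mt2E natrB; last by have := parity_le1; rewrite -/d /m; lia.
    by rewrite -muln2 natrM; field.
  rewrite /f /half_theta_term -/d.
  have -> : n.+1%:R ^+ d * chi n.+1 * expR (- (pi * n.+1%:R ^+ 2 * x^-1 / q%:R)) =
      chi n.+1 * (expR (- (pi * n.+1%:R ^+ 2 * x^-1 / q%:R)) * n.+1%:R ^+ d) by ring.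
  apply: cvgM; first exact: cvg_cst.
  apply: cvgM => //.
  move: c2; have := parity_le1; rewrite -/d; case: (d) => [|[|//]] _ c2.
    by under eq_cvg do rewrite expr0; exact: cvg_cst.
  by under eq_cvg do rewrite expr1; exact: c2.
- apply: nearW => N [|n] nh.
    by rewrite /f (chi0 q_gt1 chi_char) !mul0r normr0.
  have /andP[t0 t1] := @t_range N n.+1 nh.
  have n1 : 0 < n.+1%:R :> R by rewrite ltr0n.
  have h0 := h2_gt0 N.
  have t01 : 0 <= t N n.+1 <= pi / 2 by rewrite ltW.
  rewrite /f mulrCA normrM mulrC; apply: ler_pM => //.
    apply: le_trans (natX_chi_le n.+1); rewrite [_ ^+ _ * chi _]mulrC !normrM.
    apply: ler_wpM2l => //; rewrite -/d !normrX.
    apply: lerXn2r; rewrite ?nnegrE//.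
    have /andP[_ sle] : t N n.+1 * cos (t N n.+1) <= sin (t N n.+1) <= t N n.+1.
      by apply: sin_bounds; lra.
    have sg : 0 <= sin (t N n.+1) by apply: sin_ge0_pi; lra.
    rewrite normr_nat ger0_norm; last by rewrite mulr_ge0 ?divr_ge0// ltW.
    apply: (@le_trans _ _ ((h N).*2%:R / pi * t N n.+1)).
      by rewrite ler_pM2l// divr_gt0.
    have E (p H a : R) : 0 < p -> 0 < H -> H / p * (p * a / H) = a.
      by move=> p1 H1; field; rewrite !gt_eqF.
    by rewrite /t E.
  have cg : 0 <= cos (t N n.+1) by apply: cos_ge0_pihalf; lra.
  rewrite ger0_norm ?exprn_ge0//.
  apply: (@le_trans _ _ (expR (- (t N n.+1 ^+ 2 / 4)) ^+ ((m N).*2 - d))).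
    by apply: lerXn2r; rewrite ?nnegrE ?expR_ge0//; exact: cos_le_expR.
  rewrite -expRM_natr ler_expR mulNr lerN2.
  apply: (@le_trans _ _ (t N n.+1 ^+ 2 / 4 * (m N)%:R)); last first.
    rewrite ler_pM2l ?divr_gt0 ?exprn_gt0// ler_nat.
    by have := parity_le1; rewrite -/d /m; lia.
  have -> : t N n.+1 ^+ 2 / 4 * (m N)%:R = (m N)%:R * t N n.+1 ^+ 2 / 4 by ring.
  rewrite mt2E.
  have /andP[hm _] := m_bounds N.
  have lm : y^-1 <= (m N)%:R / (l N)%:R ^+ 2.
    by rewrite ler_pdivlMr ?exprn_gt0// mulrC ltW.
  have -> : b * n.+1%:R = y^-1 * (pi ^+ 2 * n.+1%:R / q%:R ^+ 2) / 4.
    have E (p Q a z : R) : 0 < Q -> 0 < z ->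
        p ^+ 2 / (4 * Q ^+ 2 * z) * a = z^-1 * (p ^+ 2 * a / Q ^+ 2) / 4.
      by move=> Q1 z1; field; rewrite !gt_eqF.
    exact: E.
  rewrite ler_pM2r//; apply: ler_pM => //.
  - by rewrite invr_ge0 ltW.
  - by rewrite divr_ge0 ?sqr_ge0// mulr_ge0 ?sqr_ge0.
  - rewrite ler_pM2r ?invr_gt0 ?exprn_gt0// ler_pM2l ?exprn_gt0//.
    by rewrite -natrX ler_nat leqn_sqr.
- exact: is_cvg_natM_expR.
Qed.

(* [finite_theta] along h = q (N + 1), l = 2 (N + 1), m ~ l^2 / y. *)
Lemma half_theta_scaling (tau K : R) :
  (forall l m h : nat,
    (0 < l)%N -> (0 < m)%N -> (q * l)%N = h.*2 ->
    \sum_(n < h) chi n * ((2 * cos (pi * n%:R / h.*2%:R)) ^+ (m.*2 - d) *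
                          (2 * sin (pi * n%:R / h.*2%:R)) ^+ d) =
    tau * l%:R * \sum_(j < m) chi j.+1 * (((l * j.+1)%:R / m%:R) ^+ d *
                                     'C(m.*2, m + l * j.+1)%:R)) ->
  (fun m => central_bin R m * Num.sqrt m%:R) @ \oo --> K ->
  half_theta x^-1 = tau * K * Num.sqrt (pi / q%:R) * (x ^+ d * Num.sqrt x) * half_theta x.
Proof.
move=> Htau cK; have p0 := pi_gt0 R.
(* The product of the square root of l^2 / m with [central_bin] times the square root of m is l
   times [central_bin]; it is split so that each factor converges. *)
pose coef N := tau * ((q%:R / pi * ((l N)%:R ^+ 2 / (m N)%:R)) ^+ d *
  Num.sqrt ((l N)%:R ^+ 2 / (m N)%:R) * (central_bin R (m N) * Num.sqrt (m N)%:R)).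
have ccoef : coef @ \oo --> tau * ((q%:R / pi * y) ^+ d * Num.sqrt y * K).
  apply: cvgM; first exact: cvg_cst.
  apply: cvgM; last by apply: (cvg_comp _ _ cvg_m cK).
  apply: cvgM; last by apply: (cvg_comp _ _ cvg_l2m); exact: sqrt_continuous.
  have c1 : (fun N => q%:R / pi * ((l N)%:R ^+ 2 / (m N)%:R)) @ \oo --> q%:R / pi * y.
    by apply: cvgM => //; exact: cvg_cst.
  have := parity_le1; rewrite -/d; case: (d) => [|[|//]] _.
    by under eq_cvg do rewrite expr0; exact: cvg_cst.
  by under eq_cvg do rewrite expr1; exact: c1.
have E N : \sum_(n < h N) chi n * (cos (t N n) ^+ ((m N).*2 - d) *
     ((h N).*2%:R / pi * sin (t N n)) ^+ d) = coef N *
   \sum_(j < m N) chi j.+1 * j.+1%:R ^+ d *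
     ('C((m N).*2, m N + l N * j.+1)%:R / 'C((m N).*2, m N)%:R).
  have lN0 : (0 < l N)%N by [].
  have mN0 : (0 < m N)%N by [].
  have qlh : (q * l N)%N = (h N).*2 by rewrite /h /l; lia.
  have := Htau _ _ _ lN0 mN0 qlh.
  (* Division by 4^m removes the factors 2 from cosine and sine; the scaling by 2h / pi makes the
     sine tend to n instead of 0. *)
  move/(congr1 (fun z => ((h N).*2%:R / pi) ^+ d / 4 ^+ m N * z)).
  rewrite -/(t N _) !mulr_sumr.
  have m0 := m_gt0 N; have l0 := l_gt0 N; have h0 := h2_gt0 N.
  have dm : (d <= (m N).*2)%N by have := parity_le1; rewrite -/d /m; lia.
  have four : 4 ^+ m N = 2 ^+ ((m N).*2 - d) * 2 ^+ d :> R.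
    by rewrite -exprD subnK// -mul2n exprM; congr (_ ^+ _); ring.
  move=> Heq; transitivity (\sum_(i < h N) ((h N).*2%:R / pi) ^+ d / 4 ^+ m N *
     (chi i * ((2 * cos (t N i)) ^+ ((m N).*2 - d) * (2 * sin (t N i)) ^+ d))).
    apply: eq_bigr => n _; rewrite four !exprMn; field.
    by rewrite !expf_neq0// gt_eqF.
  rewrite Heq; apply: eq_bigr => j _; rewrite /coef /central_bin.
  have -> : Num.sqrt ((l N)%:R ^+ 2 / (m N)%:R) = (l N)%:R / Num.sqrt (m N)%:R :> R.
    by rewrite sqrtrM ?sqr_ge0// sqrtr_sqr sqrtrV// ger0_norm.
  have sm : Num.sqrt (m N)%:R != 0 :> R by rewrite gt_eqF// sqrtr_gt0.
  have bm : 'C((m N).*2, m N)%:R != 0 :> R by rewrite pnatr_eq0 -lt0n bin_gt0; lia.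
  have -> : ((h N).*2%:R / pi) ^+ d / 4 ^+ m N * (tau * (l N)%:R *
     (chi j.+1 * (((l N * j.+1)%:R / (m N)%:R) ^+ d * 'C((m N).*2, m N + l N * j.+1)%:R))) =
     (((h N).*2%:R / pi) * ((l N * j.+1)%:R / (m N)%:R)) ^+ d *
     (tau * (l N)%:R * chi j.+1 * 'C((m N).*2, m N + l N * j.+1)%:R / 4 ^+ m N).
    by rewrite [in RHS]exprMn; ring.
  have -> : ((h N).*2%:R / pi) * ((l N * j.+1)%:R / (m N)%:R) =
      (q%:R / pi * ((l N)%:R ^+ 2 / (m N)%:R)) * j.+1%:R :> R.
    have E (p Q a w z : R) : 0 < p -> 0 < w ->
        Q * a / p * (a * z / w) = Q / p * (a ^+ 2 / w) * z.
      by move=> p1 w1; field; rewrite !gt_eqF.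
    by rewrite h2E natrM E.
  rewrite [in LHS]exprMn; move: ((_ / pi * _) ^+ d) => z.
  field; rewrite bm sm expf_neq0//.
have c1 := cvg_cos_side; rewrite (funext E) in c1.
have c2 := cvgM ccoef cvg_bin_side.
have -> : half_theta x^-1 = tau * ((q%:R / pi * y) ^+ d * Num.sqrt y * K) * half_theta x.
  rewrite -(cvg_lim (@Rhausdorff R) c1); exact: (cvg_lim (@Rhausdorff R) (c2 _)).
have -> : q%:R / pi * y = x.
  have E' (p Q z : R) : 0 < p -> 0 < Q -> Q / p * (p * z / Q) = z.
    by move=> p1 Q1; field; rewrite !gt_eqF.
  by rewrite yE E'.
have -> : Num.sqrt y = Num.sqrt (pi / q%:R) * Num.sqrt x.
  by rewrite -sqrtrM ?divr_ge0// 1?ltW// yE mulrAC.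
by ring.
Qed.

End Scaling.

(** The scaling identity has a constant tau * K * sqrt(pi / q) independent of x. Its value at x = 1
    fixes this product as a whole, so neither the Gauss sum nor the limit K is computed. *)
Lemma half_theta_inv : (forall x : R, 0 < x -> 0 < theta q chi x) ->
  forall x : R, 0 < x ->
  half_theta x^-1 = x ^+ parity chi * Num.sqrt x * half_theta x.
Proof.
move=> theta_gt0.
have [tau Htau] := finite_theta q_gt1 chi_char chi_prim.
have /cvg_ex[K cK] := @cvg_central_bin R.
have H x (x0 : 0 < x) := half_theta_scaling x0 (erefl _) Htau cK.
have h1 : 0 < half_theta 1.
  by have := theta_gt0 _ ltr01; rewrite theta_half_theta// pmulr_rgt0.
have c1 : tau * K * Num.sqrt (pi / q%:R) = 1.
  have := H 1 ltr01; rewrite invr1 expr1n sqrtr1 !mulr1.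
  by rewrite -{1}[half_theta 1]mul1r => /mulIf <-//; rewrite gt_eqF.
by move=> x x0; rewrite H// c1 mul1r.
Qed.

End FunctionalEquation.

(** * Integrals on the half-line and Mellin transforms *)

Section HalfLine.
Context (R : realType).
Local Notation mu := (@lebesgue_measure R).
Local Notation D := (`]0, +oo[%classic : set R).

Lemma measurable_half_line : measurable D.
Proof. exact: measurable_itv. Qed.

Lemma half_lineP (x : R) : D x <-> 0 < x.
Proof. by rewrite /= in_itv/= andbT. Qed.

(** The endpoints are general because a substitution replaces the standard intervals by their
    images. *)
Lemma exhaust_half_line (a b : nat -> R) (f : R -> R) :
  (forall n, 0 < a n) -> {homo a : m n / (m <= n)%N >-> n <= m} ->
  {homo b : m n / (m <= n)%N >-> m <= n} ->
  (forall x : R, 0 < x -> exists n, a n <= x <= b n) ->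
  measurable_fun D f -> (forall x : R, 0 < x -> 0 <= f x) ->
  (fun n => \int[mu]_(x in `[a n, b n]) (f x)%:E)%E @ \oo -->
  (\int[mu]_(x in D) (f x)%:E)%E.
Proof.
move=> a0 am bm ab mf f0.
have sub n : `[a n, b n]%classic `<=` D.
  by move=> x /=; rewrite !in_itv/= andbT => /andP[+ _]; exact: lt_le_trans.
have -> : D = \bigcup_n `[a n, b n]%classic.
  apply/seteqP; split => x; last by move=> [n _ /sub].
  by move/half_lineP/ab => [n xn]; exists n => //=; rewrite in_itv.
apply: ge0_nondecreasing_set_cvg_integral => //.
- move=> m n mn; rewrite subsetEset => x /=; rewrite !in_itv/= => /andP[h1 h2].
  by rewrite (le_trans (am _ _ mn) h1) (le_trans h2 (bm _ _ mn)).
- move=> n; apply/measurable_EFinP.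
  by apply: measurable_funS (sub n) mf; exact: measurable_half_line.
- by move=> n x /sub /half_lineP x0; rewrite lee_fin f0.
Qed.

Definition lo (n : nat) : R := n.+1%:R^-1.
Definition hi (n : nat) : R := n.+1%:R.

Lemma lo_gt0 n : 0 < lo n. Proof. by rewrite invr_gt0 ltr0n. Qed.

Lemma lo_homo : {homo lo : m n / (m <= n)%N >-> n <= m}.
Proof. by move=> m n mn; rewrite lef_pV2 ?posrE ?ltr0n// ler_nat. Qed.

Lemma hi_homo : {homo hi : m n / (m <= n)%N >-> m <= n}.
Proof. by move=> m n mn; rewrite ler_nat. Qed.

Lemma lo_le_hi n : lo n <= hi n.
Proof. by apply: (@le_trans _ _ 1); rewrite ?invf_le1 ?ltr0n// ler1n. Qed.

Lemma lo_hi_exhaust x : 0 < x -> exists n, lo n <= x <= hi n.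
Proof.
move=> x0; have xV0 : 0 < x^-1 by rewrite invr_gt0.
exists (Num.truncn x + Num.truncn x^-1)%N; rewrite /lo /hi.
have /andP[_ h1] := truncn_itv (ltW x0).
have /andP[_ h2] := truncn_itv (ltW xV0).
apply/andP; split.
  rewrite -[leRHS]invrK lef_pV2 ?posrE ?ltr0n//; apply: le_trans (ltW h2) _.
  by rewrite ler_nat ltnS leq_addl.
by apply: le_trans (ltW h1) _; rewrite ler_nat ltnS leq_addr.
Qed.

Lemma continuous_half_line_measurable (f : R -> R) :
  (forall x : R, 0 < x -> {for x, continuous f}) -> measurable_fun D f.
Proof.
move=> cf; apply: open_continuous_measurable_fun; first exact: interval_open.
by move=> x; rewrite inE => /half_lineP/cf.
Qed.

Lemma continuous_within_pos (f : R -> R) (a b : R) : 0 < a ->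
  (forall x : R, 0 < x -> {for x, continuous f}) -> {within `[a, b], continuous f}.
Proof.
move=> a0 cf; apply: continuous_in_subspaceT => x; rewrite inE/= in_itv/= => /andP[ax _].
exact/cf/(lt_le_trans a0).
Qed.

Lemma derivable_oo_pos (F dF : R -> R) (a b : R) : 0 < a -> a <= b ->
  (forall x : R, 0 < x -> is_derive x 1 F (dF x)) -> derivable_oo_LRcontinuous F a b.
Proof.
move=> a0 ab dFE.
have cF (x : R) : 0 < x -> {for x, continuous F}.
  move=> x0; apply: differentiable_continuous; apply/derivable1_diffP.
  by have [] := dFE _ x0.
split.
- move=> x; rewrite in_itv/= => /andP[ax _].
  by have [] := dFE _ (lt_trans a0 ax).
- by apply: cvg_at_right_filter; exact: cF.
- by apply: cvg_at_left_filter; apply: cF; exact: lt_le_trans ab.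
Qed.

Lemma derive1_pos (F dF : R -> R) (x : R) :
  (forall x : R, 0 < x -> is_derive x 1 F (dF x)) -> 0 < x -> derive1 F x = dF x.
Proof. by move=> dFE x0; rewrite derive1E; have [_] := dFE _ x0. Qed.

Lemma integral_antiderivative (f F : R -> R) (l0 l1 : R) :
  (forall x : R, 0 < x -> 0 <= f x) -> (forall x : R, 0 < x -> {for x, continuous f}) ->
  (forall x : R, 0 < x -> is_derive x 1 F (f x)) ->
  (F \o lo) @ \oo --> l0 -> (F \o hi) @ \oo --> l1 ->
  (\int[mu]_(x in D) (f x)%:E = (l1 - l0)%:E)%E.
Proof.
move=> f0 cf dF Fl0 Fl1.
have mf := continuous_half_line_measurable cf.
have := exhaust_half_line lo_gt0 lo_homo hi_homo lo_hi_exhaust mf f0.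
(* For n = 0 the interval is the single point 1, whereas the fundamental theorem of calculus needs
   distinct endpoints. *)
rewrite -cvg_shiftS.
have -> : [sequence (\int[mu]_(x in `[lo n.+1, hi n.+1]) (f x)%:E)%E]_n =
    EFin \o (fun n => F (hi n.+1) - F (lo n.+1)).
  apply/funext => n /=; rewrite EFinB; apply: continuous_FTC2.
  - by apply: (@lt_trans _ _ 1); rewrite ?invf_lt1 ?ltr0n// ltr1n.
  - exact: continuous_within_pos (lo_gt0 _) cf.
  - exact: derivable_oo_pos (lo_gt0 _) (lo_le_hi _) dF.
  - move=> x; rewrite in_itv/= => /andP[x0 _].
    by apply: derive1_pos dF _; exact: lt_trans (lo_gt0 _) x0.
move=> h; apply: (cvg_unique _ h); first exact: ereal_hausdorff.
apply: cvg_EFin; first by apply: nearW.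
apply: cvgB.
  by have := Fl1; rewrite -cvg_shiftS.
by have := Fl0; rewrite -cvg_shiftS.
Qed.

Lemma integrable_antiderivative (f F : R -> R) (l0 l1 : R) :
  (forall x : R, 0 < x -> 0 <= f x) -> (forall x : R, 0 < x -> {for x, continuous f}) ->
  (forall x : R, 0 < x -> is_derive x 1 F (f x)) ->
  (F \o lo) @ \oo --> l0 -> (F \o hi) @ \oo --> l1 ->
  mu.-integrable D (EFin \o f).
Proof.
move=> f0 cf dF Fl0 Fl1; apply/integrableP; split.
  by apply/measurable_EFinP; exact: continuous_half_line_measurable.
under eq_integral => x /[!inE] /half_lineP x0 do rewrite /= ger0_norm ?f0//.
by rewrite (integral_antiderivative f0 cf dF Fl0 Fl1) ltry.
Qed.

Lemma continuous_powR (p x : R) : 0 < x -> {for x, continuous (fun t : R => t `^ p)}.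
Proof.
move=> x0; apply: differentiable_continuous; apply/derivable1_diffP.
by apply: derivable_powR; rewrite in_itv/= x0.
Qed.

Lemma continuous_expRNM (a x : R) : {for x, continuous (fun t : R => expR (- (a * t)))}.
Proof.
apply: continuous_comp; last exact: continuous_expR.
by apply: continuousN; apply: continuousM; [exact: cst_continuous | exact: cvg_id].
Qed.

Lemma continuous_expRNV (b x : R) : 0 < x ->
  {for x, continuous (fun t : R => expR (- (b / t)))}.
Proof.
move=> x0; apply: continuous_comp; last exact: continuous_expR.
apply: continuousN; apply: continuousM; first exact: cst_continuous.
by apply: continuousV; [rewrite gt_eqF | exact: cvg_id].
Qed.

Lemma integrable_dominated (f g : R -> R) :
  measurable_fun D f -> mu.-integrable D (EFin \o g) ->
  (forall x : R, 0 < x -> `|f x| <= g x) -> mu.-integrable D (EFin \o f).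
Proof.
move=> mf ig fg; apply: (le_integrable _ _ _ ig).
- exact: measurable_half_line.
- exact/measurable_EFinP.
- move=> x /half_lineP x0; rewrite /= lee_fin.
  by apply: le_trans (fg _ x0) _; exact: ler_norm.
Qed.

Lemma integrable_scale (c : R) (f : R -> R) :
  mu.-integrable D (EFin \o f) -> mu.-integrable D (EFin \o (fun x => c * f x)).
Proof.
move=> fi; rewrite (_ : EFin \o _ = (fun x => c%:E * (EFin \o f) x)%E).
  by apply: integrableZl => //; exact: measurable_half_line.
by apply/funext => x; rewrite /= EFinM.
Qed.

(** The integrand has the antiderivative - 1 / (r (1 + x^r)). It behaves like x^(r - 1) at 0 and is
    integrable at infinity, so the Gamma and Bessel integrands are compared with it. *)
Lemma integrable_powR_ratio (r : R) : 0 < r ->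
  mu.-integrable D (EFin \o (fun x => x `^ (r - 1) / (1 + x `^ r) ^+ 2)).
Proof.
move=> r0.
have den0 (x : R) : 0 < 1 + x `^ r by have := powR_ge0 x r; lra.
pose F (x : R) : R := - r^-1 * (1 + x `^ r)^-1.
have cp : (fun n => hi n `^ r) @ \oo --> +oo%R.
  apply/cvgryPge => A; near=> n.
  have h1 : (Num.max A 1) `^ r^-1 <= hi n.
    near: n; have /cvgryPge := @cvgr_idn R; move=> /(_ (Num.max A 1 `^ r^-1)).
    by apply: filterS => n hn; apply: le_trans hn _; rewrite ler_nat.
  apply: (@le_trans _ _ (Num.max A 1)); first by rewrite le_max lexx.
  have M0 : 0 <= Num.max A 1 by rewrite le_max ler01 orbT.
  rewrite -[leLHS]powRr1// -[X in _ `^ X](@mulVf _ r) ?gt_eqF// powRrM.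
  by apply: ge0_ler_powR => //; rewrite ?nnegrE ?powR_ge0 ?ler0n// ltW.
have cV : (fun n => (1 + hi n `^ r)^-1) @ \oo --> (0 : R).
  apply/gtr0_cvgV0; first by apply: nearW => n.
  apply/cvgryPge => A; have /cvgryPge := cp => /(_ A).
  by apply: filterS => n h; lra.
apply: (@integrable_antiderivative _ F (- r^-1 * 1) (- r^-1 * 0)).
- by move=> x x0; rewrite divr_ge0 ?sqr_ge0 ?powR_ge0.
- move=> x x0; apply: continuousM; first exact: continuous_powR.
  apply: continuousV; first by rewrite expf_neq0// gt_eqF.
  apply: (@continuous_comp _ _ _ (fun x => 1 + x `^ r) (fun z => z ^+ 2)).
    by apply: continuousD; [exact: cst_continuous | exact: continuous_powR].
  exact: exprn_continuous.
- move=> x x0; rewrite /F.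
  have h := is_derive1_powR r x0.
  have e0 : 1 + x `^ r != 0 by rewrite gt_eqF.
  have hD : is_derive x 1 (fun t : R => 1 + t `^ r) (0 + r * x `^ (r - 1)).
    exact: is_deriveD.
  have hV := @is_deriveV _ (fun t : R => 1 + t `^ r) x _ 1 e0 hD.
  have hM := is_deriveZ (- r^-1) hV.
  have -> : x `^ (r - 1) / (1 + x `^ r) ^+ 2 =
      - r^-1 *: (- (1 + x `^ r) ^- 2 *: (0 + r * x `^ (r - 1))).
    by rewrite /GRing.scale/= add0r; field; rewrite e0 gt_eqF.
  exact: hM.
- apply: cvgM; first exact: cvg_cst.
  rewrite -invr1; apply: cvgV => //.
  have : (fun n => 1 + (1 + hi n `^ r - 1)^-1) @ \oo --> 1 + (0 : R).
    apply: cvgD; first exact: cvg_cst.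
    apply/gtr0_cvgV0; first by apply: nearW => n; rewrite addrAC subrr add0r powR_gt0 ?ltr0n.
    by under eq_cvg do rewrite addrAC subrr add0r.
  rewrite addr0; apply: cvg_trans; apply: near_eq_cvg; apply: nearW => n /=.
  have E : lo n `^ r = (hi n `^ r)^-1.
    by rewrite /lo -powR_inv1 ?ler0n// -powRrM mulN1r powRN.
  by rewrite E addrAC subrr add0r invr1.
- by apply: cvgM => //; exact: cvg_cst.
Unshelve. all: by end_near. Qed.

Lemma integrable_powR_expR (r a : R) : 0 < r -> 0 < a ->
  mu.-integrable D (EFin \o (fun x => x `^ (r - 1) * expR (- (a * x)))).
Proof.
move=> r0 a0.
pose k := (Num.truncn r).+1.
have rk : r <= k%:R by have /andP[_ /ltW] := truncn_itv (ltW r0).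
pose b := a / 2.
have b0 : 0 < b by rewrite divr_gt0.
(* A bound for (1 + x^r)^2 exp(- a x): the square is at most 4 (1 + x)^(2k), one term of the
   exponential series gives (b (1 + x))^(2k) / (2k)! <= exp(b (1 + x)), and b (1 + x) - a x <= 2 b
   because a = 2 b. *)
pose C := 4 * expR (2 * b) * ((k.*2)`!%:R / b ^+ k.*2).
have C0 : 0 < C.
  by rewrite !mulr_gt0 ?expR_gt0 ?ltr0n ?fact_gt0// invr_gt0 exprn_gt0.
have key (x : R) : 0 < x -> (1 + x `^ r) ^+ 2 * expR (- (a * x)) <= C.
  move=> x0; have x1 : 1 <= 1 + x by lra.
  have h1 : x `^ r <= (1 + x) ^+ k.
    apply: (@le_trans _ _ ((1 + x) `^ r)).
      by apply: ge0_ler_powR; rewrite ?nnegrE; [exact: ltW|lra..].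
    by rewrite -powR_mulrn ?ler_powR//; lra.
  have h1' : 1 <= (1 + x) ^+ k by exact: exprn_ege1.
  have h2 : (1 + x `^ r) ^+ 2 <= 4 * (1 + x) ^+ k.*2.
    rewrite (_ : 4 * _ = (2 * (1 + x) ^+ k) ^+ 2); last first.
      by rewrite exprMn -exprM muln2; congr (_ * _); ring.
    rewrite lerXn2r ?nnegrE//; [have := powR_ge0 x r; lra|lra|lra].
  have h3 : (b * (1 + x)) ^+ k.*2 / (k.*2)`!%:R <= expR (b * (1 + x)).
    have bx0 : 0 <= b * (1 + x) by rewrite mulr_ge0// ?ltW//; lra.
    by have := expR_ge1Dxn k.*2.-1 bx0; apply: le_trans; rewrite lerDr.
  have h4 : (1 + x) ^+ k.*2 <= (k.*2)`!%:R / b ^+ k.*2 * expR (b * (1 + x)).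
    move: h3; rewrite exprMn ler_pdivrMr ?ltr0n ?fact_gt0// => h3.
    rewrite mulrAC ler_pdivlMr ?exprn_gt0// mulrC.
    by apply: le_trans h3 _; rewrite mulrC.
  apply: (@le_trans _ _ (4 * ((k.*2)`!%:R / b ^+ k.*2 * expR (b * (1 + x))) * expR (- (a * x)))).
    by apply: ler_wpM2r; [exact: expR_ge0 | apply: le_trans h2 _; rewrite ler_pM2l].
  have Q0 : 0 < (k.*2)`!%:R / b ^+ k.*2 by rewrite divr_gt0 ?exprn_gt0 ?ltr0n ?fact_gt0.
  rewrite /C; move: (_ / _) Q0 => Q Q0.
  have -> : 4 * (Q * expR (b * (1 + x))) * expR (- (a * x)) =
      4 * Q * (expR (b * (1 + x)) * expR (- (a * x))) by ring.
  rewrite [leRHS]mulrAC ler_pM2l ?mulr_gt0// -expRD ler_expR /b.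
  by nra.
have iC := integrable_scale C (integrable_powR_ratio r0).
apply: (@integrable_dominated _ (fun x => C * (x `^ (r - 1) / (1 + x `^ r) ^+ 2))).
- apply: measurable_funM; first exact: measurable_funTS (measurable_powR _).
  by apply: continuous_half_line_measurable => x _; exact: continuous_expRNM.
- exact: iC.
- move=> x x0; have e0 : 0 < 1 + x `^ r by have := powR_ge0 x r; lra.
  rewrite ger0_norm ?mulr_ge0 ?powR_ge0 ?expR_ge0// mulrCA.
  apply: ler_wpM2l; first exact: powR_ge0.
  by rewrite ler_pdivlMr ?exprn_gt0// mulrC key.
Qed.

(** Near 0, exp(- b / x) is at most a multiple of x^k; taking k > |p| lifts the exponent p above -1
    and reduces the claim to the Gamma integrand. *)
Lemma integrable_powR_expR2 (p a b : R) : 0 < a -> 0 < b ->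
  mu.-integrable D (EFin \o (fun x => x `^ p * expR (- (a * x)) * expR (- (b / x)))).
Proof.
move=> a0 b0.
pose k := (Num.truncn `|p|).+1.
have pk : `|p| < k%:R by have /andP[_] := truncn_itv (normr_ge0 p).
have r0 : 0 < p + k%:R + 1 by have := ler_norm (- p); rewrite normrN; lra.
pose C := (k`!)%:R / b ^+ k.
have iC := integrable_scale C (integrable_powR_expR r0 a0).
apply: (@integrable_dominated _
  (fun x => C * (x `^ (p + k%:R + 1 - 1) * expR (- (a * x))))).
- apply: measurable_funM; first apply: measurable_funM.
  + exact: measurable_funTS (measurable_powR _).
  + by apply: continuous_half_line_measurable => x _; exact: continuous_expRNM.
  + by apply: continuous_half_line_measurable => x; exact: continuous_expRNV.
- exact: iC.
- move=> x x0; rewrite addrK powRD; last by rewrite (gt_eqF x0) implybT.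
  rewrite powR_mulrn; last exact: ltW.
  have e2 : expR (- (b / x)) <= C * x ^+ k.
    have bx0 : 0 <= b / x by rewrite divr_ge0 ?ltW.
    have h := expR_ge1Dxn k.-1 bx0.
    have h' : (b / x) ^+ k / k`!%:R <= expR (b / x) by apply: le_trans h; rewrite lerDr.
    have f0 : 0 < k`!%:R :> R by rewrite ltr0n fact_gt0.
    have -> : C * x ^+ k = ((b / x) ^+ k / k`!%:R)^-1.
      rewrite /C exprMn exprVn; move: (b ^+ k) (x ^+ k) (exprn_gt0 k b0) (exprn_gt0 k x0).
      by move=> u v u0 v0; field; rewrite !gt_eqF.
    by rewrite expRN lef_pV2 ?posrE ?expR_gt0 ?divr_gt0 ?exprn_gt0 ?divr_gt0.
  rewrite ger0_norm ?mulr_ge0 ?powR_ge0 ?expR_ge0//.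
  have -> : C * (x `^ p * x ^+ k * expR (- (a * x))) =
      x `^ p * expR (- (a * x)) * (C * x ^+ k) by ring.
  by apply: ler_wpM2l => //; rewrite mulr_ge0 ?powR_ge0 ?expR_ge0.
Qed.

End HalfLine.

(** * Changes of variable on the half-line *)

Section Substitution.
Context (R : realType).
Local Notation mu := (@lebesgue_measure R).
Local Notation D := (`]0, +oo[%classic : set R).

Lemma continuous_derive1_pos (F dF : R -> R) (x : R) :
  (forall x : R, 0 < x -> is_derive x 1 F (dF x)) ->
  (forall x : R, 0 < x -> {for x, continuous dF}) ->
  0 < x -> {for x, continuous (derive1 F)}.
Proof.
move=> FdF cdF x0.
suff : derive1 F z @[z --> x] --> dF x by rewrite -(derive1_pos FdF x0).
apply: cvg_trans (cdF _ x0); apply: near_eq_cvg; near=> z.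
apply/esym/(derive1_pos FdF); near: z; exact: lt_nbhsr.
Unshelve. all: by end_near. Qed.

Lemma pos_derive_continuous (F dF : R -> R) (x : R) :
  (forall x : R, 0 < x -> is_derive x 1 F (dF x)) -> 0 < x -> {for x, continuous F}.
Proof.
move=> FdF x0; apply: differentiable_continuous; apply/derivable1_diffP.
by have [] := FdF _ x0.
Qed.

(** Both integrals are limits over compact intervals, one over [lo, hi] and the other over its
    images under phi, which exhaust the half-line by surjectivity. On each interval the compact
    substitution rule applies. *)
Lemma integral_half_line_subst_incr (phi dphi G : R -> R) :
  (forall x : R, 0 < x -> is_derive x 1 phi (dphi x)) ->
  (forall x : R, 0 < x -> {for x, continuous dphi}) ->
  (forall x : R, 0 < x -> 0 < dphi x) ->
  (forall x : R, 0 < x -> 0 < phi x) ->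
  (forall x y : R, 0 < x -> x < y -> phi x < phi y) ->
  (forall y : R, 0 < y -> exists2 x : R, 0 < x & phi x = y) ->
  (forall x : R, 0 < x -> 0 <= G x) ->
  (forall x : R, 0 < x -> {for x, continuous G}) ->
  (\int[mu]_(x in D) (G x)%:E = \int[mu]_(x in D) (G (phi x) * dphi x)%:E)%E.
Proof.
move=> phiE cdphi dphi0 phi0 phi_lt phi_surj G0 cG.
have phi_le (x y : R) : 0 < x -> x <= y -> phi x <= phi y.
  by move=> x0; rewrite le_eqVlt => /predU1P[->//|/phi_lt -/(_ x0)/ltW].
have c1 : (fun n => \int[mu]_(x in `[phi (lo R n), phi (hi R n)]) (G x)%:E)%E @ \oo -->
    (\int[mu]_(x in D) (G x)%:E)%E.
  apply: exhaust_half_line => //.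
  - by move=> n; exact/phi0/lo_gt0.
  - by move=> m n mn; apply: phi_le; [exact: lo_gt0 | exact: lo_homo].
  - by move=> m n mn; apply: phi_le; [exact: lt_le_trans (lo_gt0 _ m) (lo_le_hi _ m) | exact: hi_homo].
  - move=> y /phi_surj [x x0 <-]; have [n /andP[h1 h2]] := lo_hi_exhaust x0.
    by exists n; rewrite !phi_le// lo_gt0.
  - exact: continuous_half_line_measurable.
have c2 : (fun n => \int[mu]_(x in `[lo R n, hi R n]) (G (phi x) * dphi x)%:E)%E @ \oo -->
    (\int[mu]_(x in D) (G (phi x) * dphi x)%:E)%E.
  apply: (exhaust_half_line (@lo_gt0 R) (@lo_homo R) (@hi_homo R) (@lo_hi_exhaust R)).
    apply: continuous_half_line_measurable => x x0; apply: continuousM; last exact: cdphi.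
    apply: continuous_comp; first exact: pos_derive_continuous phiE x0.
    exact/cG/phi0.
  by move=> x x0; rewrite mulr_ge0 ?G0 ?phi0// ltW// dphi0.
apply: (cvg_unique _ c1); first exact: ereal_hausdorff.
rewrite (_ : (fun n => _) = (fun n => \int[mu]_(x in `[lo R n, hi R n]) (G (phi x) * dphi x)%:E)%E)//.
apply/funext => n; have l0 := lo_gt0 R n; have lh := lo_le_hi R n.
have h0 : 0 < hi R n := lt_le_trans l0 lh.
have cd (x : R) : 0 < x -> {for x, continuous (derive1 phi)}.
  exact: continuous_derive1_pos phiE cdphi.
rewrite integration_by_substitution_increasing//.
- apply: eq_integral => x; rewrite inE/= in_itv/= => /andP[lx _]; congr EFin.
  by rewrite fctE/= (derive1_pos phiE)// (lt_le_trans l0).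
- move=> x y; rewrite !in_itv/= => /andP[lx _] _; apply: phi_lt.
  exact: lt_le_trans lx.
- by move=> x; rewrite in_itv/= => /andP[lx _]; apply: cd; exact: lt_trans lx.
- by apply/cvg_ex; exists (derive1 phi (lo R n)); apply: cvg_at_right_filter; exact: cd.
- by apply/cvg_ex; exists (derive1 phi (hi R n)); apply: cvg_at_left_filter; exact: cd.
- exact: derivable_oo_pos phiE.
- by apply: continuous_within_pos cG; exact: phi0.
Qed.

Lemma integral_half_line_subst_decr (phi dphi G : R -> R) :
  (forall x : R, 0 < x -> is_derive x 1 phi (dphi x)) ->
  (forall x : R, 0 < x -> {for x, continuous dphi}) ->
  (forall x : R, 0 < x -> dphi x < 0) ->
  (forall x : R, 0 < x -> 0 < phi x) ->
  (forall x y : R, 0 < x -> x < y -> phi y < phi x) ->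
  (forall y : R, 0 < y -> exists2 x : R, 0 < x & phi x = y) ->
  (forall x : R, 0 < x -> 0 <= G x) ->
  (forall x : R, 0 < x -> {for x, continuous G}) ->
  (\int[mu]_(x in D) (G x)%:E = \int[mu]_(x in D) (G (phi x) * - dphi x)%:E)%E.
Proof.
move=> phiE cdphi dphi0 phi0 phi_lt phi_surj G0 cG.
have phi_le (x y : R) : 0 < x -> x <= y -> phi y <= phi x.
  by move=> x0; rewrite le_eqVlt => /predU1P[->//|/phi_lt -/(_ x0)/ltW].
have hi_gt0 n : 0 < hi R n := lt_le_trans (lo_gt0 _ n) (lo_le_hi _ n).
have c1 : (fun n => \int[mu]_(x in `[phi (hi R n), phi (lo R n)]) (G x)%:E)%E @ \oo -->
    (\int[mu]_(x in D) (G x)%:E)%E.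
  apply: exhaust_half_line => //.
  - by move=> n; exact/phi0/hi_gt0.
  - by move=> m n mn; apply: phi_le; [exact: hi_gt0 | exact: hi_homo].
  - by move=> m n mn; apply: phi_le; [exact: lo_gt0 | exact: lo_homo].
  - move=> y /phi_surj [x x0 <-]; have [n /andP[h1 h2]] := lo_hi_exhaust x0.
    by exists n; rewrite !phi_le// lo_gt0.
  - exact: continuous_half_line_measurable.
have c2 : (fun n => \int[mu]_(x in `[lo R n, hi R n]) (G (phi x) * - dphi x)%:E)%E @ \oo -->
    (\int[mu]_(x in D) (G (phi x) * - dphi x)%:E)%E.
  apply: (exhaust_half_line (@lo_gt0 R) (@lo_homo R) (@hi_homo R) (@lo_hi_exhaust R)).
    apply: continuous_half_line_measurable => x x0; apply: continuousM.
      apply: continuous_comp; first exact: pos_derive_continuous phiE x0.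
      exact/cG/phi0.
    by apply: continuousN; exact: cdphi.
  by move=> x x0; rewrite mulr_ge0 ?G0 ?phi0// oppr_ge0 ltW// dphi0.
apply: (cvg_unique _ c1); first exact: ereal_hausdorff.
rewrite (_ : (fun n => _) = (fun n => \int[mu]_(x in `[lo R n, hi R n]) (G (phi x) * - dphi x)%:E)%E)//.
apply/funext => n; have l0 := lo_gt0 R n; have lh := lo_le_hi R n.
have cd (x : R) : 0 < x -> {for x, continuous (derive1 phi)}.
  exact: continuous_derive1_pos phiE cdphi.
rewrite integration_by_substitution_decreasing//.
- apply: eq_integral => x; rewrite inE/= in_itv/= => /andP[lx _]; congr EFin.
  by rewrite !fctE/= (derive1_pos phiE)// (lt_le_trans l0).
- move=> x y; rewrite !in_itv/= => _ /andP[ly _]; apply: phi_lt.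
  exact: lt_le_trans ly.
- by move=> x; rewrite in_itv/= => /andP[lx _]; apply: cd; exact: lt_trans lx.
- by apply/cvg_ex; exists (derive1 phi (lo R n)); apply: cvg_at_right_filter; exact: cd.
- by apply/cvg_ex; exists (derive1 phi (hi R n)); apply: cvg_at_left_filter; exact: cd.
- exact: derivable_oo_pos phiE.
- by apply: continuous_within_pos cG; exact: phi0.
Qed.

Lemma Rintegral_scale (k : R) (G : R -> R) : 0 < k ->
  (forall x : R, 0 < x -> 0 <= G x) ->
  (forall x : R, 0 < x -> {for x, continuous G}) ->
  \int[mu]_(x in D) G x = \int[mu]_(x in D) (G (k * x) * k).
Proof.
move=> k0 G0 cG; rewrite /Rintegral; congr fine.
apply: (@integral_half_line_subst_incr (fun x => k * x) (fun=> k)) => //.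
- move=> x x0; have h := is_deriveZ k (is_derive_id x (1 : R)).
  by rewrite /GRing.scale/= mulr1 in h.
- by move=> x x0; exact: cst_continuous.
- by move=> x x0; rewrite mulr_gt0.
- by move=> x y x0 xy; rewrite ltr_pM2l.
- by move=> y y0; exists (y / k); rewrite ?divr_gt0// mulrC divfK// gt_eqF.
Qed.

Lemma Rintegral_inv (G : R -> R) :
  (forall x : R, 0 < x -> 0 <= G x) ->
  (forall x : R, 0 < x -> {for x, continuous G}) ->
  \int[mu]_(x in D) G x = \int[mu]_(x in D) (G x^-1 / x ^+ 2).
Proof.
move=> G0 cG; rewrite /Rintegral; congr fine.
transitivity (\int[mu]_(x in D) (G x^-1 * - - x ^- 2)%:E)%E; last first.
  by apply: eq_integral => x _; rewrite opprK.
apply: (@integral_half_line_subst_decr (fun x => x^-1) (fun x => - x ^- 2)) => //.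
- move=> x x0; have xn0 : x != 0 by rewrite gt_eqF.
  have h := @is_deriveV _ id x _ 1 xn0 (is_derive_id x (1 : R)).
  by rewrite /GRing.scale/= mulr1 in h.
- move=> x x0; apply: continuousN; apply: continuousV; first by rewrite expf_neq0// gt_eqF.
  exact: exprn_continuous.
- by move=> x x0; rewrite oppr_lt0 invr_gt0 exprn_gt0.
- by move=> x x0; rewrite invr_gt0.
- by move=> x y x0 xy; rewrite ltf_pV2 ?posrE// (lt_trans x0).
- by move=> y y0; exists y^-1; rewrite ?invr_gt0// invrK.
Qed.

Lemma Rintegral_sqr (G : R -> R) :
  (forall x : R, 0 < x -> 0 <= G x) ->
  (forall x : R, 0 < x -> {for x, continuous G}) ->
  \int[mu]_(x in D) G x = \int[mu]_(x in D) (G (x ^+ 2) * (2 * x)).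
Proof.
move=> G0 cG; rewrite /Rintegral; congr fine.
apply: (@integral_half_line_subst_incr (fun x => x ^+ 2) (fun x => 2 * x)) => //.
- move=> x x0; have h := is_deriveX 2 (is_derive_id x (1 : R)).
  by rewrite /GRing.scale/= expr1 mulr1 in h.
- by move=> x x0; apply: continuousM; [exact: cst_continuous | exact: cvg_id].
- by move=> x x0; rewrite mulr_gt0.
- by move=> x x0; rewrite exprn_gt0.
- by move=> x y x0 xy; rewrite ltrXn2r ?nnegrE ?ltW// (lt_trans x0).
- by move=> y y0; exists (Num.sqrt y); rewrite ?sqrtr_gt0// sqr_sqrtr// ltW.
Qed.

End Substitution.

Section SeriesIntegral.
Context (R : realType).
Local Notation mu := (@lebesgue_measure R).
Local Notation D := (`]0, +oo[%classic : set R).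

(** Dominated convergence for the partial sums. The bound g is on partial sums, so each single term
    is integrable as a difference of two of them. *)
Lemma Rintegral_series_cvg (f : nat -> R -> R) (F g : R -> R) :
  (forall n, measurable_fun D (f n)) ->
  (forall x : R, 0 < x -> series (f^~ x) @ \oo --> F x) ->
  (forall (N : nat) (x : R), 0 < x -> `|series (f^~ x) N| <= g x) ->
  mu.-integrable D (EFin \o g) ->
  [/\ forall n, mu.-integrable D (EFin \o f n),
      mu.-integrable D (EFin \o F) &
      series (fun n => \int[mu]_(x in D) f n x) @ \oo --> \int[mu]_(x in D) F x].
Proof.
move=> mf fF fg ig.
pose S N x := series (f^~ x) N.
have mS N : measurable_fun D (S N).
  by rewrite /S /series/=; apply: measurable_sum.
have mF : measurable_fun D F.
  by apply: (measurable_fun_cvg mS) => x /half_lineP; exact: fF.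
have iS N : mu.-integrable D (EFin \o S N).
  by apply: (integrable_dominated (mS N) ig) => x x0; exact: fg.
have iF : mu.-integrable D (EFin \o F).
  apply: (integrable_dominated mF ig) => x x0.
  have h : (fun N => `|S N x|) @ \oo --> `|F x| by apply: cvg_norm; exact: fF.
  rewrite -(cvg_lim _ h)//; apply: limr_le; first by apply/cvg_ex; eexists; exact: h.
  by apply: nearW => N; exact: fg.
have ifn n : mu.-integrable D (EFin \o f n).
  have -> : EFin \o f n = ((EFin \o S n.+1) \- (EFin \o S n))%E.
    apply/funext => x /=; rewrite -EFinB /S seriesSr; congr EFin.
    by rewrite addrC addKr.
  by apply: integrableB => //; exact: measurable_half_line.
split => //.
have E N : series (fun n => \int[mu]_(x in D) f n x) N = \int[mu]_(x in D) S N x.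
  elim: N => [|N IH].
    rewrite /series/= big_geq// /Rintegral integral0_eq// => x _.
    by rewrite /S /series/= big_geq.
  rewrite seriesSr IH -RintegralD; [|exact: measurable_half_line|exact: iS|exact: ifn].
  by apply: eq_Rintegral => x _; rewrite /S seriesSr.
rewrite (funext E).
have [_ _ h] : [/\ mu.-integrable D (EFin \o F),
    [sequence (\int[mu]_(x in D) `|(S n x)%:E - (F x)%:E|)%E]_n @ \oo --> (0 : \bar R) &
    [sequence (\int[mu]_(x in D) (S n x)%:E)%E]_n @ \oo --> (\int[mu]_(x in D) (F x)%:E)%E].
  apply: (@dominated_convergence _ _ _ mu D _ (fun n => EFin \o S n) (EFin \o F) (EFin \o g)).
  - exact: measurable_half_line.
  - by move=> n; apply/measurable_EFinP; exact: mS.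
  - by apply/measurable_EFinP; exact: mF.
  - by apply: aeW => x /half_lineP x0; apply: cvg_EFin; [exact: nearW | exact: fF].
  - exact: ig.
  - by apply: aeW => x n /half_lineP x0; rewrite /= lee_fin fg.
by apply: fine_cvg; rewrite fineK ?integrable_fin_num//; exact: measurable_half_line.
Qed.

End SeriesIntegral.

(** * Mellin transforms and their analyticity *)

Section Mellin.
Context (R : realType).
Local Notation mu := (@lebesgue_measure R).
Local Notation D := (`]0, +oo[%classic : set R).

Definition mellin (f : R -> R) (s : R) : R :=
  \int[mu]_(x in D) (f x * x `^ (s - 1)).

Lemma powR_expR (x p : R) : 0 < x -> x `^ p = expR (p * ln x).
Proof. by move=> x0; rewrite /powR gt_eqF. Qed.

Lemma series_expR_cvg (y : R) : series (fun k => y ^+ k / k`!%:R) @ \oo --> expR y.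
Proof. exact: is_cvg_series_exp_coeff. Qed.

Lemma series_expR_le (y : R) (N : nat) :
  `|series (fun k => y ^+ k / k`!%:R) N| <= expR `|y|.
Proof.
apply: (@le_trans _ _ (series (fun k => `|y| ^+ k / k`!%:R) N)).
  rewrite /series/=; apply: le_trans (ler_norm_sum _ _ _) _.
  by apply: ler_sum => k _; rewrite normrM normrX [X in _ * X]ger0_norm ?invr_ge0.
rewrite -(cvg_lim _ (@series_expR_cvg `|y|))//.
apply: nondecreasing_cvgn_le; last exact: is_cvg_series_exp_coeff.
by apply: nondecreasing_series => k _ _; rewrite divr_ge0 ?exprn_ge0.
Qed.

Lemma expR_abs_ln_le (x rho : R) : 0 < x ->
  expR (rho * `|ln x|) <= x `^ rho + x `^ (- rho).
Proof.
move=> x0; rewrite !powR_expR//.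
case: (ger0P (ln x)) => h; first by rewrite lerDl expR_ge0.
by rewrite mulrN mulNr lerDr expR_ge0.
Qed.

(** Expand x^z = exp(z ln x) and integrate term by term. The partial sums are at most exp(|z| |ln
    x|) <= x^|z| + x^(- |z|), whence the two integrability hypotheses at s0 + |z| and s0 - |z|. *)
Lemma mellin_taylor (f : R -> R) (s0 z : R) :
  measurable_fun D f ->
  mu.-integrable D (EFin \o (fun x => f x * x `^ (s0 + `|z| - 1))) ->
  mu.-integrable D (EFin \o (fun x => f x * x `^ (s0 - `|z| - 1))) ->
  [/\ forall k, mu.-integrable D
        (EFin \o (fun x => f x * x `^ (s0 - 1) * ((z * ln x) ^+ k / k`!%:R))),
      mu.-integrable D (EFin \o (fun x => f x * x `^ (s0 + z - 1))) &
      series (fun k => \int[mu]_(x in D) (f x * x `^ (s0 - 1) * ((z * ln x) ^+ k / k`!%:R)))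
        @ \oo --> mellin f (s0 + z)].
Proof.
move=> mf ip im.
have E (x : R) N : series (fun k => f x * x `^ (s0 - 1) * ((z * ln x) ^+ k / k`!%:R)) N =
    f x * x `^ (s0 - 1) * series (fun k => (z * ln x) ^+ k / k`!%:R) N.
  by rewrite /series/= mulr_sumr.
apply: (@Rintegral_series_cvg _ (fun k x => f x * x `^ (s0 - 1) * ((z * ln x) ^+ k / k`!%:R))
  _ (fun x => `|f x * x `^ (s0 + `|z| - 1)| + `|f x * x `^ (s0 - `|z| - 1)|)).
- move=> k; apply: measurable_funM; first apply: measurable_funM => //.
    exact: measurable_funTS (measurable_powR _).
  apply: measurable_funM => //; apply: measurable_funX.
  by apply: measurable_funM => //; by apply: measurable_funTS.
- move=> x x0; rewrite (funext (E x)).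
  have -> : f x * x `^ (s0 + z - 1) = f x * x `^ (s0 - 1) * expR (z * ln x).
    by rewrite -mulrA !powR_expR// -expRD; congr (_ * expR _); ring.
  by apply: cvgM; [exact: cvg_cst | exact: series_expR_cvg].
- move=> N x x0; rewrite E normrM.
  apply: (@le_trans _ _ (`|f x * x `^ (s0 - 1)| * (x `^ `|z| + x `^ (- `|z|)))).
    apply: ler_wpM2l => //; apply: le_trans (series_expR_le _ _) _.
    by rewrite normrM; exact: expR_abs_ln_le.
  rewrite mulrDr !normrM !(ger0_norm (powR_ge0 _ _)) -!mulrA.
  rewrite -!powRD ?(gt_eqF x0) ?implybT//.
  by rewrite le_eqVlt; apply/orP; left; apply/eqP; congr (_ * (_ `^ _) + _ * (_ `^ _)); ring.
- pose g1 (x : R) : R := f x * x `^ (s0 + `|z| - 1).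
  pose g2 (x : R) : R := f x * x `^ (s0 - `|z| - 1).
  rewrite (_ : EFin \o _ = ((abse \o (EFin \o g1)) \+ (abse \o (EFin \o g2)))%E).
    by apply: integrableD; [exact: measurable_half_line|exact: integrable_abse..].
  by apply/funext => x /=; rewrite EFinD.
Qed.

Lemma mellin_analytic (f : R -> R) (A s0 : R) :
  measurable_fun D f ->
  (forall s, A < s -> mu.-integrable D (EFin \o (fun x => f x * x `^ (s - 1)))) ->
  A < s0 -> real_analytic_at (mellin f) s0.
Proof.
move=> mf fi As0.
pose r := s0 - A; have r0 : 0 < r by rewrite /r subr_gt0.
have fp (z : R) : mu.-integrable D (EFin \o (fun x => f x * x `^ (s0 + `|z| - 1))).
  by apply: fi; have := normr_ge0 z; lra.
have fm (z : R) : `|z| < r ->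
    mu.-integrable D (EFin \o (fun x => f x * x `^ (s0 - `|z| - 1))).
  by move=> zr; apply: fi; rewrite /r in zr; lra.
have T (z : R) (zr : `|z| < r) := mellin_taylor mf (fp z) (fm z zr).
pose h k (x : R) : R := f x * x `^ (s0 - 1) * (ln x ^+ k / k`!%:R).
have fE (z : R) k (x : R) :
    f x * x `^ (s0 - 1) * ((z * ln x) ^+ k / k`!%:R) = z ^+ k * h k x.
  by rewrite /h exprMn; ring.
have ih k : mu.-integrable D (EFin \o h k).
  (* Any nonzero z in the disc would do: [mellin_taylor] gives integrability of z^k times [h k], and
     z^k is divided out. *)
  have zr : `|r / 2| < r by rewrite gtr0_norm ?divr_gt0//; lra.
  have [/(_ k) + _ _] := T _ zr => /(integrable_scale ((r / 2) ^- k)).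
  congr (mu.-integrable D (EFin \o _)); apply/funext => x; rewrite fE mulrA mulVf ?mul1r//.
  by rewrite expf_neq0// gt_eqF// divr_gt0.
exists r => //; exists (fun k => \int[mu]_(x in D) h k x) => s sr.
have [_ _] := T _ sr; rewrite (_ : s0 + (s - s0) = s); last by ring.
rewrite (_ : series _ = series (fun k => (\int[mu]_(x in D) h k x) * (s - s0) ^+ k))//.
congr series; apply/funext => k; rewrite mulrC -RintegralZl; [|exact: measurable_half_line|exact: ih].
by apply: eq_Rintegral => x _; rewrite fE.
Qed.

Lemma Rintegral_pos (f : R -> R) (m : R) : 0 < m ->
  mu.-integrable D (EFin \o f) -> (forall x : R, 0 < x -> 0 <= f x) ->
  (forall x : R, 1 <= x <= 2 -> m <= f x) -> 0 < \int[mu]_(x in D) f x.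
Proof.
move=> m0 fi f0 fm; apply: (lt_le_trans m0).
have sub : `[1, 2]%classic `<=` D.
  by move=> x; rewrite half_lineP/= in_itv/= => /andP[x1 _]; exact: lt_le_trans x1.
rewrite -lee_fin /Rintegral fineK; last first.
  by apply: integrable_fin_num => //; exact: measurable_half_line.
have mf : measurable_fun D f by apply/measurable_EFinP; exact: measurable_int fi.
apply: (@le_trans _ _ (\int[mu]_(x in `[1%R, 2%R]) (f x)%:E)%E); last first.
  apply: ge0_subset_integral => //.
  - exact/measurable_EFinP.
  - by move=> x /half_lineP x0; rewrite lee_fin f0.
apply: (@le_trans _ _ (\int[mu]_(x in `[1%R, 2%R]) m%:E)%E).
  rewrite integral_cst//= lebesgue_measure_itv/= lte_fin ltr1n -EFinB.
  by rewrite -EFinM lee_fin (_ : 2 - 1 = 1) ?mulr1//; ring.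
apply: ge0_le_integral => //.
- by move=> x _; rewrite lee_fin ltW.
- apply/measurable_EFinP; apply: (@measurable_funS _ _ _ _ D) => //; exact: measurable_half_line.
Qed.

End Mellin.

Section GammaValues.
Context (R : realType).
Local Notation mu := (@lebesgue_measure R).
Local Notation D := (`]0, +oo[%classic : set R).

Lemma integrable_Gamma (a : R) : 0 < a ->
  mu.-integrable D (EFin \o (fun t => t `^ (a - 1) * expR (- t))).
Proof.
move=> a0; have := integrable_powR_expR a0 ltr01.
by congr (mu.-integrable D (EFin \o _)); apply/funext => x; rewrite mul1r.
Qed.

Lemma continuous_Gamma_integrand (a x : R) : 0 < x ->
  {for x, continuous (fun t : R => t `^ (a - 1) * expR (- t))}.
Proof.
move=> x0; apply: continuousM; first exact: continuous_powR.
apply: continuous_comp; last exact: continuous_expR.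
by apply: continuousN; exact: cvg_id.
Qed.

Lemma Gamma_gt0 (a : R) : 0 < a -> 0 < Gamma a.
Proof.
move=> a0; apply: (@Rintegral_pos _ _ (expR (- (`|a - 1| * ln 2)) * expR (- 2))).
- by rewrite mulr_gt0 ?expR_gt0.
- exact: integrable_Gamma.
- by move=> x x0; rewrite mulr_ge0 ?powR_ge0 ?expR_ge0.
- move=> x /andP[x1 x2]; have x0 : 0 < x := lt_le_trans ltr01 x1.
  apply: ler_pM; [exact: expR_ge0|exact: expR_ge0| |by rewrite ler_expR lerN2].
  rewrite powR_expR// ler_expR; apply: lerNnormlW; rewrite normrM.
  by apply: ler_wpM2l => //; rewrite ger0_norm ?ln_ge0// ler_ln ?posrE.
Qed.

(** This value and [Gamma_half] are those of Gamma((1 + d) / 2) for the two parities, which enter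
    the formula for L(1). *)
Lemma Gamma1 : Gamma (1 : R) = 1.
Proof.
rewrite /Gamma /Rintegral.
under eq_integral => x _ do rewrite subrr powRr0 mul1r.
suff -> : (\int[mu]_(x in D) (expR (- x))%:E = (0 - - 1)%:E)%E by rewrite /= sub0r opprK.
apply: (@integral_antiderivative R (fun t => expR (- t)) (fun t => - expR (- t)) (- 1) 0).
- by move=> x _; exact: expR_ge0.
- by move=> x _; apply: continuous_comp; [apply: continuousN; exact: cvg_id | exact: continuous_expR].
- move=> x _.
  have h := is_derive1_comp (is_derive_expR (- x)) (is_deriveN (is_derive_id x (1 : R))).
  have hN := is_deriveN h.
  by rewrite /GRing.scale/= mulrN1 opprK in hN.
- have : (fun n => - expR (- lo R n)) @ \oo --> - expR (- (0 : R)).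
    apply: cvgN; apply: continuous_cvg; first exact: continuous_expR.
    by apply: cvgN; exact: cvg_harmonic.
  by rewrite oppr0 expR0.
- have : (fun n => - expR (- hi R n)) @ \oo --> - (0 : R).
    by apply: cvgN; have := @cvgn_expR R; rewrite -cvg_shiftS.
  by rewrite oppr0.
Qed.

Lemma Gamma_half : Gamma (1 / 2 : R) = Num.sqrt pi.
Proof.
rewrite /Gamma Rintegral_sqr; last 2 first.
- by move=> x x0; rewrite mulr_ge0 ?powR_ge0 ?expR_ge0.
- by move=> x x0; exact: continuous_Gamma_integrand.
rewrite (_ : \int[mu]_(x in D) _ = \int[mu]_(x in D) (2 * gauss_fun x)); last first.
  apply: eq_Rintegral => x; rewrite inE => /half_lineP x0.
  have -> : (x ^+ 2) `^ (1 / 2 - 1) = x^-1.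
    rewrite -powR_mulrn; last exact: ltW.
    rewrite -powRrM (_ : 2%:R * _ = - 1); last by field.
    by rewrite powR_inv1//; exact: ltW.
  by rewrite /gauss_fun; field; rewrite gt_eqF.
rewrite RintegralZl; last 2 first.
- exact: measurable_half_line.
- by apply: (integrableS _ _ _ integrableT_gauss) => //; exact: measurable_half_line.
rewrite /Rintegral integral_itv_obnd_cbnd; last first.
  by apply/measurable_EFinP/measurable_funTS; exact: measurable_gauss_fun.
by rewrite integral0y_gauss/= mulrC divfK.
Qed.

Lemma mellin_expR (c a : R) : 0 < c -> 0 < a ->
  mellin (fun x => expR (- (c * x))) a = c `^ (- a) * Gamma a.
Proof.
move=> c0 a0; rewrite /Gamma (@Rintegral_scale _ c)//; last 2 first.
- by move=> x x0; rewrite mulr_ge0 ?powR_ge0 ?expR_ge0.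
- by move=> x; exact: continuous_Gamma_integrand.
rewrite (_ : \int[mu]_(x in D) _ = \int[mu]_(x in D) (c `^ a * (expR (- (c * x)) * x `^ (a - 1))));
    last first.
  apply: eq_Rintegral => x; rewrite inE => /half_lineP x0.
  have -> : c `^ a = c `^ (a - 1) * c by rewrite [RHS]mulrC mulr_powRB1// ltW.
  rewrite powRM; [by ring|exact: ltW..].
rewrite RintegralZl; last 2 first.
- exact: measurable_half_line.
- have := integrable_powR_expR a0 c0.
  by congr (mu.-integrable D (EFin \o _)); apply/funext => x; rewrite mulrC.
by rewrite mulrA -powRD ?(gt_eqF c0) ?implybT// addNr powRr0 mul1r.
Qed.

End GammaValues.

(** * Growth of the coefficients *)

Section SumProduct.
Context (A : pzRingType).

(** The square of index pairs is cut along i + j = N: the triangle below gives the Cauchy product,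
    the rest has total degree at least N. *)
Lemma sum_mul_convolution (u v : nat -> A) (N : nat) :
  (\sum_(0 <= i < N) u i) * (\sum_(0 <= j < N) v j) =
  \sum_(0 <= k < N) \sum_(i < k.+1) u i * v (k - i)%N +
  \sum_(0 <= i < N) u i * \sum_(N - i <= j < N) v j.
Proof.
rewrite sum_convolution -big_split/= mulr_suml; apply: eq_big_nat => i /andP[_ iN].
by rewrite -mulrDr -big_cat_nat// leq_subr.
Qed.

End SumProduct.

Section CoefBound.
Context (R : realType).

Lemma normc_real (x : R) : `|x%:C| = `|x|%:C :> R[i].
Proof. by rewrite normc_def /= expr0n addr0 sqrtr_sqr. Qed.

Lemma normc_cis (t : R) : `|cis t| = 1.
Proof. by rewrite normc_def /= cos2Dsin2 sqrtr1. Qed.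

Lemma conjc_realM_cis (x t : R) : (x%:C * cis t)^*%C = x%:C * cis (- t).
Proof.
apply/eqP; rewrite eq_complex /= cosN sinN; apply/andP; split; apply/eqP; ring.
Qed.

Lemma parseval_cis (u : nat -> R) (N : nat) : (0 < N)%N ->
  \sum_(b < N) `|\sum_(0 <= m < N) (u m)%:C * cis (2 * pi * (m%:Z * b%:Z)%:~R / N%:R)| ^+ 2
  = N%:R * (\sum_(0 <= m < N) u m ^+ 2)%:C.
Proof.
move=> N0; rewrite !big_mkord.
have N_neq0 : N%:R != 0 :> R by rewrite pnatr_eq0 -lt0n.
transitivity (\sum_(b < N) \sum_(m < N) \sum_(k < N) (u m * u k)%:C *
    cis (2 * pi * ((m%:Z - k%:Z) * b%:Z)%:~R / N%:R)).
  apply: eq_bigr => b _; rewrite big_mkord sqr_normc.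
  rewrite (rmorph_sum (@conjc R)) mulr_suml; apply: eq_bigr => m _.
  rewrite mulr_sumr; apply: eq_bigr => k _.
  rewrite [X in _ * X]conjc_realM_cis mulrACA -cisD -rmorphM.
  congr (_ * cis _); rewrite mulrBl intrB.
  by move: (pi : R) => p; field.
rewrite exchange_big rmorph_sum mulr_sumr; apply: eq_bigr => m _.
have inner (k : 'I_N) : \sum_(b < N) (u m * u k)%:C *
    cis (2 * pi * ((m%:Z - k%:Z) * b%:Z)%:~R / N%:R) =
    if k == m then N%:R * (u m ^+ 2)%:C else 0.
  rewrite -mulr_sumr sum_cis//; case: eqP => [->|km].
    by rewrite subrr dvdz0 mulrC expr2.
  rewrite ifF ?mulr0//; apply/negP => /dvdzP [j jE].
  have mN := ltn_ord m; have kN := ltn_ord k.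
  have {}km : (k : nat) <> m by move/val_inj.
  have [j0|j1] : j = 0 \/ (1 <= `|j|)%R.
    by case: (eqVneq j 0) => [->|]; [left|right; lia].
  - by rewrite j0 mul0r in jE; lia.
  - by nia.
rewrite exchange_big (eq_bigr _ (fun k _ => inner k)).
by rewrite -big_mkcond big_pred1_eq.
Qed.

(* Parseval for sum_(m < N) c_m z^m at the points z = r e^(2 pi i b / N), the
   square of the polynomial being bounded through the coefficients of c * c;
   the parenthesis collects the products of total degree at least N. *)
Lemma sum_sqr_coef_le (c : nat -> R) (r : R) (N : nat) : 0 <= r ->
  \sum_(0 <= m < N) (c m * r ^+ m) ^+ 2 <=
  \sum_(0 <= k < N) `|\sum_(i < k.+1) c i * c (k - i)%N| * r ^+ k +
  ((\sum_(0 <= i < N) `|c i| * r ^+ i) ^+ 2 -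
   \sum_(0 <= k < N) \sum_(i < k.+1) (`|c i| * r ^+ i) * (`|c (k - i)%N| * r ^+ (k - i))).
Proof.
move=> r0; case: N => [|N]; first by rewrite !big_geq// expr0n subr0 addr0.
set M := N.+1.
set U := (X in _ <= X).
have M0 : (0 < M)%N by [].
rewrite -(@ler_pM2l _ M%:R) ?ltr0n// -lecR rmorphM/= rmorph_nat -parseval_cis//.
pose w (b m : nat) : R[i] := (c m * r ^+ m)%:C * cis (2 * pi * (m%:Z * b%:Z)%:~R / M%:R).
have norm_w b m : `|w b m| = (`|c m| * r ^+ m)%:C.
  by rewrite normrM normc_cis mulr1 normc_real normrM normrX (ger0_norm r0).
have conv_w b k : \sum_(i < k.+1) w b i * w b (k - i)%N =
    (\sum_(i < k.+1) c i * c (k - i)%N)%:C * (r ^+ k)%:C *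
    cis (2 * pi * (k%:Z * b%:Z)%:~R / M%:R).
  rewrite -rmorphM/= mulr_suml rmorph_sum/= mulr_suml; apply: eq_bigr => i _.
  have ik : (i <= k)%N by rewrite -ltnS.
  rewrite /w mulrACA -cisD -rmorphM/=; congr (_%:C * cis _).
    have -> : r ^+ k = r ^+ i * r ^+ (k - i) by rewrite -exprD subnKC.
    by ring.
  rewrite -subzn// mulrBl intrB.
  have M_neq0 : M%:R != 0 :> R by rewrite pnatr_eq0.
  by move: (pi : R) => p; field.
have bound b : `|\sum_(0 <= m < M) w b m| ^+ 2 <= U%:C.
  rewrite -normrX expr2 sum_mul_convolution; apply: le_trans (ler_normD _ _) _.
  rewrite /U rmorphD/=; apply: lerD.
    apply: le_trans (ler_norm_sum _ _ _) _; rewrite rmorph_sum/=; apply: ler_sum => k _.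
    rewrite conv_w !normrM normc_cis mulr1 !normc_real -rmorphM/= normrX (ger0_norm r0).
    exact: lexx.
  have -> : (\sum_(0 <= i < M) `|c i| * r ^+ i) ^+ 2 -
      \sum_(0 <= k < M) \sum_(i < k.+1) (`|c i| * r ^+ i) * (`|c (k - i)%N| * r ^+ (k - i)) =
      \sum_(0 <= i < M) (`|c i| * r ^+ i) * \sum_(M - i <= j < M) (`|c j| * r ^+ j).
    rewrite expr2 (sum_mul_convolution (fun i => `|c i| * r ^+ i) (fun i => `|c i| * r ^+ i)).
    by rewrite addrC addKr.
  apply: le_trans (ler_norm_sum _ _ _) _; rewrite rmorph_sum/=; apply: ler_sum => i _.
  rewrite normrM norm_w [leRHS]rmorphM; apply: ler_wpM2l.
    by rewrite ler0c mulr_ge0 ?exprn_ge0.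
  apply: le_trans (ler_norm_sum _ _ _) _; rewrite rmorph_sum; apply: ler_sum => j _.
  by rewrite norm_w.
apply: (@le_trans _ _ (\sum_(b < M) U%:C)); first by apply: ler_sum => b _; exact: bound.
by rewrite sumr_const card_ord rmorphM/= rmorph_nat mulr_natl.
Qed.

(* c_n^2 r^(2n) is at most the mean of |sum a_k z^k| over |z| = r, and one
   takes r = exp(- 1 / (n + 1)). *)
Lemma coef_bound (c a : nat -> R) :
  (forall k, \sum_(i < k.+1) c i * c (k - i)%N = a k) ->
  (forall k, `|a k| <= k.+1%:R) ->
  (forall z : R, 0 < z < 1 -> cvgn (series (fun m => c m * z ^+ m))) ->
  forall n, `|c n| <= 3 * expR 2 * n.+1%:R.
Proof.
move=> ca a_le c_cvg n.
pose t : R := n.+1%:R^-1; have t0 : 0 < t by rewrite invr_gt0 ltr0n.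
have t1 : t <= 1 by rewrite invf_le1 ?ltr0n// ler1n.
pose r := expR (- t).
have r01 : 0 < r < 1 by rewrite expR_gt0 expR_lt1 oppr_lt0.
have /andP[r0 r1] := r01.
pose u (i : nat) : R := `|c i| * r ^+ i.
have cu : cvgn (series u).
  have := @pseries_cvg_norm _ c 1 r c_cvg; rewrite (gtr0_norm r0) => /(_ r1).
  rewrite (_ : [normed series _] = series u)//; congr series; apply/funext => k.
  by rewrite /= normrM normrX (gtr0_norm r0).
have cun : cvgn [normed series u].
  rewrite (_ : [normed series u] = series u)//; congr series; apply/funext => k /=.
  by rewrite ger0_norm// mulr_ge0 ?exprn_ge0// ltW.
(* The contribution of total degree at least N. For fixed r it tends to 0 by [mertens], so N can go
   to infinity while n stays fixed. *)
pose tail (N : nat) : R := (\sum_(0 <= i < N) u i) ^+ 2 -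
  \sum_(0 <= k < N) \sum_(i < k.+1) u i * u (k - i)%N.
have ctail : tail @ \oo --> (0 : R).
  have := mertens cun cu => h.
  rewrite -(subrr (limn (series u) * limn (series u))).
  apply: cvgB => //.
  by rewrite (_ : (fun N => _) = (fun N => series u N * series u N))//; exact: cvgM.
(* As r^k = exp(t) exp(- t (k + 1)), this is exp(t) times the bound of [sum_natM_expR_le] for the
   sum of (k + 1) exp(- t (k + 1)). *)
pose B : R := expR t * (2 / t * (1 + 2 / t) * expR (- (t / 2))).
have main N : (n < N)%N -> c n ^+ 2 * r ^+ n ^+ 2 <= B + tail N.
  move=> nN; apply: (@le_trans _ _ (\sum_(0 <= m < N) (c m * r ^+ m) ^+ 2)).
    rewrite (bigD1_seq n) ?mem_index_iota ?iota_uniq//= exprMn lerDl.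
    by apply: sumr_ge0 => i _; exact: sqr_ge0.
  apply: le_trans (sum_sqr_coef_le c N (ltW r0)) _; rewrite lerD2r.
  apply: (@le_trans _ _ (\sum_(k < N) expR t * (k.+1%:R * expR (- (t * k.+1%:R))))).
    rewrite big_mkord; apply: ler_sum => k _; rewrite ca mulrCA.
    apply: ler_pM => //; first by rewrite exprn_ge0// ltW.
    rewrite /r -expRM_natr -expRD ler_expR -natr1; lra.
  by rewrite -mulr_sumr ler_pM2l ?expR_gt0//; exact: sum_natM_expR_le.
have {}main : c n ^+ 2 * r ^+ n ^+ 2 <= B.
  have h : (fun N => B + tail N) @ \oo --> B + 0 by apply: cvgD => //; exact: cvg_cst.
  rewrite addr0 in h; rewrite -(cvg_lim _ h)//; apply: limr_ge.
    by apply/cvg_ex; exists B.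
  by exists n.+1 => // N /= nN; exact: main.
rewrite -ler_sqr ?nnegrE ?mulr_ge0 ?expR_ge0// real_normK ?num_real//.
have rn : r ^+ n ^+ 2 = expR (- (2 * (t * n%:R))).
  by rewrite /r -!expRM_natr; congr expR; ring.
have tn : t * n%:R <= 1.
  by rewrite /t mulrC ler_pdivrMr ?ltr0n// mul1r ler_nat.
(* With x = n + 1 = 1 / t >= 1 one has 2x (1 + 2x) <= 9 x^2. The factor r^(2n) >= exp(- 2) then
   costs exp(2), and the total 9 exp(3) x^2 is below (3 exp(2) x)^2. *)
have B_le : B <= expR 1 * (9 * n.+1%:R ^+ 2).
  rewrite /B; apply: ler_pM; [exact: expR_ge0| |by rewrite ler_expR|].
    have q0 : 0 <= 2 / t by rewrite divr_ge0// ltW.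
    by rewrite mulr_ge0 ?expR_ge0// mulr_ge0// addr_ge0.
  rewrite /t invrK; have n1 : 1 <= n.+1%:R :> R by rewrite ler1n.
  have : expR (- (n.+1%:R^-1 / 2)) <= 1 :> R by rewrite expR_le1 oppr_le0 divr_ge0 ?invr_ge0.
  have := expR_ge0 (- (n.+1%:R^-1 / 2) : R).
  move: (n.+1%:R : R) n1 (expR _) => x x1 e e0 e1; nra.
have h : c n ^+ 2 <= B * expR 2.
  apply: le_trans (ler_wpM2r (expR_ge0 2) main); rewrite rn -mulrA ler_peMr ?sqr_ge0//.
  by rewrite -expRD -[leLHS]expR0 ler_expR; lra.
apply: le_trans h _.
apply: (@le_trans _ _ (expR 1 * (9 * n.+1%:R ^+ 2) * expR 2)).
  by apply: ler_wpM2r => //; exact: expR_ge0.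
have -> : (3 * expR 2 * n.+1%:R) ^+ 2 = expR 2 * (9 * n.+1%:R ^+ 2) * expR 2 :> R by ring.
apply: ler_wpM2r; first exact: expR_ge0.
by apply: ler_wpM2r; [rewrite mulr_ge0 ?sqr_ge0|rewrite ler_expR; lra].
Qed.

End CoefBound.

(** * Bessel integrals and the double series *)

Section Bessel.
Context (R : realType).
Local Notation mu := (@lebesgue_measure R).
Local Notation D := (`]0, +oo[%classic : set R).

Definition bessel_integral (p a b : R) : R :=
  \int[mu]_(x in D) (expR (- (a * x)) * expR (- (b / x)) * x `^ (p - 1)).

Lemma continuous_bessel_integrand (p a b x : R) : 0 < x ->
  {for x, continuous (fun t : R => expR (- (a * t)) * expR (- (b / t)) * t `^ (p - 1))}.
Proof.
move=> x0; apply: continuousM; last exact: continuous_powR.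
by apply: continuousM; [exact: continuous_expRNM | exact: continuous_expRNV].
Qed.

Lemma bessel_integrand_ge0 (p a b x : R) :
  0 <= expR (- (a * x)) * expR (- (b / x)) * x `^ (p - 1).
Proof. by rewrite !mulr_ge0 ?expR_ge0 ?powR_ge0. Qed.

Lemma integrable_bessel (p a b : R) : 0 < a -> 0 < b ->
  mu.-integrable D
    (EFin \o (fun x => expR (- (a * x)) * expR (- (b / x)) * x `^ (p - 1))).
Proof.
move=> a0 b0; have := integrable_powR_expR2 (p - 1) a0 b0.
by congr (mu.-integrable D (EFin \o _)); apply/funext => x; ring.
Qed.

(** The scaling x -> k x with k = sqrt(b / a) makes both coefficients in the exponent equal to
    sqrt(a b). The inversion x -> 1/x then turns x^(p - 1) into x^(- p - 1), the power in
    [besselK]. *)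
Lemma bessel_integralE (p a b : R) : 0 < a -> 0 < b ->
  bessel_integral p a b = 2 * ((b / a) `^ (p / 2) * besselK p (2 * Num.sqrt (a * b))).
Proof.
move=> a0 b0; have ba0 : 0 < b / a by rewrite divr_gt0.
pose k := Num.sqrt (b / a); have k0 : 0 < k by rewrite sqrtr_gt0.
pose y := Num.sqrt (a * b); have y0 : 0 < y by rewrite sqrtr_gt0 mulr_gt0.
have ak : a * k = y.
  rewrite -[a in LHS](gtr0_norm a0) -sqrtr_sqr /k -sqrtrM ?sqr_ge0//.
  by congr Num.sqrt; field; rewrite gt_eqF.
have k2 : k ^+ 2 = b / a by rewrite sqr_sqrtr//; exact: ltW.
have bk : b / k = y.
  have bE : b = a * k ^+ 2 by rewrite k2; field; rewrite gt_eqF.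
  by rewrite -ak {1}bE; field; rewrite gt_eqF.
rewrite /bessel_integral (@Rintegral_scale _ k)//; last 2 first.
- by move=> x _; exact: bessel_integrand_ge0.
- by move=> x; exact: continuous_bessel_integrand.
transitivity (\int[mu]_(x in D) (k `^ p *
    (expR (- (y * x)) * expR (- (y / x)) * x `^ (p - 1)))).
  apply: eq_Rintegral => x; rewrite inE => /half_lineP x0.
  have -> : k `^ p = k `^ (p - 1) * k.
    by rewrite -[X in _ * X](powRr1 (ltW k0)) -powRD ?subrK// (gt_eqF k0) implybT.
  have -> : a * (k * x) = y * x by rewrite mulrA ak.
  have -> : b / (k * x) = y / x by rewrite invfM mulrA bk.
  rewrite powRM; [ring|exact: ltW..].
rewrite RintegralZl; last 2 first.
- exact: measurable_half_line.
- exact: integrable_bessel.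
have -> : k `^ p = (b / a) `^ (p / 2).
  by rewrite /k -powR12_sqrt ?(ltW ba0)// -powRrM [2^-1 * p]mulrC.
rewrite mulrCA; congr (_ * _).
rewrite Rintegral_inv; last 2 first.
- by move=> x _; exact: bessel_integrand_ge0.
- by move=> x; exact: continuous_bessel_integrand.
rewrite /besselK mulrA mulfV// mul1r; apply: eq_Rintegral => x.
rewrite inE => /half_lineP x0.
have -> : 2 * Num.sqrt (a * b) / 2 = y by rewrite mulrAC mulfV// mul1r.
rewrite invrK mulrDr opprD expRD -!mulrA mulrCA; congr (_ * (_ * _)).
rewrite -powR_inv1 ?(ltW x0)// -powRrM -powR_invn ?(ltW x0)// -powRD ?(gt_eqF x0) ?implybT//.
rewrite -powRD ?(gt_eqF x0) ?implybT//; congr (_ `^ _); ring.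
Qed.

End Bessel.

(** Part of the exponential absorbs 1 + a / 2, leaving one pure power of a times a decaying
    exponential, the shape from which a Bessel-type dominating function is built. *)
Lemma sum_natM_expR_le2 (R : realType) (a : R) (N : nat) : 0 < a ->
  \sum_(n < N) n.+1%:R * expR (- (a * n.+1%:R)) <= 8 * a ^- 2 * expR (- (a / 4)).
Proof.
move=> a0; apply: le_trans (sum_natM_expR_le N a0) _.
have h := expR_ge1Dx (a / 4).
have -> : expR (- (a / 2)) = expR (- (a / 4)) * expR (- (a / 4)) :> R.
  by rewrite -expRD; congr expR; field.
rewrite mulrA; apply: ler_wpM2r; first exact: expR_ge0.
rewrite expRN ler_pdivrMr ?expR_gt0//.
have -> : 2 / a * (1 + 2 / a) = 8 * a ^- 2 * ((1 + a / 2) / 2).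
  by field; rewrite gt_eqF.
rewrite ler_pM2l; first lra.
by rewrite mulr_gt0// invr_gt0 exprn_gt0.
Qed.

Section DoubleSeries.
Context (R : realType) (c : nat -> R) (k C : R) (sigma : R -> R).
Hypothesis k0 : 0 < k.
Hypothesis C0 : 0 <= C.
Hypothesis c_le : forall n, `|c n| <= C * n.+1%:R.
Local Notation mu := (@lebesgue_measure R).
Local Notation D := (`]0, +oo[%classic : set R).
Local Notation lam n := (k * (n%:R + 2^-1)).
Hypothesis sigmaE : forall x : R, 0 < x ->
  series (fun m => c m * expR (- (lam m * x))) @ \oo --> sigma x.

Let lam_gt0 n : 0 < lam n.
Proof. by rewrite mulr_gt0//; have := ler0n R n; lra. Qed.

(** The constants of the bound [W]: since m + 1/2 >= (m + 1) / 2, [sum_natM_expR_le2] applies with a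
    = k x / 2, giving 8 (k x / 2)^(-2) = 32 / (k x)^2 and exp(- k x / 8). In W(x) W(1/x) the powers
    of x cancel, and K^2 exp(- b x - b / x) remains. *)
Let b := k / 8.
Let b0 : 0 < b. Proof. by rewrite divr_gt0. Qed.
Let K := C * (32 / k ^+ 2).
Let K0 : 0 <= K. Proof. by rewrite mulr_ge0// divr_ge0// exprn_ge0// ltW. Qed.
Let W (x : R) : R := K * (x `^ (- 2) * expR (- (b * x))).

Let sum_le_W (x : R) (N : nat) : 0 < x ->
  \sum_(0 <= m < N) `|c m * expR (- (lam m * x))| <= W x.
Proof.
move=> x0; have kx0 : 0 < k * x / 2 by rewrite divr_gt0// mulr_gt0.
apply: (@le_trans _ _ (C * \sum_(m < N) m.+1%:R * expR (- (k * x / 2 * m.+1%:R)))).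
  rewrite big_mkord mulr_sumr; apply: ler_sum => m _.
  rewrite normrM mulrA; apply: ler_pM => //.
  rewrite ger0_norm ?expR_ge0// ler_expR lerN2 -[m.+1%:R]natr1.
  have m0 := ler0n R m; have kx : 0 < k * x by rewrite mulr_gt0.
  move: (m%:R : R) m0 => t t0.
  by rewrite -subr_ge0 (_ : _ - _ = k * x * t / 2); [rewrite divr_ge0// mulr_ge0// ltW|field].
apply: (@le_trans _ _ (C * (8 * (k * x / 2) ^- 2 * expR (- (k * x / 2 / 4))))).
  by apply: ler_wpM2l => //; exact: sum_natM_expR_le2.
rewrite /W /K powR_invn ?(ltW x0)// le_eqVlt; apply/orP; left; apply/eqP.
have -> : k * x / 2 / 4 = b * x by rewrite /b; field.
by field; rewrite !gt_eqF.
Qed.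

Let term_le_W (x : R) (m : nat) : 0 < x -> `|c m * expR (- (lam m * x))| <= W x.
Proof.
move=> x0; apply: le_trans (sum_le_W m.+1 x0).
by rewrite big_nat_recr//= lerDr; apply: sumr_ge0.
Qed.

Let partial_le_W (x : R) (N : nat) : 0 < x ->
  `|series (fun m => c m * expR (- (lam m * x))) N| <= W x.
Proof. by move=> x0; apply: le_trans (ler_norm_sum _ _ _) _; exact: sum_le_W. Qed.

Let sigma_le_W (x : R) : 0 < x -> `|sigma x| <= W x.
Proof.
move=> x0; have h : (fun N => `|series (fun m => c m * expR (- (lam m * x))) N|) @ \oo --> `|sigma x|.
  by apply: cvg_norm; exact: sigmaE.
rewrite -(cvg_lim (@Rhausdorff R) h); apply: limr_le; first by apply/cvg_ex; eexists; exact: h.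
by apply: nearW => N; exact: partial_le_W.
Qed.

Let measurable_expRNM a : measurable_fun D (fun x : R => expR (- (a * x))).
Proof. by apply: continuous_half_line_measurable => x _; exact: continuous_expRNM. Qed.

Let measurable_expRNV a : measurable_fun D (fun x : R => expR (- (a * x^-1))).
Proof. by apply: continuous_half_line_measurable => x; exact: continuous_expRNV. Qed.

Let measurable_powRB p : measurable_fun D (fun x : R => x `^ (p - 1)).
Proof. exact: measurable_funTS (measurable_powR _). Qed.

Let measurable_sigmaV : measurable_fun D (fun x => sigma x^-1).
Proof.
have mS N : measurable_fun D
    (fun x : R => series (fun m => c m * expR (- (lam m * x^-1))) N).
  by rewrite /series/=; apply: measurable_sum => m; apply: measurable_funM.
apply: (measurable_fun_cvg mS).
by move=> x /half_lineP x0; apply: sigmaE; rewrite invr_gt0.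
Qed.

Let dominating (p x : R) : R := W x * W x^-1 * x `^ (p - 1).

Let integrable_dominating p : mu.-integrable D (EFin \o dominating p).
Proof.
have h := integrable_scale (K ^+ 2) (integrable_bessel p b0 b0).
apply: eq_integrable h => [|x]; first exact: measurable_half_line.
rewrite inE => /half_lineP x0; rewrite /= /dominating /W; congr EFin.
have -> : x^-1 `^ (- 2) = (x `^ (- 2))^-1.
  by rewrite -powR_inv1 ?(ltW x0)// -!powRrM mulN1r opprK -powRN opprK.
by field; rewrite powR_eq0 gt_eqF.
Qed.

Definition sigma_product (p x : R) : R := sigma x * sigma x^-1 * x `^ (p - 1).

Let inner_series p m :
  [/\ mu.-integrable D (EFin \o (fun x => c m * expR (- (lam m * x)) * (sigma x^-1 * x `^ (p - 1)))) &
   series (fun n => c m * c n * bessel_integral p (lam m) (lam n)) @ \oo -->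
   \int[mu]_(x in D) (c m * expR (- (lam m * x)) * (sigma x^-1 * x `^ (p - 1)))].
Proof.
pose f n (x : R) : R := c m * c n *
  (expR (- (lam m * x)) * expR (- (lam n / x)) * x `^ (p - 1)).
have E (x : R) N : series (f^~ x) N =
    c m * expR (- (lam m * x)) * (series (fun n => c n * expR (- (lam n * x^-1))) N * x `^ (p - 1)).
  rewrite /series/= mulr_suml mulr_sumr; apply: eq_bigr => n _.
  by rewrite /f; ring.
have [|x x0|N x x0|_ iF h] := @Rintegral_series_cvg _ f
  (fun x => c m * expR (- (lam m * x)) * (sigma x^-1 * x `^ (p - 1))) _ _ _ _ (integrable_dominating p).
- move=> n; apply: measurable_funM => //; apply: measurable_funM => //.
  exact: measurable_funM.
- rewrite (funext (E x)); apply: cvgM; first exact: cvg_cst.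
  by apply: cvgM; [apply: sigmaE; rewrite invr_gt0 | exact: cvg_cst].
- rewrite E /dominating normrM [X in _ * X]normrM (ger0_norm (powR_ge0 _ _)) mulrA.
  apply: ler_wpM2r; first exact: powR_ge0.
  by apply: ler_pM => //; [exact: term_le_W | apply: partial_le_W; rewrite invr_gt0].
split => //; rewrite (_ : series _ = series (fun n => \int[mu]_(x in D) f n x))//.
congr series; apply/funext => n.
by rewrite /f RintegralZl; [|exact: measurable_half_line|exact: integrable_bessel].
Qed.

(** The order follows [double_series_sum]: [inner_series] expands sigma(1/x) with m fixed, and then
    sigma(x) is expanded against the whole of sigma(1/x) x^(p - 1). *)
Lemma double_series_bessel p :
  mu.-integrable D (EFin \o sigma_product p) /\
  double_series_sum (fun m n => c m * c n * bessel_integral p (lam m) (lam n))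
    (\int[mu]_(x in D) sigma_product p x).
Proof.
pose f m (x : R) : R := c m * expR (- (lam m * x)) * (sigma x^-1 * x `^ (p - 1)).
have E (x : R) N : series (f^~ x) N =
    series (fun m => c m * expR (- (lam m * x))) N * (sigma x^-1 * x `^ (p - 1)).
  by rewrite /series/= mulr_suml.
have [|x x0|N x x0|_ iF h] := @Rintegral_series_cvg _ f (sigma_product p) _ _ _ _ (integrable_dominating p).
- move=> m; apply: measurable_funM; last exact: measurable_funM.
  exact: measurable_funM.
- rewrite (funext (E x)) /sigma_product -mulrA; apply: cvgM; last exact: cvg_cst.
  exact: sigmaE.
- rewrite E /dominating normrM [X in _ * X]normrM (ger0_norm (powR_ge0 _ _)) mulrA.
  apply: ler_wpM2r; first exact: powR_ge0.
  by apply: ler_pM => //; [exact: partial_le_W | apply: sigma_le_W; rewrite invr_gt0].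
split => //; split=> [m|]; first by have [_ hm] := inner_series p m; apply/cvg_ex; eexists; exact: hm.
rewrite (_ : series _ = series (fun m => \int[mu]_(x in D) f m x))//.
congr series; apply/funext => m.
by have [_ hm] := inner_series p m; rewrite (cvg_lim (@Rhausdorff R) hm).
Qed.

End DoubleSeries.

(** * Theta as a power series, and the coefficients of its square root *)

Section SquareCoefficients.
Context (R : realType) (q : nat) (chi : int -> R).
Hypothesis q_gt1 : (1 < q)%N.
Hypothesis chi_char : real_dirichlet_character q chi.

(* theta(x) / 2 is the power series in exp(- pi x / q) with these coefficients. *)
Definition square_coef (j : nat) : R :=
  if [pick n : 'I_j.+1 | (n ^ 2 == j)%N] is Some n
  then n%:R ^+ parity chi * chi n else 0.

Lemma square_coefE (n : nat) : square_coef (n ^ 2) = n%:R ^+ parity chi * chi n.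
Proof.
rewrite /square_coef; case: pickP => [m|/(_ (inord n))].
  by rewrite eqn_exp2r// => /eqP ->.
by rewrite inordK ?eqxx// ltnS leqn_sqr.
Qed.

Lemma square_coef_eq0 (j : nat) : (forall n, (n ^ 2)%N != j) -> square_coef j = 0.
Proof.
by move=> nj; rewrite /square_coef; case: pickP => // n; rewrite (negbTE (nj n)).
Qed.

Lemma square_coef_le (j : nat) : `|square_coef j| <= j%:R.
Proof.
rewrite /square_coef; case: pickP => [n /eqP nj|_]; last by rewrite normr0.
apply: le_trans (natX_chi_le q_gt1 chi_char n) _.
by rewrite -[X in _ <= X%:R]nj ler_nat leqn_sqr.
Qed.

Lemma sum_square_coef (z : R) (K : nat) :
  \sum_(0 <= j < K ^ 2) square_coef j * z ^+ j =
  \sum_(0 <= n < K) n%:R ^+ parity chi * chi n * z ^+ (n ^ 2).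
Proof.
elim: K => [|K IH]; first by rewrite !big_geq.
rewrite [RHS]big_nat_recr//= -IH (@big_cat_nat _ _ _ (K ^ 2))//=; last by rewrite leq_exp2r.
congr (_ + _); rewrite big_ltn; last by rewrite ltn_exp2r.
rewrite square_coefE big_nat_cond big1 ?addr0// => j; rewrite andbT => /andP[h1 h2].
rewrite square_coef_eq0 ?mul0r// => n; apply/eqP => nj; move: h1 h2.
by rewrite -nj ltn_exp2r// ltn_exp2r// ltnS => h1; rewrite leqNgt h1.
Qed.

(** Convergence comes first, by domination; the limit is then read off along the partial sums of
    length K^2, which are those of [half_theta]. *)
Lemma series_square_coef (x : R) : 0 < x ->
  series (fun j => square_coef j * expR (- (pi * x / q%:R)) ^+ j) @ \oo --> half_theta q chi x.
Proof.
move=> x0; set z := expR _.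
have kx0 : 0 < pi * x / q%:R by apply: pixq_gt0.
have zE j : z ^+ j = expR (- (pi * x / q%:R * j%:R)) by rewrite /z -expRM_natr mulNr.
have /cvg_ex[l cl] : cvgn (series (fun j => square_coef j * z ^+ j)).
  apply: (@dominated_series_cvg _ _ (fun j => j%:R * expR (- (pi * x / q%:R * j%:R)))) => [j|].
    rewrite normrM zE [X in _ * X]ger0_norm ?expR_ge0//.
    by apply: ler_wpM2r; [exact: expR_ge0 | exact: square_coef_le].
  exact: is_cvg_natM_expR.
suff -> : half_theta q chi x = l by [].
have c2 : (fun K => series (fun j => square_coef j * z ^+ j) (K ^ 2)%N) @ \oo --> l.
  apply: (cvg_comp _ _ _ cl); apply/cvgnyPge => A.
  by exists A => // K /= AK; apply: leq_trans (leqn_sqr K).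
have E K : series (fun j => square_coef j * z ^+ j) (K ^ 2)%N = series (half_theta_term q chi x) K.
  rewrite /series/= sum_square_coef; apply: eq_bigr => n _; rewrite zE natrX.
  by congr (_ * expR _); ring.
rewrite (funext E) in c2.
exact: (cvg_lim (@Rhausdorff R) c2).
Qed.

Section Coefficients.
Context (c : nat -> R).
Hypothesis theta_gt0 : forall x : R, 0 < x -> 0 < theta q chi x.
Hypothesis c_chi : theta_power_coefficients q chi (1 / 2) c.

Lemma half_theta_gt0 (x : R) : 0 < x -> 0 < half_theta q chi x.
Proof.
by move=> x0; have := theta_gt0 x0; rewrite (theta_half_theta q_gt1 chi_char)// pmulr_rgt0.
Qed.

Lemma sqrt_half_theta_series (x : R) : 0 < x ->
  series (fun m => c m * expR (- (pi / q%:R * (m%:R + 2^-1) * x))) @ \oo -->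
  Num.sqrt (half_theta q chi x).
Proof.
move=> x0; have T0 := half_theta_gt0 x0.
have := c_chi x0; rewrite (theta_half_theta q_gt1 chi_char)// div1r.
rewrite powRM ?(ltW T0)// !powR12_sqrt ?(ltW T0)//.
have s2 : Num.sqrt 2 != 0 :> R by rewrite gt_eqF// sqrtr_gt0.
move=> h; have : (fun M => (Num.sqrt 2)^-1 * (Num.sqrt 2 * series (fun m => c m *
    expR (- (pi * (m%:R + 2^-1) * x / q%:R))) M)) @ \oo -->
    (Num.sqrt 2)^-1 * (Num.sqrt 2 * Num.sqrt (half_theta q chi x)).
  by apply: cvgM => //; exact: cvg_cst.
rewrite mulKf//; apply: cvg_trans; apply: near_eq_cvg; apply: nearW => M.
rewrite mulKf// /series/=; apply: eq_bigr => m _.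
by congr (_ * expR _); ring.
Qed.

(** In the variable z = exp(- pi x / q) the sum of c_m z^m is z^(-1/2) times the square root of
    theta / 2; this is [G]. Its square is theta / (2 z), so the convolution of c with itself at k is
    [square_coef] at k + 1, which is at most k + 1, and [coef_bound] applies. *)
Lemma sqrt_coef_bound (n : nat) : `|c n| <= 3 * expR 2 * n.+1%:R.
Proof.
have q0 : 0 < q%:R :> R by rewrite ltr0n; lia.
have k0 : 0 < pi / q%:R :> R by rewrite divr_gt0// pi_gt0.
pose x_ (z : R) := - ln z / (pi / q%:R).
have x0 (z : R) : 0 < z < 1 -> 0 < x_ z.
  by move=> z01; rewrite divr_gt0// oppr_gt0 ln_lt0.
have xE (z : R) : 0 < z < 1 -> pi / q%:R * x_ z = - ln z.
  by move=> _; rewrite /x_ mulrC divfK// gt_eqF.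
have zE (z : R) : 0 < z < 1 -> z = expR (- (pi * x_ z / q%:R)).
  by move=> z01; rewrite mulrAC xE// opprK lnK// posrE; case/andP: z01.
pose G (z : R) := expR (pi / q%:R * 2^-1 * x_ z) * Num.sqrt (half_theta q chi (x_ z)).
have cG (z : R) : 0 < z < 1 -> series (fun m => c m * z ^+ m) @ \oo --> G z.
  move=> z01; have h := sqrt_half_theta_series (x0 _ z01).
  have E N : series (fun m => c m * z ^+ m) N = expR (pi / q%:R * 2^-1 * x_ z) *
      series (fun m => c m * expR (- (pi / q%:R * (m%:R + 2^-1) * x_ z))) N.
    rewrite /series/= mulr_sumr; apply: eq_bigr => m _.
    rewrite mulrCA -expRD [in LHS](zE z z01) -expRM_natr; congr (_ * expR _); ring.
  by rewrite (funext E); apply: cvgM => //; exact: cvg_cst.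
have GE (z : R) : 0 < z < 1 -> G z * G z = z^-1 * half_theta q chi (x_ z).
  move=> z01; have T0 := half_theta_gt0 (x0 _ z01).
  rewrite mulrACA -expRD -expr2 sqr_sqrtr ?(ltW T0)//; congr (_ * _).
  rewrite [in RHS](zE z z01) expRN invrK; congr expR.
  have E (P Q X : R) : Q != 0 -> P / Q * 2^-1 * X + P / Q * 2^-1 * X = P * X / Q by move=> ?; field.
  by rewrite E// gt_eqF.
apply: (@coef_bound _ c (fun k => square_coef k.+1)) => [k|k|z z01]; last 2 first.
- exact: square_coef_le.
- by apply/cvg_ex; exists (G z); exact: cG.
apply/eqP; rewrite -subr_eq0; apply/eqP.
pose e k : R := \sum_(i < k.+1) c i * c (k - i)%N - square_coef k.+1.
suff : forall k, e k = 0 by apply.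
apply: (@pseries_eq0 _ 1) => // z z01; have /andP[z0 z1] := z01.
have cn : cvgn [normed series (fun m => c m * z ^+ m)].
  apply: (@pseries_cvg_norm _ c 1) => [y y01|]; last by rewrite gtr0_norm.
  by apply/cvg_ex; exists (G y); exact: cG.
have cc : cvgn (series (fun m => c m * z ^+ m)) by apply/cvg_ex; exists (G z); exact: cG.
have h1 := mertens cn cc.
rewrite (cvg_lim (@Rhausdorff R) (cG z z01)) GE// in h1.
have h2 : (fun n => z^-1 * series (fun j => square_coef j * z ^+ j) n.+1) @ \oo -->
    z^-1 * half_theta q chi (x_ z).
  apply: cvgM; first exact: cvg_cst.
  have := series_square_coef (x0 _ z01); rewrite -(zE z z01) => h.
  by rewrite -cvg_shiftS in h.
rewrite -(subrr (z^-1 * half_theta q chi (x_ z))).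
rewrite (_ : series _ = (series (fun n => \sum_(i < n.+1) c i * z ^+ i * (c (n - i)%N * z ^+ (n - i)))
   \- (fun n => z^-1 * series (fun j => square_coef j * z ^+ j) n.+1))); first exact: cvgB.
apply/funext => N; rewrite /= /series/= big_nat_recl//.
have -> : square_coef 0 = 0 by rewrite (square_coefE 0) (chi0 q_gt1 chi_char) mulr0.
rewrite mul0r add0r.
rewrite mulr_sumr -sumrB; apply: eq_bigr => j _; rewrite /e mulrBl; congr (_ - _).
  rewrite mulr_suml; apply: eq_bigr => i _.
  have -> : z ^+ j = z ^+ i * z ^+ (j - i) by rewrite -exprD subnKC// -ltnS.
  by ring.
by rewrite exprS; field; rewrite gt_eqF.
Qed.

End Coefficients.
End SquareCoefficients.

(** * Values of L *)

Section ComplexLimits.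
Context (R : realType).

Lemma cvg_complex (u : nat -> R[i]) (z : R[i]) :
  (u : nat -> (R[i] : numFieldType)) @ \oo --> (z : (R[i] : numFieldType)) ->
  (fun n => complex.Re (u n)) @ \oo --> complex.Re z /\
  (fun n => complex.Im (u n)) @ \oo --> complex.Im z.
Proof.
move=> h.
have H (e : R) : 0 < e -> \forall n \near \oo, `|z - u n| < e%:C.
  by move=> e0; move/cvgrPdist_lt : h => /(_ e%:C); apply; rewrite ltcR.
have le_norm (w : R[i]) (e : R) : `|w| < e%:C -> `|complex.Re w| < e /\ `|complex.Im w| < e.
  rewrite normc_def ltcR => we; split; apply: le_lt_trans we.
    by rewrite -sqrtr_sqr ler_wsqrtr// lerDl sqr_ge0.
  by rewrite -sqrtr_sqr ler_wsqrtr// lerDr sqr_ge0.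
split; apply/cvgrPdist_lt => e e0; apply: filterS (H e e0) => n /le_norm[].
  by move=> h1 _; rewrite -(raddfB (@complex.Re R)).
by move=> _ h2; rewrite -(raddfB (@complex.Im R)).
Qed.

Lemma ReM_real (a : R[i]) (x : R) : complex.Re (a * x%:C) = complex.Re a * x.
Proof. by case: a => a1 a2 /=; rewrite mulr0 subr0. Qed.

Lemma ImM_real (a : R[i]) (x : R) : complex.Im (a * x%:C) = complex.Im a * x.
Proof. by case: a => a1 a2 /=; rewrite mulr0 add0r. Qed.

Lemma analytic_at_real (L : R[i] -> R[i]) (s0 : R) : analytic_at L s0%:C ->
  real_analytic_at (fun s => complex.Re (L s%:C)) s0 /\
  real_analytic_at (fun s => complex.Im (L s%:C)) s0.
Proof.
case=> r r0 [a aL].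
have cL (s : R) : `|s - s0| < r ->
    series (fun k => complex.Re (a k) * (s - s0) ^+ k) @ \oo --> complex.Re (L s%:C) /\
    series (fun k => complex.Im (a k) * (s - s0) ^+ k) @ \oo --> complex.Im (L s%:C).
  move=> sr; have rE : s%:C - s0%:C = (s - s0)%:C :> R[i] by rewrite rmorphB.
  have /aL/cvg_complex[h1 h2] : `|s%:C - s0%:C| < r%:C by rewrite rE normc_real ltcR.
  split; [move: h1 | move: h2]; apply: cvg_trans; apply: near_eq_cvg; apply: nearW => N;
    rewrite /series/= raddf_sum; apply: eq_bigr => k _; rewrite rE -rmorphXn.
    exact: ReM_real.
  exact: ImM_real.
by split; exists r => //; [exists (fun k => complex.Re (a k)) | exists (fun k => complex.Im (a k))]
  => s /cL[].
Qed.

Lemma complex_exp_real (x : R) : complex_exp x%:C = (expR x)%:C.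
Proof. by rewrite /complex_exp /= cos0 sin0 mulr1. Qed.

Lemma dirichlet_L_real_series (chi : int -> R) (L : R[i] -> R[i]) (s : R) :
  is_dirichlet_L chi L -> 1 < s ->
  series (fun n => chi (Posz n.+1) * n.+1%:R `^ (- s)) @ \oo --> complex.Re (L s%:C) /\
  complex.Im (L s%:C) = 0.
Proof.
move=> [_ hL] s1; have /cvg_complex[h1 h2] := hL s%:C s1.
have E n : (chi (Posz n.+1))%:C * complex_exp (- s%:C * (ln (n.+1%:R : R))%:C) =
    (chi (Posz n.+1) * n.+1%:R `^ (- s))%:C.
  rewrite -rmorphN -rmorphM complex_exp_real -rmorphM powR_expR//.
rewrite (funext E) in h1 h2.
split.
  move: h1; apply: cvg_trans; apply: near_eq_cvg; apply: nearW => N.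
  by rewrite /series/= raddf_sum.
rewrite -(cvg_lim (@Rhausdorff R) h2); apply/cvg_lim => //.
rewrite (_ : (fun n => _) = fun=> 0); first exact: cvg_cst.
by apply/funext => N; rewrite /series/= raddf_sum big1.
Qed.

(** For s > 1 the series has real terms; the identity theorem carries the vanishing down to 0. *)
Lemma dirichlet_L_Im_eq0 (chi : int -> R) (L : R[i] -> R[i]) (s : R) :
  is_dirichlet_L chi L -> 0 < s -> complex.Im (L s%:C) = 0.
Proof.
move=> L_chi; apply: (@real_analytic_eq0 _ (fun s => complex.Im (L s%:C)) 0 1) => [t _|t t1].
  by have [_] := analytic_at_real (L_chi.1 t%:C).
by have [] := dirichlet_L_real_series L_chi t1.
Qed.

Lemma real_analytic_at_half (F : R -> R) (d s0 : R) :
  real_analytic_at F ((s0 + d) / 2) -> real_analytic_at (fun s => F ((s + d) / 2)) s0.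
Proof.
case=> r r0 [a aF]; exists r => //; exists (fun k => a k * 2^-1 ^+ k) => s sr.
have E : (s + d) / 2 - (s0 + d) / 2 = 2^-1 * (s - s0) by field.
have /aF : `|(s + d) / 2 - (s0 + d) / 2| < r.
  rewrite E normrM ger0_norm ?invr_ge0//; have := normr_ge0 (s - s0); lra.
apply: cvg_trans; apply: near_eq_cvg; apply: nearW => N.
by rewrite /series/=; apply: eq_bigr => k _; rewrite E exprMn mulrA.
Qed.

End ComplexLimits.

Lemma double_series_sumZ (R : realType) (u v : nat -> nat -> R) (r S : R) :
  (forall m n, v m n = r * u m n) -> double_series_sum u S -> double_series_sum v (r * S).
Proof.
move=> vE [cu cS].
have cv m : series (v m) @ \oo --> r * limn (series (u m)).
  rewrite (_ : series (v m) = fun N => r * series (u m) N).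
    by apply: cvgM; [exact: cvg_cst | exact: cu].
  by apply/funext => N; rewrite /series/= mulr_sumr; apply: eq_bigr => n _.
split=> [m|]; first by apply/cvg_ex; exists (r * limn (series (u m))); exact: cv.
rewrite (_ : series _ = fun N => r * series (fun m => limn (series (u m))) N).
  by apply: cvgM => //; exact: cvg_cst.
apply/funext => N; rewrite /series/= mulr_sumr; apply: eq_bigr => m _.
exact: (cvg_lim (@Rhausdorff R) (cv m)).
Qed.

Lemma powRD_gt0 (R : realType) (x a b : R) : 0 < x -> x `^ (a + b) = x `^ a * x `^ b.
Proof. by move=> x0; apply: powRD; apply/implyP => _; rewrite gt_eqF. Qed.

Section LValues.
Context (R : realType) (q : nat) (chi : int -> R) (L : R[i] -> R[i]) (c : nat -> R).
Hypothesis q_gt1 : (1 < q)%N.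
Hypothesis chi_char : real_dirichlet_character q chi.
Hypothesis chi_prim : primitive_character q chi.
Hypothesis theta_gt0 : forall x : R, 0 < x -> 0 < theta q chi x.
Hypothesis L_chi : is_dirichlet_L chi L.
Hypothesis c_chi : theta_power_coefficients q chi (1 / 2) c.
Local Notation mu := (@lebesgue_measure R).
Local Notation D := (`]0, +oo[%classic : set R).
Local Notation k := (pi / q%:R : R).
Local Notation d := ((parity chi)%:R : R).
Local Notation T := (half_theta q chi).
Local Notation sigma := (fun x => Num.sqrt (half_theta q chi x)).

Let k_gt0 : 0 < k.
Proof. by rewrite divr_gt0 ?pi_gt0// ltr0n; lia. Qed.

Let T_gt0 (x : R) : 0 < x -> 0 < T x.
Proof. by move=> x0; apply: half_theta_gt0. Qed.

Lemma sqrt_half_theta_inv (x : R) : 0 < x -> sigma x^-1 = x `^ (d / 2 + 1 / 4) * sigma x.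
Proof.
move=> x0; rewrite /= (half_theta_inv q_gt1 chi_char chi_prim theta_gt0)//.
have -> : x ^+ parity chi * Num.sqrt x = (x `^ (d / 2 + 1 / 4)) ^+ 2.
  rewrite -powR12_sqrt ?(ltW x0)// -(powR_mulrn (parity chi) (ltW x0)).
  by rewrite expr2 -!(powRD_gt0 _ _ x0); congr (_ `^ _); field.
by rewrite sqrtrM ?sqr_ge0// sqrtr_sqr ger0_norm// powR_ge0.
Qed.

Lemma half_theta_sigma_product (u x : R) : 0 < x ->
  T x * x `^ (u - 1) = sigma_product sigma (u - 1 / 4 - d / 2) x.
Proof.
move=> x0; rewrite /sigma_product sqrt_half_theta_inv// mulrCA -expr2 sqr_sqrtr ?(ltW (T_gt0 x0))//.
by rewrite mulrAC -(powRD_gt0 _ _ x0) mulrC; congr (_ `^ _ * _); field.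
Qed.

Let double_series_sigma p :
  mu.-integrable D (EFin \o sigma_product sigma p) /\
  double_series_sum (fun m n => c m * c n *
      bessel_integral p (k * (m%:R + 2^-1)) (k * (n%:R + 2^-1)))
    (\int[mu]_(x in D) sigma_product sigma p x).
Proof.
have C0 : 0 <= 3 * expR 2 :> R by rewrite mulr_ge0 ?expR_ge0.
apply: (@double_series_bessel R c k (3 * expR 2)) => //.
  exact: (sqrt_coef_bound q_gt1 chi_char theta_gt0 c_chi).
exact: (sqrt_half_theta_series q_gt1 chi_char theta_gt0 c_chi).
Qed.

(** Any real u is allowed: written as a [sigma_product], the integrand decays exponentially at
    infinity through sigma(x) and at 0 through sigma(1/x). *)
Lemma integrable_half_theta (u : R) :
  mu.-integrable D (EFin \o (fun x => T x * x `^ (u - 1))).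
Proof.
apply: (eq_integrable _ _ _ _ (double_series_sigma (u - 1 / 4 - d / 2)).1).
  exact: measurable_half_line.
by move=> x; rewrite inE => /half_lineP x0 /=; rewrite half_theta_sigma_product.
Qed.

Lemma measurable_half_theta : measurable_fun D T.
Proof.
have /measurable_int/measurable_EFinP := integrable_half_theta 1.
by congr (measurable_fun _ _); apply/funext => x /=; rewrite subrr powRr0 mulr1.
Qed.

Lemma mellin_half_theta_analytic (u : R) : real_analytic_at (mellin T) u.
Proof.
apply: (@mellin_analytic _ _ (u - 1)); first exact: measurable_half_theta.
  by move=> s _; exact: integrable_half_theta.
by rewrite ltrBlDr ltrDl.
Qed.

Lemma mellin_expR_analytic (u : R) : 0 < u ->
  real_analytic_at (mellin (fun x => expR (- (k * x)))) u.
Proof.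
move=> u0; apply: (@mellin_analytic _ _ 0) => //.
  apply: continuous_half_line_measurable => x x0; exact: continuous_expRNM.
move=> s s0; have := integrable_powR_expR s0 k_gt0.
by congr (mu.-integrable D (EFin \o _)); apply/funext => x; rewrite mulrC.
Qed.

(** The bound on the partial sums of theta costs x^(-2) at 0, so term by term integration asks for u
    > 2, which s > 4 ensures for both parities. The n-th term gives n^d chi(n) (k n^2)^(- u)
    Gamma(u), and n^(d - 2u) = n^(- s). *)
Lemma mellin_half_theta_large (s : R) : 4 < s ->
  complex.Re (L s%:C) * mellin (fun x => expR (- (k * x))) ((s + d) / 2) =
  mellin T ((s + d) / 2).
Proof.
move=> s4; set u := (s + d) / 2.
have d0 : 0 <= d by [].
have u2 : 2 < u by rewrite /u; lra.
have u0 : 0 < u by lra.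
rewrite mellin_expR//.
pose f n (x : R) : R := half_theta_term q chi x n.+1 * x `^ (u - 1).
pose g (x : R) : R := 8 * k ^- 2 * (x `^ (u - 2 - 1) * expR (- (k / 4 * x))).
pose e (n : nat) : R := n.+1%:R ^+ parity chi * chi (Posz n.+1).
pose cn (n : nat) : R := k * n.+1%:R ^+ 2.
have cn0 n : 0 < cn n by rewrite mulr_gt0// exprn_gt0.
have fE n x : f n x = e n * (expR (- (cn n * x)) * x `^ (u - 1)).
  rewrite /f /half_theta_term /e /cn -!mulrA; congr (_ * (_ * (expR _ * _))).
  by rewrite !mulrA; congr (- _); ring.
have fi n : mu.-integrable D (EFin \o (fun x => expR (- (cn n * x)) * x `^ (u - 1))).
  have := integrable_powR_expR u0 (cn0 n).
  by congr (mu.-integrable D (EFin \o _)); apply/funext => x; rewrite mulrC.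
have [||||_ _ h] := @Rintegral_series_cvg R f (fun x => T x * x `^ (u - 1)) g.
- move=> n; rewrite (funext (fE n)); apply: measurable_funM => //.
  by have /measurable_int/measurable_EFinP := fi n.
- move=> x x0; rewrite (_ : series _ = fun N => series (fun n => half_theta_term q chi x n.+1) N *
      x `^ (u - 1)); last by apply/funext => N; rewrite /series/= mulr_suml.
  apply: cvgM; last exact: cvg_cst.
  exact: (cvg_half_theta_succ q_gt1 chi_char x0).
- move=> N x x0.
  rewrite (_ : series _ N = series (fun n => half_theta_term q chi x n.+1) N * x `^ (u - 1));
    last by rewrite /series/= mulr_suml.
  rewrite normrM [X in _ * X]ger0_norm ?powR_ge0//.
  have kx0 : 0 < k * x by rewrite mulr_gt0.
  apply: (@le_trans _ _ (8 * (k * x) ^- 2 * expR (- (k * x / 4)) * x `^ (u - 1))).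
    apply: ler_wpM2r; first exact: powR_ge0.
    apply: le_trans (sum_natM_expR_le2 N kx0).
    rewrite /series/= big_mkord; apply: le_trans (ler_norm_sum _ _ _) _.
    apply: ler_sum => n _; apply: le_trans (half_theta_term_le q_gt1 chi_char _ x0) _.
    by rewrite [pi * x / _]mulrAC.
  have -> : x `^ (u - 1) = x ^+ 2 * x `^ (u - 2 - 1).
    rewrite -(powR_mulrn 2 (ltW x0)) -(powRD_gt0 _ _ x0); congr (_ `^ _); ring.
  have E (K X P Y : R) : K != 0 -> X != 0 ->
      8 * (K * X) ^- 2 * Y * (X ^+ 2 * P) = 8 * K ^- 2 * (P * Y).
    by move=> K0 X0; field; rewrite K0 X0.
  rewrite E ?(gt_eqF k_gt0) ?(gt_eqF x0)// /g.
  by rewrite [k * x / 4]mulrAC.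
- have k4 : 0 < k / 4 by rewrite divr_gt0.
  have u20 : 0 < u - 2 by lra.
  exact: (integrable_scale (8 * k ^- 2) (integrable_powR_expR u20 k4)).
have fI n : \int[mu]_(x in D) f n x =
    k `^ (- u) * Gamma u * (chi (Posz n.+1) * n.+1%:R `^ (- s)).
  rewrite (funext (fE n)) RintegralZl; [|exact: measurable_half_line|exact: fi].
  have := mellin_expR (cn0 n) u0; rewrite /mellin => ->.
  have n0 : 0 < n.+1%:R :> R by [].
  rewrite /cn powRM ?(ltW k_gt0) ?exprn_ge0// -(powR_mulrn 2 (ltW n0)) -powRrM.
  rewrite /e -(powR_mulrn (parity chi) (ltW n0)).
  have -> : n.+1%:R `^ (- s) = n.+1%:R `^ d * n.+1%:R `^ (2 * - u) :> R.
    by rewrite -(powRD_gt0 _ _ n0); congr (_ `^ _); rewrite /u; field.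
  by ring.
rewrite (funext fI) in h.
have s1 : 1 < s by lra.
have [h2 _] := dirichlet_L_real_series L_chi s1.
rewrite mulrC /mellin -(cvg_lim (@Rhausdorff R) h); apply/esym/cvg_lim => //.
rewrite (_ : series _ = fun N => k `^ (- u) * Gamma u *
    series (fun n => chi (Posz n.+1) * n.+1%:R `^ (- s)) N).
  by apply: cvgM => //; exact: cvg_cst.
by apply/funext => N; rewrite /series/= mulr_sumr.
Qed.

(** The factor k^(- u) Gamma(u) is kept as the Mellin transform of exp(- k x), so that its
    analyticity is again a case of [mellin_analytic]. *)
Lemma mellin_half_thetaE (s : R) : 0 < s ->
  complex.Re (L s%:C) * mellin (fun x => expR (- (k * x))) ((s + d) / 2) =
  mellin T ((s + d) / 2).
Proof.
move=> s0; apply/eqP; rewrite -subr_eq0; apply/eqP; move: s s0.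
have d0 : 0 <= d by [].
apply: (@real_analytic_eq0 _ (fun s => complex.Re (L s%:C) *
    mellin (fun x => expR (- (k * x))) ((s + d) / 2) - mellin T ((s + d) / 2)) 0 4).
  move=> s s0; apply: real_analytic_atB.
    apply: real_analytic_atM; first by have [] := analytic_at_real (L_chi.1 s%:C).
    apply: (@real_analytic_at_half _ (mellin (fun x => expR (- (k * x))))).
    by apply: mellin_expR_analytic; lra.
  by apply: real_analytic_at_half; exact: mellin_half_theta_analytic.
by move=> s s4; rewrite mellin_half_theta_large ?subrr.
Qed.

(** Here s = 2p + 1/2 and u = (s + d) / 2 = p + 1/4 + d/2; the condition on p says s > 0. *)
Lemma L_value_double_series (p : R) : 0 < p + 1 / 4 ->
  exists2 S : R,
    double_series_sum (fun m n : nat =>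
      c m * c n * ((2 * n%:R + 1) / (2 * m%:R + 1)) `^ (p / 2) *
      besselK p (k * Num.sqrt ((2 * m%:R + 1) * (2 * n%:R + 1)))) S &
    L (2 * p + 1 / 2)%:C =
      (2 * (k `^ (p + 1 / 4 + d / 2) / Gamma (p + 1 / 4 + d / 2)) * S)%:C.
Proof.
move=> p0; have [_ hS] := double_series_sigma p.
set I := (X in double_series_sum _ X) in hS.
have d0 : 0 <= d by [].
have s0 : 0 < 2 * p + 1 / 2 by lra.
(* The factor 2 of [bessel_integralE] is taken out of every term. *)
exists (2^-1 * I).
  apply: double_series_sumZ hS => m n.
  have m0 : 0 < m%:R + 2^-1 :> R by have := ler0n R m; lra.
  have n0 : 0 < n%:R + 2^-1 :> R by have := ler0n R n; lra.
  rewrite (bessel_integralE _ (mulr_gt0 k_gt0 m0) (mulr_gt0 k_gt0 n0)).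
  have -> : k * (n%:R + 2^-1) / (k * (m%:R + 2^-1)) = (2 * n%:R + 1) / (2 * m%:R + 1).
    have E (N : R) : 2 * N + 1 = 2 * (N + 2^-1) by field.
    by rewrite !E -mulf_div divff ?(gt_eqF k_gt0)// mul1r -mulf_div divff ?pnatr_eq0// mul1r.
  have -> : 2 * Num.sqrt (k * (m%:R + 2^-1) * (k * (n%:R + 2^-1))) =
      k * Num.sqrt ((2 * m%:R + 1) * (2 * n%:R + 1)).
    have k2 : 0 <= k / 2 by rewrite divr_ge0// ltW.
    have -> : k * (m%:R + 2^-1) * (k * (n%:R + 2^-1)) =
        (k / 2) ^+ 2 * ((2 * m%:R + 1) * (2 * n%:R + 1)).
      have E (K M N : R) : K * (M + 2^-1) * (K * (N + 2^-1)) =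
        (K / 2) ^+ 2 * ((2 * M + 1) * (2 * N + 1)) by field.
      exact: E.
    rewrite [X in 2 * X]sqrtrM ?sqr_ge0// sqrtr_sqr ger0_norm// mulrA; congr (_ * _).
    by rewrite mulrC divfK.
  have E (x y z : R) : x * y * z = 2^-1 * (x * (2 * (y * z))) by field.
  exact: E.
have uE : (2 * p + 1 / 2 + d) / 2 = p + 1 / 4 + d / 2 by field.
have u0 : 0 < p + 1 / 4 + d / 2 by lra.
have := mellin_half_thetaE s0; rewrite uE (mellin_expR k_gt0 u0).
have -> : mellin T (p + 1 / 4 + d / 2) = I.
  rewrite /mellin /I; apply: eq_Rintegral => x; rewrite inE => /half_lineP x0.
  rewrite half_theta_sigma_product//; congr (sigma_product _ _ _); ring.
rewrite powRN => h.
have -> : L (2 * p + 1 / 2)%:C = (complex.Re (L (2 * p + 1 / 2)%:C))%:C.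
  by apply/eqP; rewrite eq_complex /= (dirichlet_L_Im_eq0 L_chi s0) !eqxx.
congr (_%:C); rewrite -h; set a := complex.Re _.
have E (B G : R) : B != 0 -> G != 0 -> a = 2 * (B / G) * (2^-1 * (a * (B^-1 * G))).
  by move=> B0 G0; field; rewrite B0 G0.
by apply: E; rewrite gt_eqF ?powR_gt0 ?Gamma_gt0.
Qed.

End LValues.

Theorem corollary2 (R : realType) (q : nat) (chi : int -> R)
    (L : R[i] -> R[i]) (c : nat -> R)
    (q_gt1 : (1 < q)%N)
    (chi_char : real_dirichlet_character q chi)
    (chi_prim : primitive_character q chi)
    (theta_gt0 : forall x : R, 0 < x -> 0 < theta q chi x)
    (L_chi : is_dirichlet_L chi L)
    (c_chi : theta_power_coefficients q chi (1 / 2) c) :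
  (exists2 S : R,
     double_series_sum (fun m n : nat =>
       c m * c n * ((2 * n%:R + 1) / (2 * m%:R + 1)) `^ (1 / 8) *
       besselK (1 / 4)
         (pi / q%:R * Num.sqrt ((2 * m%:R + 1) * (2 * n%:R + 1)))) S &
     L 1 = (2 * pi ^+ parity chi /
            q%:R `^ (1 / 2 + (parity chi)%:R / 2) * S)%:C) /\
  (exists2 S : R,
     double_series_sum (fun m n : nat =>
       c m * c n *
       besselK 0
         (pi / q%:R * Num.sqrt ((2 * m%:R + 1) * (2 * n%:R + 1)))) S &
     L (1 / 2) = (2 * (pi / q%:R) `^ ((1 + 2 * (parity chi)%:R) / 4) /
            Gamma (1 / 4 + (parity chi)%:R / 2) * S)%:C).
Proof.
have q0 : 0 < q%:R :> R by rewrite ltr0n; lia.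
have Lval (p : R) : 0 < p + 1 / 4 -> _ :=
  L_value_double_series q_gt1 chi_char chi_prim theta_gt0 L_chi c_chi (p := p).
split.
  have [|S hS LE] := Lval (1 / 4); first lra.
  have e8 : 1 / 4 / 2 = 1 / 8 :> R by field.
  exists S; first by rewrite e8 in hS.
  have e1 : 2 * (1 / 4) + 1 / 2 = 1 :> R by field.
  move: LE; rewrite e1 => ->; congr ((_ * S)%:C).
  rewrite -mulrA; congr (_ * _).
  have -> : 1 / 4 + 1 / 4 + (parity chi)%:R / 2 = 1 / 2 + (parity chi)%:R / 2 :> R by field.
  set e : R := 1 / 2 + _.
  rewrite powRM ?pi_ge0 ?invr_ge0 ?(ltW q0)// -(powR_inv1 (ltW q0)) -powRrM mulN1r powRN mulrAC.
  congr (_ / _); rewrite /e.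
  (* It remains to see that pi^((1 + d) / 2) / Gamma((1 + d) / 2) = pi^d: for d = 0 the two square
     roots of pi cancel, for d = 1 the Gamma value is 1. *)
  have Gh : Num.sqrt pi != 0 :> R by rewrite gt_eqF// sqrtr_gt0 pi_gt0.
  rewrite /parity; case: ifP => _.
    by rewrite mul0r addr0 Gamma_half div1r powR12_sqrt ?pi_ge0// divff.
  have -> : 1 / 2 + 1%:R / 2 = 1 :> R by field.
  by rewrite Gamma1 divr1 powRr1 ?pi_ge0.
have [|S hS LE] := Lval 0; first lra.
exists S.
  rewrite -[S]mul1r; apply: double_series_sumZ hS => m n.
  by rewrite mul0r powRr0 mulr1 mul1r.
have e2 : (2 * 0 + 1 / 2)%:C = 1 / 2 :> R[i].
  by rewrite mulr0 add0r !div1r fmorphV rmorph_nat.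
move: LE; rewrite e2 add0r => ->; congr ((_ * S)%:C).
by rewrite -mulrA; congr (2 * (_ `^ _ / _)); field.
Qed.
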